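(* Let $G$ be a second countable, locally compact abelian Hausdorff group and let $\Gamma\subset G$ be a closed, countable, discrete subgroup with (compact) dual group $\widehat\Gamma$ and normalized Haar measure $\lambda$ on $\widehat\Gamma$. Let $\alpha:\Gamma\to\Gamma$ be an injective group endomorphism such that $\Gamma/\alpha(\Gamma)$ is finite with $N>1$ elements and such that the dual endomorphism $\alpha^{\ast}:\widehat\Gamma\to\widehat\Gamma$, $\alpha^{\ast}(\chi)=\chi\circ\alpha$, is ergodic with respect to $\lambda$. Let $\mathcal H$ be a separable Hilbert space, let $\pi:\Gamma\to\mathcal U(\mathcal H)$ be a unitary representation whose spectral measure $\mu$ on $\widehat\Gamma$ is absolutely continuous with respect to $\lambda$, and let $\delta:\mathcal H\to\mathcal H$ be a unitary operator with $$\delta^{-1}\pi(\gamma)\delta=\pi(\alpha(\gamma))\quad\text{for all }\gamma\in\Gamma .$$ Assume that for every $0\neq f\in L^2(G)$ the family of translates $\{T_\gamma f:\gamma\in\Gamma\}$, $T_\gamma f=f(\cdot-\gamma)$, is linearly independent. Suppose $0\neq\psi\in\mathcal H$ and that its space of negative dilates $$V_0=\overline{\operatorname{span}}\{\delta^j\pi(\gamma)\psi:\ j<0,\ j\in\mathbb Z,\ \gamma\in\Gamma\}$$ is $\pi$-invariant. Then the affine system $\{\delta^j\pi(\gamma)\psi:\ j\in\mathbb Z,\ \gamma\in\Gamma\}$ is linearly independent.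
   Context: A closed subspace $V\subset\mathcal H$ is $\pi$-invariant if $\pi(\gamma)V\subset V$ for all $\gamma\in\Gamma$. A countable indexed family of vectors in a Hilbert space is linearly independent if every finite subfamily is linearly independent: a finite linear combination (over distinct indices) equal to $0$ has all coefficients $0$. Spectral measure of $\pi$: there are a finite Borel measure $\mu$ on $\widehat\Gamma$ (unique up to equivalence of measures), nested Borel subsets $\cdots\subset\sigma_2\subset\sigma_1\subset\widehat\Gamma$ (unique up to $\mu$-null sets), and a unitary operator $T:\mathcal H\to\bigoplus_i L^2(\sigma_i,\mu)$ with $[T(\pi(\gamma)f)]_i(\chi)=(\gamma,\chi)[Tf]_i(\chi)$ for all $i$, $\gamma\in\Gamma$, $f\in\mathcal H$ and $\mu$-a.e. $\chi$, where $(\gamma,\chi)$ denotes the value of the character $\chi$ at $\gamma$, and $T$ intertwines the projection valued measure of $\pi$ with multiplication by indicator functions of Borel sets. The sets $\sigma_i$ are understood so that $\mu$ is the maximal spectral type of $\pi$, i.e. $\mu(\widehat\Gamma\setminus\sigma_1)=0$. ''The spectral measure of $\pi$ is absolutely continuous'' refers to this $\mu$. *)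

(* Defs.v *)
From HB Require Import structures.
From mathcomp Require Import all_boot all_order all_algebra.
From mathcomp Require Import all_classical all_reals all_analysis.
From mathcomp Require Import complex.

Set Implicit Arguments.
Unset Strict Implicit.
Unset Printing Implicit Defensive.

Import Order.TTheory GRing.Theory Num.Theory Num.Def.
Import numFieldNormedType.Exports.
Import ComplexField.Normc.

Local Open Scope classical_set_scope.
Local Open Scope ring_scope.

(* R[i] bundled as a numClosedFieldType, so that the topology and norm that
   the library attaches to numeric fields are found on it. *)
Definition Cplx (R : realType) : numClosedFieldType := R[i].

Section Subgroup.
Variables (G : topologicalZmodType) (S : zmodClosed G).

Definition subgroup : Type := {x : G | x \in S}.

HB.instance Definition _ := [isSub of subgroup for @sval _ _].
HB.instance Definition _ := [Choice of subgroup by <:].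
HB.instance Definition _ := [SubChoice_isSubZmodule of subgroup by <:].
HB.instance Definition _ :=
  Topological.copy subgroup (initial_topology (val : subgroup -> G)).

Definition discrete_subgroup := isolated [set` S] = [set` S].

Lemma discrete_continuous (T : topologicalType) (f : subgroup -> T) :
  discrete_subgroup -> continuous f.
Proof.
move=> dS x U Ufx.
have : [set` S] (val x) by exact: valP x.
rewrite -dS => -[/= Sx [V Vx VS]].
have : nbhs x (val @^-1` V) by exact: (@initial_continuous subgroup G val x).
apply: filterS => y Vy /=.
suff -> : y = x by exact: nbhs_singleton.
apply: val_inj => /=.
have : ([set val x] : set G) (val y) by rewrite -VS; split => //; exact: valP y.
by [].
Qed.

End Subgroup.

Section Dual.
Variables (R : realType) (A : PreTopologicalZmodule.type).
Local Notation C := (Cplx R).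

Definition character : set (A -> C) :=
  [set chi : A -> C | [/\ continuous chi,
    forall a b, chi (a + b) = chi a * chi b & forall a, `|chi a| = 1]].

(* The group law of the dual, pointwise multiplication of characters, is
   written additively: its zero is the trivial character. *)
Definition dual : Type := set_type character.

Definition pairing (a : A) (chi : dual) : C := \val chi a.

HB.instance Definition _ := Choice.on dual.
HB.instance Definition _ := Topological.copy dual
  (initial_topology (fun chi : dual => \val chi : {compact-open, A -> C})).

Lemma dualP (chi : dual) : character (\val chi).
Proof. by case: chi => chi /= /set_mem. Qed.

Lemma pairing_neq0 a (chi : dual) : pairing a chi != 0.
Proof. by have [_ _ n1] := dualP chi; rewrite -normr_gt0 n1. Qed.

Lemma character1 : character (fun=> 1).
Proof.
by split=> [x|a b|a]; [exact: cvg_cst|rewrite mul1r|rewrite normr1].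
Qed.

Lemma characterM (chi xi : dual) :
  character (fun a => pairing a chi * pairing a xi).
Proof.
have [c1 m1 n1] := dualP chi; have [c2 m2 n2] := dualP xi.
split=> [x|a b|a]; first by apply: cvgM; [exact: c1|exact: c2].
  by rewrite /pairing m1 m2 mulrACA.
by rewrite normrM /pairing n1 n2 mulr1.
Qed.

Lemma characterV (chi : dual) : character (fun a => (pairing a chi)^-1).
Proof.
have [c1 m1 n1] := dualP chi.
split=> [x|a b|a]; first by apply: cvgV; [exact: pairing_neq0|exact: c1].
  by rewrite /pairing m1 invfM.
by rewrite normfV /pairing n1 invr1.
Qed.

Definition dual_zero : dual := SigSub (mem_set character1).
Definition dual_add (chi xi : dual) : dual :=
  SigSub (mem_set (characterM chi xi)).
Definition dual_opp (chi : dual) : dual := SigSub (mem_set (characterV chi)).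

Lemma dual_addA : associative dual_add.
Proof. by move=> x y z; apply/val_inj/funext => a; exact: mulrA. Qed.
Lemma dual_addC : commutative dual_add.
Proof. by move=> x y; apply/val_inj/funext => a; exact: mulrC. Qed.
Lemma dual_add0 : left_id dual_zero dual_add.
Proof. by move=> x; apply/val_inj/funext => a; exact: mul1r. Qed.
Lemma dual_addN : left_inverse dual_zero dual_opp dual_add.
Proof.
by move=> x; apply/val_inj/funext => a; exact/mulVf/pairing_neq0.
Qed.

HB.instance Definition _ :=
  GRing.isZmodule.Build dual dual_addA dual_addC dual_add0 dual_addN.

Lemma character_comp (f : {additive A -> A}) (cf : continuous f) (chi : dual) :
  character (fun a => pairing (f a) chi).
Proof.
have [c1 m1 n1] := dualP chi.
split=> [x|a b|a]; last exact: n1.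
  exact: (continuous_comp (cf x) (c1 (f x))).
by rewrite /pairing raddfD m1.
Qed.

Definition dual_map (f : {additive A -> A}) (cf : continuous f) (chi : dual) :
  dual := SigSub (mem_set (character_comp cf chi)).

End Dual.

Section Borel.
Variable G : PreTopologicalZmodule.type.

(* The library's generated sigma-algebras live on pointed types. *)
Definition pointed_group : Type := G.
HB.instance Definition _ := Choice.on pointed_group.
HB.instance Definition _ := isPointed.Build pointed_group (0 : G).

Definition borel : Type := g_sigma_algebraType (@open G : set (set pointed_group)).
HB.instance Definition _ := Measurable.on borel.

End Borel.

(* On a second countable locally compact Hausdorff group a Borel measure which
   is finite on compact sets is automatically regular. *)
Definition is_haar (R : realType) (G : PreTopologicalZmodule.type)
    (m : {measure set (borel G) -> \bar R}) : Prop :=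
  [/\ forall (x : G) (E : set (borel G)), measurable E ->
        m ((fun y : G => x + y) @` E) = m E,
      forall K : set G, compact K -> (m K < +oo)%E
    & forall U : set G, open U -> U !=set0 -> (0 < m U)%E].

Definition ergodic d (T : measurableType d) (R : realType)
    (P : probability T R) (f : T -> T) : Prop :=
  [/\ measurable_fun setT f,
      forall E, measurable E -> P (f @^-1` E) = P E
    & forall E, measurable E -> f @^-1` E = E -> P E = 0%E \/ P E = 1%E].

Definition cosets (A B : zmodType) (f : A -> B) : set (set B) :=
  range (fun b : B => [set b + f a | a in [set: A]]).

Section ComplexIntegration.
Variables (R : realType) (d : measure_display) (T : measurableType d).
Variable mu : {measure set T -> \bar R}.
Local Notation C := (Cplx R).

Definition measurable_cplx (D : set T) (f : T -> C) : Prop :=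
  measurable_fun D (fun x => complex.Re (f x)) /\
  measurable_fun D (fun x => complex.Im (f x)).

Definition sqnorm2 (D : set T) (f : T -> C) : \bar R :=
  (\int[mu]_(x in D) (normc (f x) ^+ 2)%:E)%E.

(* Elements of L^2(D) are represented by functions, of which only the values
   mu-almost everywhere on D matter. *)
Definition in_L2 (D : set T) (f : T -> C) : Prop :=
  measurable_cplx D f /\ (sqnorm2 D f < +oo)%E.

Definition integral_cplx (f : T -> C) : C :=
  Complex (\int[mu]_x complex.Re (f x)) (\int[mu]_x complex.Im (f x)).

End ComplexIntegration.

Section LinearAlgebra.
Variables (K : pzRingType) (V : lmodType K).

Definition linear_span (A : set V) : set V :=
  [set v | exists (s : seq V) (c : V -> K),
     (forall x, x \in s -> A x) /\ v = \sum_(x <- s) c x *: x].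

(* Linear independence in the quotient of V by the subspace Z. *)
Definition linearly_independent_mod (Z : set V) (I : eqType) (e : I -> V) :=
  forall (s : seq I) (c : I -> K), uniq s ->
    Z (\sum_(i <- s) c i *: e i) -> forall i, i \in s -> c i = 0.

Definition linearly_independent (I : eqType) (e : I -> V) :=
  linearly_independent_mod [set 0] e.

End LinearAlgebra.

(* Linear independence in L^2(G, m) of the translates by the elements of S
   of every nonzero f. *)
Definition translates_independent (R : realType) (G : topologicalZmodType)
    (S : zmodClosed G) (m : {measure set (borel G) -> \bar R}) : Prop :=
  forall f : borel G -> Cplx R,
    in_L2 m setT f -> ~ (f = 0 %[ae m]) ->
    linearly_independent_mod [set h : borel G -> Cplx R | h = 0 %[ae m]]
      (fun (g : subgroup S) (x : borel G) => f ((x : G) - val g)).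

Section Hilbert.
Variables (R : realType) (H : completeNormedModType (Cplx R)).
Local Notation C := (Cplx R).
Variable dot : {dot H for (@conjC C)}.

Definition hilbert_norm : Prop := forall x : H, `|x| ^+ 2 = dot x x.

Definition separable_space : Prop := exists2 D : set H, countable D & dense D.

Record unitary_op := Unitary {
  uval :> {linear H -> H};
  uinv : H -> H;
  uvalK : cancel uval uinv;
  uinvK : cancel uinv uval;
  uval_dot : forall x y, dot (uval x) (uval y) = dot x y
}.

Definition upow (u : unitary_op) (j : int) : H -> H :=
  match j with
  | Posz n => iter n u
  | Negz n => iter n.+1 (uinv u)
  end.

Section Representation.
Variables (A : PreTopologicalZmodule.type) (pi : A -> unitary_op).
Local Notation dA := (borel (dual R A)).

Definition unitary_rep : Prop := forall a b x, pi (a + b) x = pi a (pi b x).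

Definition pi_invariant (V : set H) : Prop := forall a, pi a @` V `<=` V.

(* <p(.)f, f> is a finite Borel measure nu with
   <pi(a)f, f> = \int (a, chi) d nu(chi), that is, pi(a) = \int (a, .) dp. *)
Definition projection_valued_measure (p : set dA -> {linear H -> H}) : Prop :=
  [/\ forall E, measurable E ->
        (forall f, p E (p E f) = p E f) /\
        (forall f g, dot (p E f) g = dot f (p E g)),
      forall f, p setT f = f,
      forall E F, measurable E -> measurable F ->
        forall f, p (E `&` F) f = p E (p F f)
    & forall f, exists nu : {finite_measure set dA -> \bar R},
        (forall E, measurable E -> dot (p E f) f = (fine (nu E))%:C%C) /\
        (forall a, dot (pi a f) f = integral_cplx nu (pairing a))].

(* T f i is a representative of the i-th component of T f, where T is a
   unitary operator from H onto the Hilbert direct sum of the L^2(sigma i, mu).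
   The numbering of the sets sigma starts at 0. *)
Record spectral_decomposition (mu : {finite_measure set dA -> \bar R})
    (sigma : nat -> set dA) (p : set dA -> {linear H -> H})
    (T : H -> nat -> dA -> C) : Prop := SpectralDecomposition {
  sigma_measurable : forall i, measurable (sigma i);
  sigma_nested : forall i, sigma i.+1 `<=` sigma i;
  sigma_maximal : mu (~` sigma 0%N) = 0%E;
  T_measurable : forall f i, measurable_cplx (sigma i) (T f i);
  T_linear : forall (c : C) f g i,
    T (c *: f + g) i = (fun chi => c * T f i chi + T g i chi)
      %[ae mu in sigma i];
  T_isometry : forall f,
    (\sum_(0 <= i <oo) sqnorm2 mu (sigma i) (T f i) =
      (complex.Re (`|f| ^+ 2))%:E)%E;
  T_onto : forall h : nat -> dA -> C,
    (forall i, measurable_cplx (sigma i) (h i)) ->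
    (\sum_(0 <= i <oo) sqnorm2 mu (sigma i) (h i) < +oo)%E ->
    exists f, forall i, T f i = h i %[ae mu in sigma i];
  T_pi : forall a f i,
    T (pi a f) i = (fun chi => pairing a chi * T f i chi)
      %[ae mu in sigma i];
  T_pvm : forall E, measurable E -> forall f i,
    T (p E f) i = (fun chi => \1_E chi * T f i chi) %[ae mu in sigma i]
}.

Definition is_spectral_measure (mu : {finite_measure set dA -> \bar R}) : Prop :=
  exists sigma p T,
    projection_valued_measure p /\ spectral_decomposition mu sigma p T.

Definition affine_system (delta : unitary_op) (psi : H) (ja : int * A) : H :=
  upow delta ja.1 (pi ja.2 psi).

Definition negative_dilates (delta : unitary_op) (psi : H) : set H :=
  closure (linear_span
    (affine_system delta psi @` [set ja : int * A | ja.1 < 0])).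

End Representation.
End Hilbert.

(* Main.v *)
Require Import Defs.
From HB Require Import structures.
From mathcomp Require Import all_boot all_order all_algebra.
From mathcomp Require Import all_classical all_reals all_analysis.
From mathcomp Require Import complex measurable_realfun.
From mathcomp Require Import ring lra.

(* Call an expression P(pi) = \sum_t c_t pi(a_t) a polynomial in pi; its symbol
   is the trigonometric polynomial P(chi) = \sum_t c_t (a_t, chi), and
   |P(pi) f|^2 = \int |P|^2 d nu_f for the spectral measure nu_f << lambda of f.
   If P <> 0 vanished on a set E of positive measure, the inverse Fourier
   transform of 1_E would give a nonzero l^2 sequence killed by convolution
   with P; spread over small translates in G it would become an f in L^2(G)
   with dependent translates.  So P <> 0 almost everywhere, and hence a
   pi-invariant closed subspace containing P(pi) y contains y.

   A linear relation in the affine system can be written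
   \sum_(k <= K) Q_k(pi) psi_k = 0 with psi_k = delta^-k psi and Q_0, Q_K <> 0.
   Let M be the closed pi-invariant span of psi_1, ..., psi_K.  By the above
   M contains psi_0, and psi_(K+1) after an application of delta^-1, so
   delta^-1 M is included in M and M contains every psi_k.  Thus M = V_0 and
   delta M is included in M.

   A finitely generated M allows no such inclusion.  Pick x <> 0 in M with
   |P(pi) x|^2 <= B \int |P|^2 d lambda for all P, and b not in alpha(Gamma),
   so that the elements alpha^c(b), c < n, are distinct modulo alpha^n(Gamma).
   As M is finitely generated, the n vectors delta^n pi(alpha^c b) x of M are
   approximately \sum_i Q_(c,i)(pi) eta_i with \sum_i |eta_i|^2 <= K and
   \sum_i \int |Q_(c,i)|^2 d lambda controlled by |x|^2.  Applying delta^-n and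
   pairing with pi(alpha^c b) x, the sum over c is, by the orthogonality of
   distinct cosets, at most of order sqrt n, whereas it is about n |x|^2. *)

Import Order.TTheory GRing.Theory Num.Theory Num.Def.
Import numFieldNormedType.Exports.
Local Open Scope classical_set_scope.
Local Open Scope ring_scope.

Set Implicit Arguments.
Unset Strict Implicit.
Unset Printing Implicit Defensive.

(** * Bounded and square integrable functions *)

(** The final contradiction compares two sizes. From delta M in M follows M in delta^-n M, which
    over alpha^n(Gamma) has no more generators than M has over Gamma; yet it contains the n vectors
    pi(alpha^c b) x, which over alpha^n(Gamma) behave like independent ones. The generators of M
    need not form a frame, so this count has to be quantitative. A cyclic subspace is L^2(h d
    lambda) for a density h; on a band where h lies between two positive bounds, the vector with
    symbol h^(-1/2) is a good generator, and what lies outside a large band costs an arbitrarily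
    small error. Hence approximations appear throughout, while the bound K on the generators stays
    independent of n. V_0 is used to obtain delta M in M. The space delta^-1 M is a priori invariant
    under alpha(Gamma) only, so the inclusion cannot be tested on generators of M as a pi-invariant
    span; it can be tested on the vectors whose closed linear span is V_0. *)

Section BoundedMeasurable.
Context (R : realType) (d : measure_display) (T : measurableType d).
Implicit Types f g : T -> R.

(** A class closed under sums and products whose members are integrable for every finite measure:
    the proof integrates against [lambda] and against many spectral measures. *)
Definition bounded_measurable f :=
  measurable_fun setT f /\ exists M, forall x, `|f x| <= M.

Lemma bounded_measurable_cst (r : R) : bounded_measurable (fun=> r).
Proof. by split; [exact: measurable_cst|exists `|r|]. Qed.

Lemma bounded_measurableD f g : bounded_measurable f -> bounded_measurable g ->
  bounded_measurable (fun x => f x + g x).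
Proof.
move=> [mf [M fM]] [mg [M' gM']]; split; first exact: measurable_funD.
by exists (M + M') => x; rewrite (le_trans (ler_normD _ _))// lerD.
Qed.

Lemma bounded_measurableN f : bounded_measurable f ->
  bounded_measurable (fun x => - f x).
Proof.
move=> [mf [M fM]]; split; first exact: measurable_funN.
by exists M => x; rewrite normrN.
Qed.

Lemma bounded_measurableB f g : bounded_measurable f -> bounded_measurable g ->
  bounded_measurable (fun x => f x - g x).
Proof. by move=> bf bg; apply/bounded_measurableD/bounded_measurableN. Qed.

Lemma bounded_measurableM f g : bounded_measurable f -> bounded_measurable g ->
  bounded_measurable (fun x => f x * g x).
Proof.
move=> [mf [M fM]] [mg [M' gM']]; split; first exact: measurable_funM.
by exists (M * M') => x; rewrite normrM ler_pM.
Qed.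

Lemma bounded_measurable_indic (E : set T) : measurable E ->
  bounded_measurable (\1_E : T -> R).
Proof.
move=> mE; split; first exact: measurable_indic.
by exists 1 => x; rewrite indicE; case: (_ \in _); rewrite ?normr0 ?normr1.
Qed.

Variable mu : {finite_measure set T -> \bar R}.

Lemma bounded_measurable_integrable f : bounded_measurable f ->
  mu.-integrable setT (EFin \o f).
Proof.
move=> [mf [M fM]]; apply: measurable_bounded_integrable => //.
  by rewrite ltey_eq fin_num_measure.
exists M; split; first exact: num_real.
by move=> x Mx y _ /=; rewrite (le_trans (fM _))// ltW.
Qed.

Lemma RintD f g : bounded_measurable f -> bounded_measurable g ->
  \int[mu]_x (f x + g x) = \int[mu]_x f x + \int[mu]_x g x.
Proof. by move=> bf bg; rewrite RintegralD//; exact: bounded_measurable_integrable. Qed.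

Lemma RintB f g : bounded_measurable f -> bounded_measurable g ->
  \int[mu]_x (f x - g x) = \int[mu]_x f x - \int[mu]_x g x.
Proof. by move=> bf bg; rewrite RintegralB//; exact: bounded_measurable_integrable. Qed.

Lemma RintZ (r : R) f : bounded_measurable f ->
  \int[mu]_x (r * f x) = r * \int[mu]_x f x.
Proof. by move=> bf; rewrite RintegralZl//; exact: bounded_measurable_integrable. Qed.

Lemma le_Rint f g : bounded_measurable f -> bounded_measurable g ->
  (forall x, f x <= g x) -> \int[mu]_x f x <= \int[mu]_x g x.
Proof.
by move=> bf bg fg; apply: le_Rintegral => //; exact: bounded_measurable_integrable.
Qed.

Lemma Rint_ge0 f : (forall x, 0 <= f x) -> 0 <= \int[mu]_x f x.
Proof. by move=> f0; apply: Rintegral_ge0. Qed.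

Lemma Rint_EFin f : bounded_measurable f ->
  (\int[mu]_x (f x)%:E)%E = (\int[mu]_x f x)%:E.
Proof.
move=> bf; rewrite /Rintegral fineK//.
by apply: integrable_fin_num => //; exact: bounded_measurable_integrable.
Qed.

Lemma Rint_indic (E : set T) : measurable E -> \int[mu]_x \1_E x = fine (mu E).
Proof. by move=> mE; rewrite /Rintegral integral_indic// setIT. Qed.

Lemma bounded_cvg_Rint (f_ : nat -> T -> R) f M :
  (forall n, bounded_measurable (f_ n)) -> bounded_measurable f ->
  (forall n x, `|f_ n x| <= M) -> (forall x, f_ ^~ x @ \oo --> f x) ->
  (fun n => \int[mu]_x f_ n x) @ \oo --> \int[mu]_x f x.
Proof.
move=> bf_ bf fM cf.
have mE g : bounded_measurable g -> measurable_fun setT (EFin \o g).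
  by move=> [mg _]; exact/measurable_EFinP.
have cE x : (f_ n x)%:E @[n --> \oo] --> (f x)%:E.
  by apply: cvg_EFin; [exact: nearW|exact: cf].
have [_ _ h] := @dominated_convergence _ _ _ mu setT measurableT
  (fun n x => (f_ n x)%:E) (fun x => (f x)%:E) (fun=> M%:E)
  (fun n => mE _ (bf_ n)) (mE _ bf) (aeW _ (fun x _ => cE x))
  (bounded_measurable_integrable (bounded_measurable_cst M))
  (aeW _ (fun x n _ => fM n x)).
rewrite Rint_EFin// in h.
exact: fine_cvg h.
Qed.

Lemma Rint_eq0_ae f : bounded_measurable f -> (forall x, 0 <= f x) ->
  \int[mu]_x f x = 0 -> mu [set x | f x != 0] = 0%E.
Proof.
move=> bf f0 If.
have mf : measurable_fun setT (EFin \o f).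
  by apply/measurable_EFinP; case: bf.
have : ae_eq mu setT (EFin \o f) (cst 0).
  apply/ae_eq_integral_abs => //=.
  under eq_integral do rewrite /= ger0_norm//.
  by rewrite Rint_EFin// If.
case=> N [mN N0 fN]; apply/eqP; rewrite eq_le measure_ge0 andbT -N0.
apply: le_measure; rewrite ?inE//.
  rewrite [X in measurable X](_ : _ = f @^-1` (~` [set 0])); last first.
    by apply/seteqP; split => x /= /eqP.
  by rewrite -[X in measurable X]setTI; apply: (proj1 bf) => //; exact: measurableC.
move=> x /= fx0; apply: fN => /= /(_ I) [] fx; move: fx0; rewrite fx eqxx.
by [].
Qed.

End BoundedMeasurable.

(** * Complex-valued functions and squared L^2 norms *)

Section Complex.
Variable R : realType.
Local Notation C := (Cplx R).
Implicit Types z w : C.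

(** Real-valued, unlike the norm of [Cplx R], so that estimates stay inside the ordered field
    [R]. *)
Definition sqmod z : R := complex.Re z ^+ 2 + complex.Im z ^+ 2.

Lemma ltCR (r s : R) : (r%:C%C < s%:C%C :> C) = (r < s).
Proof. exact: ltcR. Qed.
Lemma leCR (r s : R) : (r%:C%C <= s%:C%C :> C) = (r <= s).
Proof. exact: lecR. Qed.
Lemma cReD z w : complex.Re (z + w) = complex.Re z + complex.Re w.
Proof. by case: z w => [? ?] []. Qed.
Lemma cImD z w : complex.Im (z + w) = complex.Im z + complex.Im w.
Proof. by case: z w => [? ?] []. Qed.
Lemma cReN z : complex.Re (- z) = - complex.Re z. Proof. by case: z. Qed.
Lemma cImN z : complex.Im (- z) = - complex.Im z. Proof. by case: z. Qed.
Lemma cReM z w : complex.Re (z * w) =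
  complex.Re z * complex.Re w - complex.Im z * complex.Im w.
Proof. by case: z w => [? ?] []. Qed.
Lemma cImM z w : complex.Im (z * w) =
  complex.Re z * complex.Im w + complex.Im z * complex.Re w.
Proof. by case: z w => [? ?] []. Qed.
Lemma conjCE z : z^*%R = conjc z. Proof. by []. Qed.
Lemma cRe_conj z : complex.Re z^*%R = complex.Re z.
Proof. by rewrite conjCE; case: z. Qed.
Lemma cIm_conj z : complex.Im z^*%R = - complex.Im z.
Proof. by rewrite conjCE; case: z. Qed.
Lemma Re_sum (I : Type) (s : seq I) (f : I -> C) :
  complex.Re (\sum_(i <- s) f i) = \sum_(i <- s) complex.Re (f i).
Proof. by elim/big_rec2: _ => // i y z _ <-; rewrite cReD. Qed.
Lemma complex_eq z w : complex.Re z = complex.Re w ->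
  complex.Im z = complex.Im w -> z = w.
Proof. by case: z w => [? ?] [? ?] /= -> ->. Qed.

Lemma sqmod_ge0 z : 0 <= sqmod z.
Proof. by rewrite addr_ge0 ?sqr_ge0. Qed.
Lemma sqmod0 : sqmod 0 = 0.
Proof. by rewrite /sqmod/= !expr0n addr0. Qed.
Lemma sqmod1 : sqmod 1 = 1.
Proof. by rewrite /sqmod/= expr1n expr0n addr0. Qed.
Lemma sqmodN z : sqmod (- z) = sqmod z.
Proof. by rewrite /sqmod cReN cImN !sqrrN. Qed.
Lemma sqmodM z w : sqmod (z * w) = sqmod z * sqmod w.
Proof. rewrite /sqmod cReM cImM; ring. Qed.
Lemma sqmod_conj z : sqmod z^*%R = sqmod z.
Proof. by rewrite /sqmod cRe_conj cIm_conj sqrrN. Qed.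
Lemma sqmodE z : (sqmod z)%:C%C = `|z| ^+ 2.
Proof. exact: add_Re2_Im2. Qed.
Lemma mulC_conj z : z * z^*%R = (sqmod z)%:C%C.
Proof. by rewrite sqmodE normCK. Qed.
Lemma sqmod_eq0 z : (sqmod z == 0) = (z == 0).
Proof.
rewrite /sqmod paddr_eq0 ?sqr_ge0// !sqrf_eq0.
by case: z => a b; rewrite eq_complex.
Qed.
Lemma normc_sqr z : ComplexField.Normc.normc z ^+ 2 = sqmod z.
Proof. by case: z => a b /=; rewrite sqr_sqrtr ?addr_ge0 ?sqr_ge0. Qed.
Lemma sqmod_real (r : R) : sqmod (r%:C%C : C) = r ^+ 2.
Proof. by rewrite /sqmod/= expr0n addr0. Qed.
Lemma sqmodD_le z w : sqmod (z + w) <= 2 * sqmod z + 2 * sqmod w.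
Proof.
rewrite /sqmod cReD cImD.
have := sqr_ge0 (complex.Re z - complex.Re w).
have := sqr_ge0 (complex.Im z - complex.Im w).
nra.
Qed.
Lemma Re_sqr_le z : complex.Re z ^+ 2 <= sqmod z.
Proof. by rewrite /sqmod lerDl sqr_ge0. Qed.
Lemma Im_sqr_le z : complex.Im z ^+ 2 <= sqmod z.
Proof. by rewrite /sqmod lerDr sqr_ge0. Qed.

Lemma near_norm_lt z (e : R) : 0 < e ->
  \forall w \near z, sqmod (z - w) < e ^+ 2.
Proof.
move=> e0; apply/nbhs_ballP; exists (e%:C%C : C) => /=; first by rewrite ltCR.
move=> w; rewrite /ball/= => zw.
have: (sqmod (z - w))%:C%C < (e ^+ 2)%:C%C :> C.
  by rewrite sqmodE rmorphXn/= ltrXn2r// nnegrE ltW// ltCR.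
by rewrite ltCR.
Qed.

Lemma Re_continuous : continuous (fun z : C => complex.Re z : R).
Proof.
move=> z; apply/(@cvgrPdist_lt _ R^o _ _ (@nbhs_filter C z)) => e e0.
apply: filterS (near_norm_lt z e0) => w zw.
rewrite -(@ltr_pXn2r _ 2)// ?nnegrE ?ltW// real_normK ?num_real//.
by apply: le_lt_trans zw; rewrite -cReN -cReD Re_sqr_le.
Qed.

Lemma Im_continuous : continuous (fun z : C => complex.Im z : R).
Proof.
move=> z; apply/(@cvgrPdist_lt _ R^o _ _ (@nbhs_filter C z)) => e e0.
apply: filterS (near_norm_lt z e0) => w zw.
rewrite -(@ltr_pXn2r _ 2)// ?nnegrE ?ltW// real_normK ?num_real//.
by apply: le_lt_trans zw; rewrite -cImN -cImD Im_sqr_le.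
Qed.

Context (d : measure_display) (T : measurableType d).
Implicit Types u v : T -> C.

Definition bounded_cplx u :=
  bounded_measurable (fun x => complex.Re (u x)) /\
  bounded_measurable (fun x => complex.Im (u x)).

Lemma bounded_cplx_cst z : bounded_cplx (fun=> z).
Proof. by split; apply: bounded_measurable_cst. Qed.
Lemma bounded_cplxD u v : bounded_cplx u -> bounded_cplx v ->
  bounded_cplx (fun x => u x + v x).
Proof.
move=> [ru iu] [rv iv]; split.
  by under eq_fun do rewrite cReD; exact: bounded_measurableD.
by under eq_fun do rewrite cImD; exact: bounded_measurableD.
Qed.
Lemma bounded_cplxN u : bounded_cplx u -> bounded_cplx (fun x => - u x).
Proof.
move=> [ru iu]; split.
  by under eq_fun do rewrite cReN; exact: bounded_measurableN.
by under eq_fun do rewrite cImN; exact: bounded_measurableN.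
Qed.
Lemma bounded_cplxB u v : bounded_cplx u -> bounded_cplx v ->
  bounded_cplx (fun x => u x - v x).
Proof. by move=> bu bv; apply/bounded_cplxD/bounded_cplxN. Qed.
Lemma bounded_cplxM u v : bounded_cplx u -> bounded_cplx v ->
  bounded_cplx (fun x => u x * v x).
Proof.
move=> [ru iu] [rv iv]; split.
  by under eq_fun do rewrite cReM; apply: bounded_measurableB;
    exact: bounded_measurableM.
by under eq_fun do rewrite cImM; apply: bounded_measurableD;
  exact: bounded_measurableM.
Qed.
Lemma bounded_cplx_conj u : bounded_cplx u ->
  bounded_cplx (fun x => (u x)^*%R).
Proof.
move=> [ru iu]; split.
  by under eq_fun do rewrite cRe_conj.
by under eq_fun do rewrite cIm_conj; exact: bounded_measurableN.
Qed.
Lemma bounded_cplx_real (f : T -> R) : bounded_measurable f ->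
  bounded_cplx (fun x => (f x)%:C%C).
Proof. by move=> bf; split => //; exact: bounded_measurable_cst. Qed.
Lemma bounded_cplx_sum (I : Type) (s : seq I) (u : I -> T -> C) :
  (forall i, bounded_cplx (u i)) -> bounded_cplx (fun x => \sum_(i <- s) u i x).
Proof.
move=> bu; elim: s => [|i s IH].
  by under eq_fun do rewrite big_nil; exact: bounded_cplx_cst.
by under eq_fun do rewrite big_cons; exact: bounded_cplxD.
Qed.
Lemma bounded_cplx_sqmod u : bounded_cplx u ->
  bounded_measurable (fun x => sqmod (u x)).
Proof.
by move=> [ru iu]; apply: bounded_measurableD; exact: bounded_measurableM.
Qed.
Lemma bounded_cplx_bound u : bounded_cplx u ->
  exists2 M, 0 < M & forall x, sqmod (u x) <= M.
Proof.
move=> /bounded_cplx_sqmod[_ [M uM]]; exists (`|M| + 1); first by rewrite ltr_wpDl.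
by move=> x; rewrite (le_trans (ler_norm _))// (le_trans (uM x))//
  (le_trans (ler_norm _))// lerDl.
Qed.

Variable mu : {finite_measure set T -> \bar R}.

(** The square of the L^2 norm. Squares avoid roots in the estimates, at the price of the factors 2
    in [nrmL2D] and [nrmL2_triangle]. *)
Definition nrmL2 u : R := \int[mu]_x sqmod (u x).

Lemma nrmL2_ge0 u : 0 <= nrmL2 u.
Proof. by apply: Rint_ge0 => x; exact: sqmod_ge0. Qed.

Lemma nrmL2N u : nrmL2 (fun x => - u x) = nrmL2 u.
Proof. by rewrite /nrmL2; under eq_Rintegral do rewrite sqmodN. Qed.

Lemma nrmL2D u v : bounded_cplx u -> bounded_cplx v ->
  nrmL2 (fun x => u x + v x) <= 2 * nrmL2 u + 2 * nrmL2 v.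
Proof.
move=> bu bv; rewrite /nrmL2 -!RintZ//; [|exact: bounded_cplx_sqmod..].
rewrite -RintD//; [|by apply: bounded_measurableM;
  [exact: bounded_measurable_cst|exact: bounded_cplx_sqmod]..].
apply: le_Rint => [||x]; last exact: sqmodD_le.
  exact/bounded_cplx_sqmod/bounded_cplxD.
by apply: bounded_measurableD; (apply: bounded_measurableM;
  [exact: bounded_measurable_cst|exact: bounded_cplx_sqmod]).
Qed.

Lemma nrmL2_triangle u v (w : T -> C) : bounded_cplx u -> bounded_cplx v ->
  bounded_cplx w ->
  nrmL2 (fun x => u x - w x) <= 2 * nrmL2 (fun x => u x - v x)
    + 2 * nrmL2 (fun x => v x - w x).
Proof.
move=> bu bv bw; rewrite (_ : (fun x => u x - w x) =
  (fun x => (u x - v x) + (v x - w x))); last first.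
  by apply/funext => x; rewrite addrA subrK.
by apply: nrmL2D; exact: bounded_cplxB.
Qed.

Lemma nrmL2M_le u v M : bounded_cplx u -> bounded_cplx v ->
  (forall x, sqmod (u x) <= M) -> nrmL2 (fun x => u x * v x) <= M * nrmL2 v.
Proof.
move=> bu bv uM; rewrite /nrmL2 -RintZ; last exact: bounded_cplx_sqmod.
apply: le_Rint => [||x]; last by rewrite sqmodM ler_wpM2r ?sqmod_ge0.
  exact/bounded_cplx_sqmod/bounded_cplxM.
by apply: bounded_measurableM;
  [exact: bounded_measurable_cst|exact: bounded_cplx_sqmod].
Qed.

End Complex.

(** * Trigonometric polynomials on the dual group *)

Section DualTopology.
Variables (R : realType) (A : PreTopologicalZmodule.type).
Hypothesis discreteA : forall a : A, open [set a].
Hypothesis countableA : countable [set: A].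
Local Notation C := (Cplx R).
Local Notation dA := (borel (dual R A)).

Lemma pairingD (a b : A) (chi : dual R A) :
  pairing (a + b) chi = pairing a chi * pairing b chi.
Proof. by have [_ m _] := dualP chi; exact: m. Qed.

Lemma sqmod_pairing (a : A) (chi : dual R A) : sqmod (pairing a chi) = 1.
Proof.
have [_ _ n1] := dualP chi; apply: (@complexI R).
by rewrite sqmodE /pairing n1 expr1n.
Qed.

Lemma pairing0 (chi : dual R A) : pairing 0 chi = 1.
Proof.
apply: (mulfI (pairing_neq0 0 chi)).
by rewrite mulr1 -pairingD addr0.
Qed.

Lemma pairingN (a : A) (chi : dual R A) :
  pairing (- a) chi = (pairing a chi)^*%R.
Proof.
apply: (mulfI (pairing_neq0 a chi)); rewrite -pairingD subrr pairing0.
by rewrite mulC_conj sqmod_pairing.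
Qed.

Lemma pairing_continuous (a : A) :
  continuous (fun chi : dual R A => pairing a chi : C).
Proof.
apply/continuousP => O oO.
have -> : (fun chi : dual R A => pairing a chi : C) @^-1` O =
    (fun chi : dual R A => \val chi : {compact-open, A -> C}) @^-1`
      [set g | g @` [set a] `<=` O].
  apply/seteqP; split => chi /=; first by move=> ? _ [_ -> <-].
  by apply; exists a.
by eexists; [exact: compact_open_open (@compact_set1 _ a) oO|].
Qed.

Lemma continuous_borel_measurable (f : dual R A -> R) :
  continuous f -> measurable_fun setT (f : dA -> R).
Proof.
move=> /continuousP cf; apply: (measurability _ (RGenOpens.measurableE R)).
move=> _ [_ [a [b ->] <-]]; rewrite setTI.
by apply: sub_sigma_algebra; apply: cf; exact: interval_open.
Qed.

Lemma bounded_pairing (a : A) : bounded_cplx (fun chi : dA => pairing a chi : C).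
Proof.
split; split.
- apply: continuous_borel_measurable => chi.
  exact: continuous_comp (@pairing_continuous a chi) (@Re_continuous _ _).
- exists 1 => chi; rewrite -(@ler_pXn2r _ 2)// ?nnegrE//.
  rewrite real_normK ?num_real// expr1n -(sqmod_pairing a chi).
  exact: Re_sqr_le.
- apply: continuous_borel_measurable => chi.
  exact: continuous_comp (@pairing_continuous a chi) (@Im_continuous _ _).
- exists 1 => chi; rewrite -(@ler_pXn2r _ 2)// ?nnegrE//.
  rewrite real_normK ?num_real// expr1n -(sqmod_pairing a chi).
  exact: Im_sqr_le.
Qed.

(** If K were infinite, the sets containing all but finitely many points of K would form a proper
    filter without cluster point in K: the complement of {a} belongs to it, while {a} is a
    neighbourhood of a. *)
Lemma discrete_compact_finite (K : set A) : compact K -> finite_set K.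
Proof.
move=> cptK; apply: contrapT => Kinf.
pose F : set_system A := [set P | finite_set (K `\` P)].
have FF : ProperFilter F.
  split; first by rewrite /F/= setD0.
  split; first by rewrite /F/= setDT.
    by move=> P Q FP FQ; rewrite /F/= setDIr finite_setU.
  by move=> P Q PQ; apply: sub_finite_set; exact: setDS.
have [|a [Ka]] := cptK F FF; first by rewrite /F/= setDv.
move=> /(_ (~` [set a]) [set a])[||b []//].
  rewrite /F/= setDE setCK; apply: sub_finite_set (finite_set1 a).
  exact: subIsetr.
exact: open_nbhs_nbhs.
Qed.

(** A code (a, q1, q2, n) stands for the condition that the value at a lies within 1 / (n + 1) of q1
    + i q2. As A is countable, so are the finite lists of codes. *)
Let code : Type := A * rat * rat * nat.
Let center (t : code) : C := Complex (ratr t.1.1.2) (ratr t.1.2).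
Let basic (s : seq code) : set (A -> C) :=
  [set f | forall t, t \in s ->
    sqmod (f t.1.1.1 - center t) < (t.2.+1%:R^-1) ^+ 2].

Let basic_near (O : set C) (a : A) (z : C) : open O -> O z ->
  exists t : code, [/\ t.1.1.1 = a,
    sqmod (z - center t) < (t.2.+1%:R^-1) ^+ 2 &
    forall w, sqmod (w - center t) < (t.2.+1%:R^-1) ^+ 2 -> O w].
Proof.
move=> oO Oz; have /nbhs_ballP[e /= e0 zeO] : nbhs z O by exact: open_nbhs_nbhs.
have eE : e = (complex.Re e)%:C%C.
  by move: e0; rewrite ltcE => /andP[/eqP ? _]; exact: complex_eq.
set r := complex.Re e in eE; have r0 : 0 < r by rewrite eE ltCR in e0.
(* With k = 1 / (n + 1) and the centre within k / 2 of z in both coordinates, z is within k of the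
   centre, and another point within k of it is at squared distance at most 4 k^2 < r^2 from z. *)
have [n nr] : exists n, n.+1%:R^-1 < r / 2 :> R.
  have r20 : 0 < r / 2 by rewrite divr_gt0.
  have [n _ nP] := near_infty_natSinv_lt (PosNum r20).
  by exists n; apply: (nP n) => /=.
have [k kE] : exists k : R, k = n.+1%:R^-1 by eexists.
have k0 : 0 < k by rewrite kE invr_gt0.
rewrite -kE in nr.
have [q1] : exists q, ratr q \in `]complex.Re z - k / 2, complex.Re z[.
  by apply: rat_in_itvoo; lra.
rewrite in_itv/= => /andP[q1l q1r].
have [q2] : exists q, ratr q \in `]complex.Im z - k / 2, complex.Im z[.
  by apply: rat_in_itvoo; lra.
rewrite in_itv/= => /andP[q2l q2r].
have zc : sqmod (z - Complex (ratr q1) (ratr q2)) < k ^+ 2.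
  have sq (u : R) : 0 < u -> u < k / 2 -> u ^+ 2 < k ^+ 2 / 4 by move=> *; nra.
  have := sq (complex.Re z - ratr q1); have := sq (complex.Im z - ratr q2).
  rewrite /sqmod cReD cImD cReN cImN /= => h1 h2.
  have k2 : 0 < k ^+ 2 by rewrite exprn_gt0.
  rewrite !subr_gt0 in h1 h2; rewrite ltrBlDr -ltrBlDl in q1l.
  rewrite ltrBlDr -ltrBlDl in q2l.
  by apply: lt_le_trans (ltrD (h2 q1r q1l) (h1 q2r q2l)) _; lra.
exists (a, q1, q2, n); rewrite -!kE; split => // w wc; apply: zeO; rewrite /ball/= eE.
rewrite -(@ltr_pXn2r _ 2)// ?nnegrE// ?leCR ?(ltW r0)//.
rewrite -sqmodE -rmorphXn/= ltCR.
have := sqmodD_le (z - Complex (ratr q1) (ratr q2))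
  (Complex (ratr q1) (ratr q2) - w).
rewrite addrA subrK -(sqmodN (Complex _ _ - w)) opprB => h; move: wc; rewrite /center/= => wc.
have kr : 4 * k ^+ 2 < r ^+ 2 by nra.
by apply: (le_lt_trans h); lra.
Qed.

(** The dual is second countable: compact subsets of A are finite, so the cylinders given by finite
    lists of codes form a basis, and there are countably many of them. Every open set is thus a
    countable union of finite intersections of half-planes. *)
Lemma borel_dual_ind (F : set_system (dual R A)) : sigma_algebra setT F ->
  (forall a (z : C) (q : R), F [set chi | q < complex.Re (z * pairing a chi)]) ->
  forall E : set dA, measurable E -> F E.
Proof.
move=> sF hF; apply: smallest_sub => // U oU.
have [f finj] := countable_injP _ countableA.
pose enc (s : seq code) :=
  pickle [seq (f t.1.1.1, t.1.1.2, t.1.2, t.2) | t <- s].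
have encI : injective enc.
  move=> s s' /(pcan_inj (@pickleK _)); elim: s s' => [[]//|t s IH] [//|t' s'] /= [].
  case: t t' => [[[a q1] q2] n] [[[a' q1'] q2'] n'] /= /finj -> //; rewrite ?inE//.
  by move=> -> -> -> /IH ->.
pose b (s : seq code) : set (dual R A) :=
  (fun chi : dual R A => \val chi : A -> C) @^-1` basic s.
have F0 : F set0 by case: sF.
have FC E : F E -> F (~` E) by rewrite -setTD; case: sF => _ h _; exact: h.
have FU (E : nat -> set (dual R A)) : (forall n, F (E n)) -> F (\bigcup_n E n).
  by move=> FE; case: sF => _ _; apply.
have FT : F setT by rewrite -setC0; exact: FC.
have FI E E' : F E -> F E' -> F (E `&` E').
  move=> FE FE'; rewrite -[_ `&` _]setCK setCI; apply: (FC); rewrite -bigcup2E.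
  by apply: FU => -[|[|n]] /=; [exact: FC|exact: FC|].
have Fb s : F (b s).
  elim: s => [|t s IH].
    by rewrite (_ : b [::] = setT)//; apply/seteqP; split => // chi _ t.
  rewrite (_ : b (t :: s) = [set chi |
      sqmod (pairing t.1.1.1 chi - center t) < (t.2.+1%:R^-1) ^+ 2] `&` b s).
    apply: FI => //; set z := center t; set r := _ ^+ 2.
    (* As |chi(a)| = 1, expanding |chi(a) - z|^2 < r turns the disc into a half-plane. *)
    rewrite (_ : [set _ | _] = [set chi | (1 + sqmod z - r) / 2 <
        complex.Re (z^*%R * pairing t.1.1.1 chi)]); first exact: hF.
    apply/funext => chi /=; congr is_true.
    have := sqmod_pairing t.1.1.1 chi.
    rewrite /sqmod !cReD !cImD !cReN !cImN cReM cRe_conj cIm_conj => h.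
    by apply/idP/idP; nra.
  apply/seteqP; split => chi /=.
    by move=> h; split => [|t' t's]; apply: h; rewrite inE ?eqxx ?t's ?orbT.
  by move=> [h1 h2] t'; rewrite inE => /orP[/eqP ->//|]; exact: h2.
have -> : U = \bigcup_n \bigcup_(s in [set s | enc s = n /\ b s `<=` U]) b s.
  apply/seteqP; split => [chi Uchi|chi [n _ [s [_ sU]]]]; last exact: sU.
  suff [s [bs sU]] : exists s, b s chi /\ b s `<=` U.
    by exists (enc s) => //; exists s.
  have [V oV VU] := oU.
  (* The sets containing a cylinder around chi. Convergence of this filter in the compact-open
     topology puts a cylinder inside V; one code per point of a finite compact set suffices. *)
  pose G : set_system {compact-open, A -> C} :=
    [set P | exists2 s, basic s (\val chi) & basic s `<=` P].
  have FG : Filter G.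
    split; first by exists [::].
      move=> P Q [s bs sP] [s' bs' sQ]; exists (s ++ s').
        by move=> t; rewrite mem_cat => /orP[/bs|/bs'].
      move=> g gss'; split; [apply: sP|apply: sQ] => t ts; apply: gss';
      by rewrite mem_cat ts ?orbT.
    by move=> P Q PQ [s bs sP]; exists s => //; exact: subset_trans sP PQ.
  suff cG : G --> (\val chi : {compact-open, A -> C}).
    have [|s bs sV] := cG V.
      by apply: open_nbhs_nbhs; split => //; rewrite -VU in Uchi.
    by exists s; split => // xi /sV; rewrite -VU.
  apply/compact_open_cvgP => K O cK oO chiKO.
  have /finite_seqP[D DK] := discrete_compact_finite cK.
  have : forall a, a \in D -> O (\val chi a).
    by move=> a aD; apply: chiKO; exists a => //; rewrite DK.
  rewrite DK => {K DK cK chiKO}; elim: D => [_|a D IH chiO].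
    by apply: filterE => g y [x].
  have GD := IH (fun a' a'D => chiO a' (mem_behead (s := a :: D) a'D)).
  have [t [ta zt tO]] := basic_near a oO (chiO a (mem_head a D)).
  have Ga : G [set g | O ((g : A -> C) a)].
    rewrite -ta; rewrite -ta in zt; exists [:: t] => [t'|g /(_ t)];
      rewrite inE; first by move=> /eqP ->.
    by move=> h; apply/tO/h; rewrite eqxx.
  apply: filterS (filterI Ga GD) => g [ga gD] _ [a' /= + <-].
  by rewrite inE => /orP[/eqP ->//|a'D]; apply: gD; exists a'.
apply: FU => n.
have [[s [sn sU]]|nos] := pselect (exists s, enc s = n /\ b s `<=` U).
  rewrite (_ : \bigcup_(_ in _) _ = b s)//; apply/seteqP; split.
    by move=> chi [s' /= [s'n _]]; rewrite (encI s' s)// s'n.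
  by move=> chi bs; exists s.
rewrite (_ : \bigcup_(_ in _) _ = set0)//; apply/seteqP; split => // chi [s h _].
by apply: nos; exists s.
Qed.

End DualTopology.

Section TrigPolynomials.
Variables (R : realType) (A : PreTopologicalZmodule.type).
Local Notation C := (Cplx R).
Local Notation dA := (borel (dual R A)).

(* A trigonometric polynomial is a list of pairs (coefficient, frequency);
   repetitions are allowed. *)
Definition tpoly : Type := seq (C * A).
Implicit Types P Q : tpoly.

Definition teval P (chi : dA) : C := \sum_(t <- P) t.1 * pairing t.2 chi.

Definition tmul P Q : tpoly := [seq (t.1 * u.1, t.2 + u.2) | t <- P, u <- Q].

Definition tconj P : tpoly := [seq ((t.1)^*%R, - t.2) | t <- P].

Lemma teval_cat P Q chi : teval (P ++ Q) chi = teval P chi + teval Q chi.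
Proof. by rewrite /teval big_cat. Qed.

Lemma teval_mul P Q chi : teval (tmul P Q) chi = teval P chi * teval Q chi.
Proof.
rewrite /teval/= /tmul big_flatten/= big_map mulr_suml; apply: eq_bigr => t _.
by rewrite big_map mulr_sumr; apply: eq_bigr => u _ /=; rewrite pairingD mulrACA.
Qed.

Lemma teval_conj P chi : teval (tconj P) chi = (teval P chi)^*%R.
Proof.
rewrite /teval big_map rmorph_sum/=; apply: eq_bigr => t _ /=.
by rewrite rmorphM/= pairingN.
Qed.

Lemma teval1 (z : C) (a : A) chi : teval [:: (z, a)] chi = z * pairing a chi.
Proof. by rewrite /teval big_seq1. Qed.

Lemma bounded_teval P : bounded_cplx (teval P).
Proof.
apply: bounded_cplx_sum => t; apply: bounded_cplxM.
  exact: bounded_cplx_cst.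
exact: bounded_pairing.
Qed.

End TrigPolynomials.

(** * Density of trigonometric polynomials in L^2(mu) *)

Section Density.
Variables (R : realType) (A : PreTopologicalZmodule.type).
Hypothesis discreteA : forall a : A, open [set a].
Hypothesis countableA : countable [set: A].
Local Notation C := (Cplx R).
Local Notation dA := (borel (dual R A)).
Variable mu : {finite_measure set dA -> \bar R}.
Implicit Types (u v : dA -> C) (f g : dA -> R).

(** Boundedness is included because a product of approximants is close to the product only when an
    error is multiplied by a bounded factor. *)
Let approximable u := bounded_cplx u /\
  forall e, 0 < e -> exists P, nrmL2 mu (fun x => u x - teval P x) <= e.

Let approximable_teval P : approximable (teval P).
Proof.
split=> [|e e0]; first exact: bounded_teval.
exists P; rewrite /nrmL2; under eq_Rintegral do rewrite subrr sqmod0.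
by rewrite Rintegral_cst// mul0r ltW.
Qed.

Let approximable_lim u : bounded_cplx u ->
  (forall e, 0 < e -> exists2 v, approximable v &
    nrmL2 mu (fun x => u x - v x) <= e) -> approximable u.
Proof.
move=> bu h; split => // e e0; have e40 : 0 < e / 4 by lra.
have [v [bv va] uv] := h _ e40; have [P vP] := va _ e40.
exists P; apply: (le_trans (nrmL2_triangle mu bu bv (bounded_teval P))).
lra.
Qed.

Let approximableD u v : approximable u -> approximable v ->
  approximable (fun x => u x + v x).
Proof.
move=> [bu ua] [bv va]; split => [|e e0]; first exact: bounded_cplxD.
have e40 : 0 < e / 4 by lra.
have [P uP] := ua _ e40; have [Q vQ] := va _ e40; exists (P ++ Q).
rewrite (_ : (fun x => _) =
    (fun x => (u x - teval P x) + (v x - teval Q x))); last first.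
  by apply/funext => x; rewrite teval_cat opprD addrACA.
apply: (le_trans (nrmL2D mu _ _)); last lra.
  by apply: bounded_cplxB => //; exact: bounded_teval.
by apply: bounded_cplxB => //; exact: bounded_teval.
Qed.

Let approximableM u v : approximable u -> approximable v ->
  approximable (fun x => u x * v x).
Proof.
move=> [bu ua] [bv va]; split => [|e e0]; first exact: bounded_cplxM.
have [M M0 vM] := bounded_cplx_bound bv.
have [|P uP] := ua (e / 4 / M); first by rewrite !divr_gt0.
(* Q is chosen after P, since its tolerance depends on the bound K of P. *)
have [K K0 PK] := bounded_cplx_bound (bounded_teval P).
have [|Q vQ] := va (e / 4 / K); first by rewrite !divr_gt0.
exists (tmul P Q).
rewrite (_ : (fun x => _) = (fun x => v x * (u x - teval P x) +
    teval P x * (v x - teval Q x))); last first.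
  by apply/funext => x; rewrite teval_mul; ring.
have bP := bounded_teval P; have bQ := bounded_teval Q.
have bvu := bounded_cplxB bu bP; have bvv := bounded_cplxB bv bQ.
apply: (le_trans (nrmL2D mu (bounded_cplxM bv bvu) (bounded_cplxM bP bvv))).
have h1 := nrmL2M_le mu bv bvu vM; have h2 := nrmL2M_le mu bP bvv PK.
rewrite ler_pdivlMr// in uP; rewrite ler_pdivlMr// in vQ.
rewrite (mulrC M) in h1; rewrite (mulrC K) in h2.
lra.
Qed.

Let rapprox f := approximable (fun x => (f x)%:C%C).

Let rapprox_bounded f : rapprox f -> bounded_measurable f.
Proof. by case=> -[]. Qed.

Let rapprox_cst (r : R) : rapprox (fun=> r).
Proof.
rewrite /rapprox (_ : (fun=> _) = teval [:: (r%:C%C, 0)])//.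
by apply/funext => x; rewrite teval1 pairing0 mulr1.
Qed.

Let rapproxD f g : rapprox f -> rapprox g -> rapprox (fun x => f x + g x).
Proof.
move=> af ag; rewrite /rapprox; under eq_fun do rewrite rmorphD.
exact: approximableD.
Qed.

Let rapproxM f g : rapprox f -> rapprox g -> rapprox (fun x => f x * g x).
Proof.
move=> af ag; rewrite /rapprox; under eq_fun do rewrite rmorphM.
exact: approximableM.
Qed.

Let rapproxB f g : rapprox f -> rapprox g -> rapprox (fun x => f x - g x).
Proof.
move=> af ag; rewrite (_ : (fun x => _) = (fun x => f x + (-1) * g x)).
  by apply: rapproxD => //; apply: rapproxM.
by apply/funext => x; rewrite mulN1r.
Qed.

Let rapproxX f n : rapprox f -> rapprox (fun x => f x ^+ n).
Proof.
move=> af; elim: n => [|n IH]; first exact: rapprox_cst.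
by under eq_fun do rewrite exprS; exact: rapproxM.
Qed.

Let rapprox_sum (I : Type) (s : seq I) (F : I -> dA -> R) :
  (forall i, rapprox (F i)) -> rapprox (fun x => \sum_(i <- s) F i x).
Proof.
move=> aF; elim: s => [|i s IH].
  by under eq_fun do rewrite big_nil; exact: rapprox_cst.
by under eq_fun do rewrite big_cons; exact: rapproxD.
Qed.

(** Dominated convergence applied to |f - f_n|^2. This closure property leads from polynomials to
    indicators and from simple functions to bounded ones. *)
Let rapprox_lim (f_ : nat -> dA -> R) f M : (forall n, rapprox (f_ n)) ->
  bounded_measurable f -> (forall n x, `|f_ n x| <= M) ->
  (forall x, f_ ^~ x @ \oo --> f x) -> rapprox f.
Proof.
move=> af bf fM cf; apply: approximable_lim; first exact: bounded_cplx_real.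
move=> e e0.
have bd n : bounded_measurable (fun x => (f x - f_ n x) ^+ 2).
  by apply: bounded_measurableM; apply: bounded_measurableB => //;
    exact: rapprox_bounded.
have c0 x : (f x - f_ n x) ^+ 2 @[n --> \oo] --> (0 : R).
  rewrite -(mulr0 (0 : R)) -{1 2}(subrr (f x)).
  by apply: cvgM; apply: cvgB => //; exact: cvg_cst.
have [_ [M' fM']] := bf.
have dM n x : `|(f x - f_ n x) ^+ 2| <= (M' + M) ^+ 2.
  have h : `|f x - f_ n x| <= M' + M.
    by rewrite (le_trans (ler_normB _ _))// lerD.
  by rewrite normrX lerXn2r ?nnegrE// (le_trans _ h).
have := bounded_cvg_Rint (mu := mu) bd (bounded_measurable_cst _ 0) dM c0.
rewrite Rintegral_cst// mul0r => /cvgr0_norm_le/(_ _ e0)[n _ /(_ n (leqnn n)) h].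
exists (fun x => (f_ n x)%:C%C); first exact: af.
rewrite /nrmL2; under eq_Rintegral do rewrite -rmorphB sqmod_real.
exact: le_trans (ler_norm _) h.
Qed.

Let bernoulli_le (x : R) n : 0 <= x <= 1 -> (1 - x) ^+ n <= (1 + n%:R * x)^-1.
Proof.
move=> /andP[x0 x1].
have h m : 0 < 1 + m%:R * x by rewrite ltr_pwDl// mulr_ge0.
rewrite -[leRHS]mul1r ler_pdivlMr//; elim: n => [|n IH].
  by rewrite expr0 mul0r addr0 mulr1.
apply: le_trans IH; rewrite exprS mulrAC mulrC ler_wpM2l ?exprn_ge0 ?subr_ge0//.
rewrite -natr1; have := h n; have := ler0n R n; nra.
Qed.

Let bernoulli_ge (x : R) n : 0 <= x <= 1 -> 1 - n%:R * x <= (1 - x) ^+ n.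
Proof.
move=> /andP[x0 x1]; elim: n => [|n IH]; first by rewrite mul0r subr0 expr0.
rewrite exprS -natr1; have := ler0n R n => n0.
apply: le_trans (ler_wpM2l _ IH); last by rewrite subr_ge0.
nra.
Qed.

(* (1 - r ^ (2n)) ^ (n 4 ^ n) converges to 1 if r < 1/2, and to 0 if
   1/2 <= r <= 1. *)
Let threshold (r : R) n : R := (1 - r ^+ (2 * n)) ^+ (n * 4 ^ n).

Let threshold01 r n : 0 <= r <= 1 -> `|threshold r n| <= 1.
Proof.
move=> /andP[r0 r1]; have h : 0 <= r ^+ (2 * n) <= 1.
  by rewrite exprn_ge0//= exprn_ile1.
rewrite normrX exprn_ile1// ger0_norm; lra.
Qed.

(** The exponent times r^(2n) equals n (2r)^(2n), which tends to 0 for r < 1/2 and is at least n for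
    r >= 1/2. The two Bernoulli inequalities turn these facts into the limits 1 and 0. *)
Let threshold_cvg r : 0 <= r <= 1 ->
  threshold r @ \oo --> ((r < 1 / 2)%R%:R : R).
Proof.
move=> /andP[r0 r1].
have h n : 0 <= r ^+ (2 * n) <= 1 by rewrite exprn_ge0//= exprn_ile1.
have rn n : (4 ^ n)%:R * r ^+ (2 * n) = (2 * r) ^+ n ^+ 2.
  by rewrite natrX exprM -exprMn -exprM mulnC exprM; congr (_ ^+ _); ring.
case: ltP => r2.
  pose t := 1 - 2 * r; have t0 : 0 < t by rewrite /t; lra.
  have ub n : threshold r n <= 1.
    by rewrite (le_trans (ler_norm _))// threshold01// r0.
  have lb n : 1 - t^-2 * n.+1%:R^-1 <= threshold r n.
    apply: le_trans (bernoulli_ge _ (h n)).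
    rewrite lerD2l lerN2 natrM -mulrA rn.
    have tn : (2 * r) ^+ n <= (1 + n%:R * t)^-1.
      by rewrite (_ : 2 * r = 1 - t) ?bernoulli_le//; rewrite /t; lra.
    have n0 := ler0n R n.
    have tt : 0 < 1 + n%:R * t by rewrite ltr_pwDl// mulr_ge0// ltW.
    have tn1 : (1 + n%:R * t)^-1 <= t^-1 * n.+1%:R^-1.
      rewrite -invfM lef_pV2 ?posrE ?mulr_gt0// -natr1 /t.
      by rewrite /t in t0 *; nra.
    have : (2 * r) ^+ n <= t^-1 * n.+1%:R^-1 by exact: le_trans tn tn1.
    have p0 : 0 <= (2 * r) ^+ n by rewrite exprn_ge0// mulr_ge0.
    set p := (2 * r) ^+ n in p0 * => pn.
    apply: (@le_trans _ _ (n%:R * (t^-1 * n.+1%:R^-1) ^+ 2)).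
      by rewrite ler_wpM2l// lerXn2r ?nnegrE// (le_trans p0).
    rewrite exprMn -exprVn mulrCA ler_wpM2l ?exprn_ge0 ?invr_ge0 ?(ltW t0)//.
    rewrite expr2 mulrA ger_pMl ?invr_gt0//.
    by rewrite ler_pdivrMr ?mul1r ?ltr0n// ler_nat.
  apply: (@squeeze_cvgr _ _ _ _ (fun n => 1 - t^-2 * n.+1%:R^-1) (fun=> 1)).
  - by apply: nearW => n; rewrite lb ub.
  - rewrite -[X in _ --> X]subr0 -[X in _ --> _ - X](mulr0 (t^-2)).
    apply: cvgB; first exact: cvg_cst.
    by apply: cvgM; [exact: cvg_cst|exact: cvg_harmonic].
  - exact: cvg_cst.
have lb n : 0 <= threshold r n.
  by rewrite exprn_ge0// subr_ge0; case/andP: (h n).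
have ub n : threshold r n <= n.+1%:R^-1.
  apply: le_trans (bernoulli_le _ (h n)) _.
  rewrite lef_pV2 ?posrE//; last first.
    by rewrite ltr_pwDl// mulr_ge0//; case/andP: (h n).
  rewrite -nat1r lerD2l natrM -mulrA rn ler_peMr//.
  by rewrite !exprn_ege1//; lra.
apply: (@squeeze_cvgr _ _ _ _ (fun=> 0) (fun n => n.+1%:R^-1)).
- by apply: nearW => n; rewrite lb ub.
- exact: cvg_cst.
- exact: cvg_harmonic.
Qed.

Let measurable_pos f : measurable_fun setT f -> measurable [set x | 0 < f x].
Proof.
move=> mf; rewrite (_ : [set _ | _] = f @^-1` `]0, +oo[).
  by rewrite -[X in measurable X]setTI; exact: mf.
by apply/seteqP; split => x /=; rewrite in_itv/= andbT.
Qed.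

(** An affine change of variable sends f to r with values in [0, 1] and f > 0 to r < 1/2. Then
    [threshold] of r is a polynomial in f, hence approximable, and converges to the indicator. *)
Let rapprox_pos f : rapprox f -> rapprox (\1_[set x | 0 < f x]).
Proof.
move=> af; have [mf [M fM]] := rapprox_bounded af.
pose K := `|M| + 1; have K0 : 0 < K by rewrite ltr_wpDl.
have fK x : - K <= f x <= K.
  by rewrite -ler_norml (le_trans (fM x))// (le_trans (ler_norm _))// lerDl.
pose r x := (1 - K^-1 * f x) * (1 / 2).
have r01 x : 0 <= r x <= 1.
  have /andP[f1 f2] := fK x.
  have h1 : K^-1 * f x <= 1 by rewrite mulrC ler_pdivrMr// mul1r.
  have h2 : -1 <= K^-1 * f x by rewrite mulrC ler_pdivlMr// mulN1r.
  rewrite /r; lra.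
apply: (@rapprox_lim (fun n x => threshold (r x) n) _ 1).
- move=> n; apply: rapproxX; apply: rapproxB; first exact: rapprox_cst.
  apply: rapproxX; apply: rapproxM; last exact: rapprox_cst.
  apply: rapproxB; first exact: rapprox_cst.
  by apply: rapproxM; [exact: rapprox_cst|exact: af].
- by apply: bounded_measurable_indic; exact: measurable_pos.
- by move=> n x; exact: threshold01.
- move=> x; have := threshold_cvg (r01 x).
  suff -> : ((r x < 1 / 2)%R%:R : R) = \1_[set x | 0 < f x] x by [].
  rewrite indicE; congr ((nat_of_bool _)%:R).
  have h : (0 < K^-1 * f x) = (0 < f x) by rewrite pmulr_rgt0// invr_gt0.
  rewrite [RHS](_ : _ = (0 < f x)); last by apply/idP/idP; rewrite in_setE.
  by rewrite -h /r; apply/idP/idP; lra.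
Qed.

Let rapprox_indic (E : set dA) : measurable E -> rapprox (\1_E).
Proof.
(* Measurability is carried through the induction because [rapprox_lim] asks for a measurable
   limit. *)
move=> mE; suff [] : measurable E /\ rapprox (\1_E) by [].
apply: (@borel_dual_ind R A discreteA countableA
  (fun E : set dA => measurable E /\ rapprox (\1_E))) => //; last first.
  move=> a z q; pose f (chi : dA) := complex.Re (z * pairing a chi) - q.
  rewrite (_ : [set chi | _] = [set chi : dA | 0 < f chi]); last first.
    by apply/seteqP; split => chi /=; rewrite subr_gt0.
  have af : rapprox f.
    apply: rapproxB; last exact: rapprox_cst.
    rewrite /rapprox (_ : (fun x => _) =
      teval [:: (z / 2, a); (z^*%R / 2, - a)]); first exact: approximable_teval.
    apply/funext => chi; rewrite /teval big_cons big_seq1/= pairingN.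
    set w := pairing a chi; rewrite (mulrAC z) (mulrAC z^*%R) -mulrDl -rmorphM/=.
    by rewrite ReJ_add.
  by split; [apply: measurable_pos; exact: (proj1 (rapprox_bounded af))|exact: rapprox_pos].
split.
- by split => //; rewrite indic0; exact: rapprox_cst.
- move=> B [mB aB]; rewrite setTD; split; first exact: measurableC.
  rewrite (_ : \1__ = fun x => 1 - \1_B x).
    by apply: rapproxB => //; exact: rapprox_cst.
  apply/funext => x; rewrite !indicE in_setC.
  by case: (x \in B); rewrite ?subrr ?subr0.
- move=> B mB; have mUB : measurable (\bigcup_k B k : set dA).
    by apply: bigcup_measurable => k _; case: (mB k).
  (* The indicator of the union of the first n sets, as a polynomial in their indicators; at each
     point it is eventually constant. *)
  split=> //; pose f_ n (x : dA) : R := 1 - \prod_(k < n) (1 - \1_(B k) x).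
  have p01 n x : 0 <= \prod_(k < n) (1 - \1_(B k) x : R) <= 1.
    have h k : 0 <= 1 - (\1_(B k) x : R) <= 1.
      by rewrite indicE; case: (_ \in _); rewrite ?subrr ?subr0 ?lexx ?ler01.
    apply/andP; split; last by apply: prodr_ile1 => k _; exact: h.
    by apply: prodr_ge0 => k _; case/andP: (h k).
  apply: (@rapprox_lim f_ _ 1) => //.
  + move=> n; apply: rapproxB; first exact: rapprox_cst.
    elim: n => [|n IH]; first by under eq_fun do rewrite big_ord0; exact: rapprox_cst.
    under eq_fun do rewrite big_ord_recr/=; apply: rapproxM => //.
    by apply: rapproxB; [exact: rapprox_cst|case: (mB n)].
  + exact: bounded_measurable_indic.
  + by move=> n x; have := p01 n x; rewrite /f_ => ?; rewrite ger0_norm; lra.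
  + move=> x; rewrite indicE.
    have [xB|xB] := boolP (x \in _); last first.
      apply: cvg_near_cst; apply: nearW => n; rewrite /f_ big1 ?subrr// => k _.
      rewrite indicE memNset ?subr0// => xBk; move/negP: xB; apply.
      by rewrite inE; exists k.
    have [k _ xBk] : (\bigcup_k B k) x by rewrite inE in xB.
    apply: cvg_near_cst; exists k.+1 => // n /= kn.
    rewrite /f_ (bigD1 (Ordinal kn))//= indicE mem_set//.
    by rewrite subrr mul0r subr0.
Qed.

Let rapprox_ge0 f : bounded_measurable f -> (forall x, 0 <= f x) -> rapprox f.
Proof.
move=> bf f0; have [mf [M fM]] := bf.
have mEf : measurable_fun setT (EFin \o f) by exact/measurable_EFinP.
have f0E x : setT x -> (0 <= (EFin \o f) x)%E by rewrite lee_fin.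
apply: (@rapprox_lim (fun n => approx setT (EFin \o f) n) _ M) => //.
- move=> n; apply: rapproxD.
    apply: rapprox_sum => k; apply: rapproxM; first exact: rapprox_cst.
    apply: rapprox_indic; rewrite /dyadic_approx; case: ifP => // _.
    rewrite -preimage_comp.
    by apply: mEf => //; apply/measurable_image_EFin; exact: measurable_itv.
  apply: rapproxM; first exact: rapprox_cst.
  by apply: rapprox_indic; exact: emeasurable_fun_c_infty.
- move=> n x; rewrite ger0_norm.
    have := le_approx n f0E (I : setT x); rewrite lee_fin => /le_trans; apply.
    exact: le_trans (ler_norm _) (fM x).
  rewrite addr_ge0 ?mulr_ge0//; apply: sumr_ge0 => k _; rewrite mulr_ge0//.
- move=> x; have := @cvg_approx _ _ _ setT (EFin \o f) x f0E I; apply.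
  exact: ltry.
Qed.

(** Proved for every finite measure, since it is applied both to [lambda] and to spectral measures
    of vectors. *)
Lemma tpoly_dense u : bounded_cplx u ->
  forall e, 0 < e -> exists P, nrmL2 mu (fun x => u x - teval P x) <= e.
Proof.
suff h f : bounded_measurable f -> rapprox f.
  move=> [bre bim]; suff [] : approximable u by [].
  rewrite (_ : u = fun x => (complex.Re (u x))%:C%C +
     teval [:: (Complex 0 1, 0)] x * (complex.Im (u x))%:C%C).
    apply: approximableD; first exact: h.
    by apply: approximableM; [exact: approximable_teval|exact: h].
  apply/funext => x; rewrite teval1 pairing0 mulr1; exact: complexE.
move=> bf; have [_ [M fM]] := bf.
rewrite (_ : f = fun x => (f x + `|M|) - `|M|).
  apply: rapproxB; last exact: rapprox_cst.
  apply: rapprox_ge0 => [|x].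
    by apply: bounded_measurableD => //; exact: bounded_measurable_cst.
  have := fM x; rewrite ler_norml => /andP[+ _].
  by have := ler_norm M; lra.
by apply/funext => x; rewrite addrK.
Qed.

End Density.

(** * Extension of characters from subgroups of an abelian group *)

Section CharacterExtension.
Variables (R : realType) (A : zmodType).
Local Notation C := (Cplx R).
Implicit Types (G : set (A * C)) (a b : A) (w z : C).

(* Characters of subgroups of A, represented by their graphs. *)
Let graph_character G := [/\ forall a z b w, G (a, z) -> G (b, w) ->
    G (a - b, z / w), forall a z, G (a, z) -> `|z| = 1 &
  forall z, G (0, z) -> z = 1].

Let extend G b w : set (A * C) :=
  [set t | exists a z (k : int), G (a, z) /\ t = (a + b *~ k, z * w ^ k)].

Let graph_neq0 G a z : graph_character G -> G (a, z) -> z != 0.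
Proof. by move=> [_ n1 _] /n1 z1; rewrite -normr_gt0 z1. Qed.

Let graph_one G a z : graph_character G -> G (a, z) -> G (0, 1).
Proof.
move=> gG Gaz; have [sG _ _] := gG.
by have := sG _ _ _ _ Gaz Gaz; rewrite subrr divff// (graph_neq0 gG Gaz).
Qed.

Let graph_fun G a z w : graph_character G -> G (a, z) -> G (a, w) -> z = w.
Proof.
move=> gG Gz Gw; have [sG _ G1] := gG.
have := sG _ _ _ _ Gz Gw; rewrite subrr => /G1 /(canRL (divfK _)).
by rewrite mul1r; apply; exact: graph_neq0 gG Gw.
Qed.

Let graph_opp G a z : graph_character G -> G (a, z) -> G (- a, z^-1).
Proof.
move=> gG Gz; have [sG _ _] := gG.
by have := sG _ _ _ _ (graph_one gG Gz) Gz; rewrite sub0r div1r.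
Qed.

Let graph_add G a z b w : graph_character G -> G (a, z) -> G (b, w) ->
  G (a + b, z * w).
Proof.
move=> gG Gz Gw; have [sG _ _] := gG.
by have := sG _ _ _ _ Gz (graph_opp gG Gw); rewrite opprK invrK.
Qed.

Let graph_mulrn G a z n : graph_character G -> G (a, z) -> G (a *+ n, z ^+ n).
Proof.
move=> gG Gz; elim: n => [|n IH]; first exact: graph_one gG Gz.
by rewrite mulrS exprS; exact: graph_add.
Qed.

Let graph_extend G b w : graph_character G -> `|w| = 1 ->
  (forall (k : int) v, G (b *~ k, v) -> v = w ^ k) ->
  graph_character (extend G b w).
Proof.
move=> gG w1 hw; have [sG n1 G1] := gG.
have w0 : w != 0 by rewrite -normr_gt0 w1.
split.
- move=> _ _ _ _ [a [z [k [Gz [-> ->]]]]] [a' [z' [k' [Gz' [-> ->]]]]].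
  exists (a - a'), (z / z'), (k - k'); split; first exact: sG.
  by rewrite mulrzBr opprD addrACA expfzDr// -invr_expz invfM mulrACA.
- move=> _ _ [a [z [k [Gz [_ ->]]]]].
  have wk : `|w ^ k| = 1.
    by case: k => n; rewrite ?NegzE -?exprnN ?normfV normrX w1 expr1n ?invr1.
  by rewrite normrM (n1 _ _ Gz) wk mul1r.
- move=> v [a [z [k [Gz [/eqP + ->]]]]]; rewrite eq_sym addr_eq0 => /eqP ak.
  have := hw (- k) z; rewrite mulrNz -ak => /(_ Gz) ->.
  by rewrite -expfzDr// addNr expr0z.
Qed.

(** The value chosen at b must agree with G on the multiples of b in its domain. These are the
    multiples of the least positive one, (n + 1) b, so an (n + 1)-st root of the value there works;
    if no positive multiple occurs, 1 works. *)
Let graph_root G b : graph_character G -> exists w, `|w| = 1 /\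
  forall (k : int) v, G (b *~ k, v) -> v = w ^ k.
Proof.
move=> gG; have [sG n1 G1] := gG.
have [[n0 n0P]|nog] := pselect (exists n, exists z, G (b *+ n.+1, z)); last first.
  exists 1; split; first by rewrite normr1.
  case=> [[|n]|n] v Gv; rewrite exp1rz.
  - by apply: G1; rewrite mulr0z in Gv.
  - by exfalso; apply: nog; exists n, v.
  - exfalso; apply: nog; exists n, v^-1.
    by have := graph_opp gG Gv; rewrite NegzE mulrNz opprK.
pose p n := `[< exists z, G (b *+ n.+1, z) >].
have ep : exists n, p n by exists n0; apply/asboolP.
have [n /asboolP[z Gz] nmin] := ex_minnP ep.
pose w : C := n.+1.-root z; have wz : w ^+ n.+1 = z by rewrite rootCK.
have w1 : `|w| = 1.
  apply/eqP; rewrite -(@pexpr_eq1 _ _ n.+1)//.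
  by rewrite -normrX wz; apply/eqP; exact: n1 Gz.
have w0 : w != 0 by rewrite -normr_gt0 w1.
have wnat k v : G (b *+ k, v) -> v = w ^+ k.
  move=> Gv; have := divn_eq k n.+1; set q := (k %/ n.+1)%N; set r := (k %% n.+1)%N.
  move=> kE; have Gq := graph_mulrn q gG Gz.
  have Gr : G (b *+ r, v / z ^+ q).
    have := sG _ _ _ _ Gv Gq.
    by rewrite {1}kE mulrnDr mulnC mulrnA addrAC subrr add0r.
  have r0 : r = 0%N.
    have := ltn_pmod k (ltn0Sn n); rewrite -/r.
    case: r Gr kE => // r Gr _ rn.
    have pr : p r by apply/asboolP; exists (v / z ^+ q).
    by have := leq_ltn_trans (nmin r pr) rn; rewrite ltnn.
  move: Gr; rewrite r0 mulr0n => /G1 /(canRL (divfK _)).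
  rewrite mul1r => ->; last by rewrite expf_neq0// (graph_neq0 gG Gz).
  by rewrite kE r0 addn0 mulnC exprM wz.
exists w; split=> //; case=> [k v|k v] Gv; first exact: wnat.
have := graph_opp gG Gv; rewrite NegzE mulrNz opprK => /wnat.
by move=> /(canRL (@invrK _)) ->.
Qed.

(** Start from a character of the cyclic group of a that is not 1 at a, and take a maximal extension
    by Zorn's lemma; [graph_root] shows that it is defined everywhere. *)
Lemma character_separates a : a != 0 -> exists f : A -> C,
  [/\ forall x y, f (x + y) = f x * f y, forall x, `|f x| = 1 & f a != 1].
Proof.
move=> a0; pose G1 : set (A * C) := [set (0, 1)].
have gG1 : graph_character G1.
  split.
  - by move=> _ _ _ _ [-> ->] [-> ->]; rewrite subrr divr1.
  - by move=> _ _ [_ ->]; rewrite normr1.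
  - by move=> _ [->].
have [w [w1 wn1 hw]] : exists w, [/\ `|w| = 1, w != 1 &
    forall (k : int) v, G1 (a *~ k, v) -> v = w ^ k].
  suff [w [w1 wn1 hw]] : exists w, [/\ `|w| = 1, w != 1 &
      forall k, a *+ k = 0 -> w ^+ k = 1].
    exists w; split => // -[k|k] v [] ak ->; first by rewrite -exprnP hw.
    by rewrite NegzE -exprnN hw ?invr1//; move/eqP: ak; rewrite oppr_eq0 => /eqP.
  have [[n0 n0P]|nog] := pselect (exists n, a *+ n.+1 = 0); last first.
    exists (-1); split; first by rewrite normrN1.
      by rewrite -subr_eq0 -opprD oppr_eq0 paddr_eq0 ?ler01 ?oner_eq0.
    by case=> // k ak; exfalso; apply: nog; exists k.
  have ep : exists n, a *+ n.+1 == 0 by exists n0; apply/eqP.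
  have [n /eqP an nmin] := ex_minnP ep.
  have n_gt0 : (0 < n)%N by case: n an {nmin} => // /eqP; rewrite (negPf a0).
  (* The order of a is n + 1. A root of 1 + X + ... + X^n is an (n + 1)-st root of unity, and it is
     not 1, where the value is n + 1. *)
  have [|w /eqP pw0] := closed_rootP (\poly_(i < n.+1) (1 : C)) _.
    by rewrite size_poly_eq ?oner_eq0// eqSS -lt0n.
  rewrite horner_poly (eq_bigr _ (fun _ _ => mul1r _)) in pw0.
  have wn : w ^+ n.+1 = 1 by apply/eqP; rewrite -subr_eq0 subrX1 pw0 mulr0.
  exists w; split.
  - by apply/eqP; rewrite -(@pexpr_eq1 _ _ n.+1)// -normrX wn normr1.
  - apply/eqP => we; move: pw0; rewrite we.
    rewrite (eq_bigr (fun=> 1)) => [|i _]; last by rewrite expr1n.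
    by rewrite sumr_const card_ord => /eqP; rewrite pnatr_eq0.
  - move=> k ak; rewrite (divn_eq k n.+1) exprD mulnC exprM wn expr1n mul1r.
    have : a *+ (k %% n.+1) = 0.
      by move: ak; rewrite {1}(divn_eq k n.+1) mulrnDr mulnC mulrnA an mul0rn add0r.
    case: (k %% n.+1)%N (ltn_pmod k (ltn0Sn n)) => [|r] rn ar; first by [].
    have nr : (n <= r)%N by apply: nmin; rewrite ar.
    by have := leq_ltn_trans nr rn; rewrite ltnn.
pose F0 := extend G1 a w.
have gF0 : graph_character F0 by exact: graph_extend.
have F0a : F0 (a, w) by exists 0, 1, 1; split; rewrite ?add0r ?mul1r ?expr1z.
(* The fixed part [F0] is adjoined to each member, so that the union of the empty chain also
   qualifies. *)
have [|G [gG Gmax]] := @Zorn_bigcup _ (fun F => graph_character (F0 `|` F)).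
  move=> F FP Ftot; split.
  - move=> x z y v Hx Hy.
    have [E [FE Ex Ey]] : exists E, [/\ E = set0 \/ F E, (F0 `|` E) (x, z) &
        (F0 `|` E) (y, v)].
      case: Hx Hy => [Hx|[E FE Ex]] [Hy|[E' FE' Ey]].
      + by exists set0; split; [left|left|left].
      + by exists E'; split; [right|left|right].
      + by exists E; split; [right|right|left].
      + have [EE'|EE'] := Ftot _ _ FE FE'.
          by exists E'; split; [right|right; apply: EE'|right].
        by exists E; split; [right|right|right; apply: EE'].
    have gE : graph_character (F0 `|` E).
      by case: FE => [->|/FP//]; rewrite setU0.
    have [sE _ _] := gE; have [|] := sE _ _ _ _ Ex Ey; first by left.
    by case: FE => [->//|FE] Exy; right; exists E.
  - move=> x z [Hx|[E FE Ex]]; first by have [_ n1 _] := gF0; exact: n1 Hx.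
    by have [_ n1 _] := FP _ FE; apply: (n1 x); right.
  - move=> z [Hx|[E FE Ex]]; first by have [_ _ G1'] := gF0; exact: G1' Hx.
    by have [_ _ G1'] := FP _ FE; apply: G1'; right.
set U := F0 `|` G in gG.
have Uone : U (0, 1) by apply: graph_one gG (_ : U (a, w)); left.
have Utot b : exists z, U (b, z).
  have [v [v1 hv]] := graph_root b gG.
  have gE := graph_extend gG v1 hv.
  have UE : U `<=` extend U b v.
    by move=> -[x z] Uxz; exists x, z, 0; split=> //; rewrite addr0 mulr1.
  apply: contrapT => nob; apply: (Gmax (extend U b v)); last first.
    by rewrite setUidr//; apply: subset_trans UE; left.
  split; first by apply: subset_trans UE; right.
  move=> /(_ (b, v)) h; apply: nob; exists v; right; apply: h.
  by exists 0, 1, 1; split; rewrite ?add0r ?mul1r ?expr1z.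
have [f fP] := choice Utot.
exists f; split.
- by move=> x y; apply: (graph_fun gG (fP _)); exact: graph_add.
- by move=> x; have [_ n1 _] := gG; exact: n1 (fP x).
- by have -> : f a = w by apply: (graph_fun gG (fP a)); left.
Qed.

End CharacterExtension.

Section ComplexIntegral.
Context (R : realType) (d : measure_display) (T : measurableType d).
Variable mu : {finite_measure set T -> \bar R}.
Local Notation C := (Cplx R).
Local Notation cint := (integral_cplx mu).
Implicit Types u v : T -> C.

Lemma cintD u v : bounded_cplx u -> bounded_cplx v ->
  cint (fun x => u x + v x) = cint u + cint v.
Proof.
move=> [ru iu] [rv iv]; apply: complex_eq; rewrite /= ?cReD ?cImD /=.
  by under eq_Rintegral do rewrite cReD; exact: RintD.
by under eq_Rintegral do rewrite cImD; exact: RintD.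
Qed.

Lemma cintZ (z : C) u : bounded_cplx u ->
  cint (fun x => z * u x) = z * cint u.
Proof.
move=> [ru iu]; apply: complex_eq; rewrite ?cReM ?cImM /=.
  under eq_Rintegral do rewrite cReM.
  by rewrite RintB ?RintZ//; apply: bounded_measurableM => //;
    exact: bounded_measurable_cst.
under eq_Rintegral do rewrite cImM.
by rewrite RintD ?RintZ//; apply: bounded_measurableM => //;
  exact: bounded_measurable_cst.
Qed.

Lemma cint_sum (I : Type) (s : seq I) (u : I -> T -> C) :
  (forall i, bounded_cplx (u i)) ->
  cint (fun x => \sum_(i <- s) u i x) = \sum_(i <- s) cint (u i).
Proof.
move=> bu; elim: s => [|i s IH].
  rewrite big_nil (_ : (fun=> _) = (fun x => 0 * (0 : C))).
    by rewrite cintZ ?mul0r//; exact: bounded_cplx_cst.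
  by apply/funext => x; rewrite big_nil mul0r.
rewrite big_cons -IH -cintD//; last exact: bounded_cplx_sum.
by congr cint; apply/funext => x; rewrite big_cons.
Qed.

Lemma nrmL2_cint u : (nrmL2 mu u)%:C%C = cint (fun x => u x * (u x)^*%R).
Proof.
apply: complex_eq => /=.
  by under [RHS]eq_Rintegral do rewrite mulC_conj/=.
under eq_Rintegral do rewrite mulC_conj/=.
by rewrite Rintegral_cst// mul0r.
Qed.

Lemma nrmL2D_cint u v : bounded_cplx u -> bounded_cplx v ->
  nrmL2 mu (fun x => u x + v x) = nrmL2 mu u + nrmL2 mu v +
    2 * complex.Re (cint (fun x => u x * (v x)^*%R)).
Proof.
move=> bu bv; have bvc := bounded_cplx_conj bv.
have [buv _] := bounded_cplxM bu bvc.
have b1 := bounded_cplx_sqmod bu; have b2 := bounded_cplx_sqmod bv.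
have b3 := bounded_measurableD b1 b2.
have b4 := bounded_measurableM (bounded_measurable_cst T (2 : R)) buv.
rewrite /nrmL2 /= -RintZ// -!RintD//.
apply: eq_Rintegral => x _; rewrite cReM cRe_conj cIm_conj /sqmod cReD cImD.
ring.
Qed.

End ComplexIntegral.

(** * Orthogonality of characters for Haar measure *)

Section Haar.
Variables (R : realType) (A : PreTopologicalZmodule.type).
Hypothesis discreteA : forall a : A, open [set a].
Hypothesis countableA : countable [set: A].
Local Notation C := (Cplx R).
Local Notation dA := (borel (dual R A)).
Variable lambda : probability dA R.
Hypothesis lambda_invariant : forall (x : dual R A) (E : set dA),
  measurable E -> lambda ((fun y : dual R A => x + y) @` E) = lambda E.
Local Notation cint := (integral_cplx lambda).
Local Notation nrm := (nrmL2 lambda).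
Implicit Types P Q : tpoly R A.

Lemma dual_separates (a : A) : a != 0 -> exists chi : dual R A, pairing a chi != 1.
Proof.
move=> /(character_separates R)[f [fM f1 fa]].
have cf : @character R A f.
  split => [x|//|//]; apply: cvg_near_cst.
  have : nbhs x [set x] by apply: open_nbhs_nbhs; split => //; exact: discreteA.
  by apply: filterS => _ ->.
by exists (SigSub (mem_set cf)).
Qed.

Let translate (x : dual R A) : dA -> dA := fun y => (x + y : dual R A).

(** It is enough to test half-planes: translation by x replaces the coefficient z by
    [z * pairing a x]. *)
Let measurable_translate x : measurable_fun setT (translate x).
Proof.
move=> _ E mE; rewrite setTI.
apply: (@borel_dual_ind R A discreteA countableA
  (fun E : set dA => measurable (translate x @^-1` E))) => //.
  split.
  - by rewrite preimage_set0; exact: measurable0.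
  - by move=> B mB; rewrite setTD preimage_setC; exact: measurableC.
  - by move=> B mB; rewrite preimage_bigcup; exact: bigcupT_measurable.
move=> a z q; have [[mf _] _] := bounded_cplxM
  (bounded_cplx_cst _ (z * pairing a x)) (bounded_pairing R a).
rewrite (_ : _ @^-1` _ = (fun chi : dA =>
    complex.Re (z * pairing a x * pairing a chi)) @^-1` `]q, +oo[).
  by rewrite -[X in measurable X]setTI; exact: mf.
apply/seteqP; split => chi /=; rewrite in_itv/= andbT -mulrA; exact.
Qed.

Let Rint_translate (x : dual R A) (f : dA -> R) : bounded_measurable f ->
  \int[lambda]_chi f (translate x chi) = \int[lambda]_chi f chi.
Proof.
move=> [mf [M fM]]; rewrite /Rintegral; congr fine.
have bfx : bounded_measurable (f \o translate x).
  by split; [exact: measurableT_comp|exists M => y; exact: fM].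
have := @integral_pushforward _ _ _ _ _ _ (measurable_translate x) lambda setT
  (EFin \o f) _ _ measurableT.
rewrite preimage_setT => <-//; last exact: bounded_measurable_integrable bfx.
  apply: eq_measure_integral => E mE _; rewrite /pushforward.
  transitivity (lambda ((fun y : dual R A => - x + y) @` E)); last first.
    exact: lambda_invariant.
  congr (lambda _); apply/seteqP; split => y.
    by move=> xy; exists (x + y : dual R A) => //; exact: addKr.
  by move=> [z Ez <-]; rewrite /preimage/= /translate addNKr.
exact/measurable_EFinP.
Qed.

Let Rint_cst (r : R) : \int[lambda]_x r = r.
Proof.
by rewrite Rintegral_cst// [X in fine X](@probability_setT _ _ _ lambda) mulr1.
Qed.

(** For a <> 0 a translation by some x multiplies the integral by [pairing a x], which differs from
    1, and also leaves it unchanged. *)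
Lemma cint_pairing (a : A) : cint (pairing a) = (a == 0)%:R.
Proof.
have [->|/dual_separates[x xa]] := eqVneq a 0.
  apply: complex_eq => /=.
    under eq_Rintegral do rewrite pairing0/=.
    exact: Rint_cst.
  under eq_Rintegral do rewrite pairing0/=.
  exact: Rint_cst.
have bp := bounded_pairing R a.
have : cint (pairing a) = pairing a x * cint (pairing a).
  rewrite -cintZ//; have [r i] := bp; apply: complex_eq => /=.
    by rewrite -(Rint_translate x r).
  by rewrite -(Rint_translate x i).
move/eqP; rewrite -subr_eq0 -{1}[cint _]mul1r -mulrBl mulf_eq0 subr_eq0.
by rewrite eq_sym (negPf xa) => /eqP.
Qed.

Lemma cint_teval P : cint (teval P) = \sum_(t <- P | t.2 == 0) t.1.
Proof.
rewrite cint_sum => [|t]; last first.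
  by apply: bounded_cplxM; [exact: bounded_cplx_cst|exact: bounded_pairing].
rewrite [RHS]big_mkcond/=; apply: eq_bigr => t _.
rewrite cintZ ?cint_pairing; last exact: bounded_pairing.
by case: eqP => _; rewrite ?mulr1 ?mulr0.
Qed.

(** The cross term is the integral of P times the conjugate of Q, whose frequencies are differences
    and so never 0. Repetitions within P or within Q do no harm. *)
Lemma nrmL2_cat P Q :
  (forall t u, t \in P -> u \in Q -> t.2 != u.2) ->
  nrm (teval (P ++ Q)) = nrm (teval P) + nrm (teval Q).
Proof.
move=> PQ; rewrite (_ : teval (P ++ Q) = fun chi => teval P chi + teval Q chi).
  rewrite nrmL2D_cint; [|exact: bounded_teval..].
  rewrite (_ : (fun x => _) = teval (tmul P (tconj Q))); last first.
    by apply/funext => x; rewrite teval_mul teval_conj.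
  rewrite cint_teval big_seq_cond big1 ?mulr0 ?addr0// => t /andP[].
  move=> /allpairsP[[u v] /= [uP /mapP[w wQ ->] ->]] /=.
  by rewrite subr_eq0 (negPf (PQ _ _ uP wQ)).
by apply/funext => x; rewrite teval_cat.
Qed.

Definition tmap (f : A -> A) P : tpoly R A := [seq (t.1, f t.2) | t <- P].

(** The norm depends only on the coefficients and on which frequencies coincide, and an injective f
    preserves coincidences. *)
Lemma nrmL2_tmap (f : {additive A -> A}) P : injective f ->
  nrm (teval (tmap f P)) = nrm (teval P).
Proof.
move=> finj; apply: (@complexI R); rewrite !nrmL2_cint.
have h Q : (fun x => teval Q x * (teval Q x)^*%R) = teval (tmul Q (tconj Q)).
  by apply/funext => x; rewrite teval_mul teval_conj.
rewrite !h !cint_teval /tmul !big_flatten/= !big_map.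
apply: eq_bigr => t _; rewrite !big_map; apply: eq_big => // u /=.
by rewrite -raddfB (raddf_eq0 _ finj).
Qed.

(** Expand the squared norm of u minus its partial Fourier sum. *)
Lemma bessel (u : dA -> C) (s : seq A) : bounded_cplx u -> uniq s ->
  \sum_(a <- s) sqmod (cint (fun chi => u chi * (pairing a chi)^*%R)) <= nrm u.
Proof.
move=> bu us; pose c a := cint (fun chi => u chi * (pairing a chi)^*%R).
pose P : tpoly R A := [seq (- c a, a) | a <- s].
have nP : nrm (teval P) = \sum_(a <- s) sqmod (c a).
  rewrite /P; elim: s us {P} => [_|a s IH /= /andP[nas us]].
    rewrite big_nil /nrmL2; under eq_Rintegral do rewrite /teval big_nil sqmod0.
    by rewrite Rintegral_cst// mul0r.
  rewrite -cat1s nrmL2_cat => [|t t']; last first.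
    rewrite inE => /eqP -> /mapP[b bs ->] /=.
    by apply: contraNneq nas => ->.
  rewrite IH// big_cons; congr (_ + _); rewrite /nrmL2.
  under eq_Rintegral do rewrite teval1 sqmodM sqmod_pairing mulr1 sqmodN.
  exact: Rint_cst.
have := nrmL2_ge0 lambda (fun chi => u chi + teval P chi).
rewrite nrmL2D_cint//; last exact: bounded_teval.
have -> : cint (fun chi => u chi * (teval P chi)^*%R) =
    (- \sum_(a <- s) sqmod (c a))%:C%C.
  rewrite (_ : (fun chi => _) = fun chi => \sum_(a <- s)
      (- (c a)^*%R) * (u chi * (pairing a chi)^*%R)).
    rewrite cint_sum => [|a]; last first.
      apply: bounded_cplxM; first exact: bounded_cplx_cst.
      by apply: bounded_cplxM => //; apply: bounded_cplx_conj; exact: bounded_pairing.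
    rewrite rmorphN rmorph_sum/= -sumrN; apply: eq_bigr => a _.
    rewrite cintZ -/(c a); first by rewrite mulNr mulrC mulC_conj.
    by apply: bounded_cplxM => //; apply: bounded_cplx_conj; exact: bounded_pairing.
  apply/funext => chi; rewrite /teval big_map rmorph_sum mulr_sumr.
  apply: eq_bigr => a _ /=; rewrite rmorphM rmorphN/=; ring.
rewrite /= nP; lra.
Qed.

End Haar.

Lemma subr_continuous (G : topologicalZmodType) (c : G) :
  continuous (fun x : G => x - c).
Proof.
move=> x; apply: (@cvg_comp _ _ _ (fun y : G => (y, c))
  (fun z : G * G => z.1 - z.2) _ _ _ _ (@sub_continuous G (x, c))).
by apply: cvg_pair; [exact: cvg_id|exact: cvg_cst].
Qed.

Section Subgroups.
Variables (G : topologicalZmodType) (S : zmodClosed G).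
Hypothesis S_discrete : discrete_subgroup S.

Lemma discrete_subgroup_nbhs0 :
  exists2 V : set G, nbhs 0 V & forall g : subgroup S, V (val g) -> g = 0.
Proof.
have : [set` S] (0 : G) by exact: rpred0.
rewrite -S_discrete => -[_ [V V0 VS]]; exists V => // g Vg; apply: val_inj.
have : ([set 0] : set G) (val g) by rewrite -VS; split => //; exact: valP g.
by [].
Qed.

Lemma subgroup_set1_open (g : subgroup S) : open [set g].
Proof.
rewrite openE => _ ->; rewrite /interior.
have [V V0 VS] := discrete_subgroup_nbhs0.
have cV : nbhs (val g) ((fun x : G => x - val g) @^-1` V).
  by apply: subr_continuous; rewrite subrr.
have : nbhs g ((val : subgroup S -> G) @^-1` ((fun x : G => x - val g) @^-1` V)).
  exact: (@initial_continuous (subgroup S) G val g).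
apply: filterS => h /= Vh.
by apply/eqP; rewrite -subr_eq0; apply/eqP/VS; rewrite raddfB.
Qed.

Lemma subgroup_countable : countable [set` S] -> countable [set: subgroup S].
Proof.
move=> /countable_injP[f finj]; apply/countable_injP.
exists (f \o val) => x y _ _ /= /finj fxy; apply: val_inj; apply: fxy;
by rewrite inE; exact: valP.
Qed.

End Subgroups.

(** * Zero sets of trigonometric polynomials *)

Section NonvanishingPolynomials.
Variables (R : realType) (G : topologicalZmodType).
Hypothesis G_locally_compact : locally_compact [set: G].
Variable haarG : {measure set (borel G) -> \bar R}.
Hypothesis haarG_haar : is_haar haarG.
Variable Gamma : zmodClosed G.
Hypothesis Gamma_countable : countable [set` Gamma].
Hypothesis Gamma_discrete : discrete_subgroup Gamma.
Local Notation A := (subgroup Gamma).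
Local Notation C := (Cplx R).
Local Notation dA := (borel (dual R A)).
Variable lambda : probability dA R.
Hypothesis lambda_haar : is_haar lambda.
Hypothesis translates_indep : translates_independent Gamma haarG.

(** V meets Gamma only in 0, and differences of points of U lie in V; hence the translates of U by
    Gamma are disjoint. Lying in a compact set, U has finite measure. *)
Let separating_nbhs : exists U : set G, [/\ open U, U 0,
  (haarG U < +oo)%E & forall (x : G) (g h : A), U (x - val g) ->
    U (x - val h) -> g = h].
Proof.
have [V V0 VS] := discrete_subgroup_nbhs0 Gamma_discrete.
have [K K0 [cK clK]] := G_locally_compact (I : [set: G] 0).
have K0' : nbhs (0 : G) K.
  by have h := K0; rewrite /within/= in h; apply: filterS h => x; apply.
have /(_ V)[|[/= W W'] [W0 W'0] WV] := @sub_continuous G (0, 0).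
  by rewrite /= subrr.
pose U := interior (W `&` W' `&` K).
have U0 : U 0 by apply: filterI => //; exact: filterI.
have oU : open U by exact: open_interior.
have UK : U `<=` K by move=> x /interior_subset[].
have haarK : (haarG K < +oo)%E by case: haarG_haar => _ h _; exact: h.
exists U; split => //.
  apply: le_lt_trans haarK; apply: le_measure => //; rewrite inE.
    exact: sub_sigma_algebra.
  rewrite -[K]setCK; apply: measurableC; apply: sub_sigma_algebra.
  exact: closed_openC.
move=> x g h /interior_subset[[Wg _] _] /interior_subset[[_ W'h] _].
apply/esym/eqP; rewrite -subr_eq0; apply/eqP/VS.
have -> : val (h - g) = (x - val g) - (x - val h).
  by rewrite opprB [RHS]addrC addrA subrK raddfB.
by apply: (WV (x - val g, x - val h)).
Qed.

Lemma tpoly_neq0_ae (s : seq A) (c : A -> C) : uniq s ->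
  (exists2 a, a \in s & c a != 0) ->
  lambda [set chi | teval [seq (c a, a) | a <- s] chi = 0] = 0%E.
Proof.
move=> us [a0 a0s ca0]; set P := [seq (c a, a) | a <- s]; set E := [set _ | _].
have discreteA (a : A) : open [set a] by exact: subgroup_set1_open.
have countableA : countable [set: A] by exact: subgroup_countable.
have lam_inv (x : dual R A) (B : set dA) : measurable B ->
    lambda ((fun y : dual R A => x + y) @` B) = lambda B.
  by case: lambda_haar => h _ _; exact: h.
have mE : measurable E.
  have [[mr _] [mi _]] := bounded_teval P.
  rewrite (_ : E = (fun chi => complex.Re (teval P chi)) @^-1` [set 0] `&`
    (fun chi => complex.Im (teval P chi)) @^-1` [set 0]).
    apply: measurableI; rewrite -[X in measurable X]setTI.
      exact: mr.
    exact: mi.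
  apply/seteqP; split => chi /=; first by move=> ->.
  by move=> [r i]; exact: complex_eq.
apply: contrapT => lamE.
pose u (chi : dA) : C := (\1_E chi)%:C%C.
have bu : bounded_cplx u by exact/bounded_cplx_real/bounded_measurable_indic.
have bp (a : A) : bounded_cplx (fun chi : dA => u chi * (pairing a chi)^*%R).
  by apply: bounded_cplxM => //; apply: bounded_cplx_conj; exact: bounded_pairing.
pose a (g : A) := integral_cplx lambda (fun chi => u chi * (pairing g chi)^*%R).
have a00 : a 0 != 0.
  have -> : a 0 = (fine (lambda E))%:C%C.
    apply: complex_eq => /=.
      by under eq_Rintegral do rewrite pairing0 conjC1 mulr1/=; exact: Rint_indic.
    under eq_Rintegral do rewrite pairing0 conjC1 mulr1/=.
    by rewrite Rintegral_cst// mul0r.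
  apply/eqP => /(congr1 (@complex.Re _)) /= h; apply: lamE.
  by rewrite -[LHS]fineK ?fin_num_measure// h.
have nu : nrmL2 lambda u <= 1.
  rewrite /nrmL2; under eq_Rintegral do rewrite sqmod_real.
  have -> : 1 = \int[lambda]_x (1 : R).
    by rewrite Rintegral_cst// [X in fine X](@probability_setT _ _ _ lambda) mulr1.
  have b1 := bounded_measurable_indic R mE.
  apply: le_Rint => [||x]; [exact: bounded_measurableM|exact: bounded_measurable_cst|].
  by rewrite indicE; case: (_ \in _); rewrite ?expr1n ?expr0n.
have ab (t : seq A) : uniq t -> \sum_(g <- t) sqmod (a g) <= 1.
  by move=> ut; apply: le_trans nu; exact: bessel.
have [U [oU U0 haarU Usep]] := separating_nbhs.
(* The Fourier coefficients of 1_E, spread over G: f equals a g on U + g. By [Usep] the chosen g is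
   the only possible one. *)
pose f (x : borel G) : C := if pselect (exists g : A, U ((x : G) - val g))
  is left h then a (sval (cid h)) else 0.
have fE (x : G) (g : A) : U (x - val g) -> f x = a g.
  move=> Ug; rewrite /f; case: pselect => [h|[]]; last by exists g.
  by congr a; case: cid => h' /= Uh'; exact: Usep Uh' Ug.
have f0 (x : G) : ~ (exists g : A, U (x - val g)) -> f x = 0.
  by rewrite /f; case: pselect.
(* On U + g the sum is the integral of 1_E P against the conjugate of g, and P = 0 on E. Off the
   union of all U + g every term vanishes, as that union is invariant under Gamma. *)
have rel (x : G) : \sum_(g <- s) c g * f (x - val g) = 0.
  have [[g Ug]|noU] := pselect (exists g : A, U (x - val g)); last first.
    rewrite big1// => h _; rewrite f0 ?mulr0// => -[k Uk]; apply: noU.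
    exists (h + k); have -> : val (h + k) = val h + val k by rewrite raddfD.
    by rewrite opprD addrA.
  rewrite (eq_bigr (fun h => integral_cplx lambda (fun chi =>
      c h * (u chi * (pairing (g - h) chi)^*%R)))); last first.
    move=> h _; rewrite (fE _ (g - h)); last first.
      have -> : val (g - h) = val g - val h by rewrite raddfB.
      by rewrite opprB addrA subrK.
    by rewrite cintZ.
  rewrite -cint_sum; last first.
    by move=> h; apply: bounded_cplxM => //; exact: bounded_cplx_cst.
  have -> : (fun chi => \sum_(h <- s) c h * (u chi * (pairing (g - h) chi)^*%R)) =
      (fun chi : dA => 0 * (0 : C)).
    apply/funext => chi; rewrite mul0r.
    transitivity (u chi * (pairing g chi)^*%R * teval P chi).
      rewrite /P /teval big_map mulr_sumr; apply: eq_bigr => h _ /=.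
      by rewrite pairingD pairingN rmorphM/= conjCK; ring.
    rewrite /u indicE; have [|_] := boolP (chi \in E); last by rewrite !mul0r.
    by rewrite inE /E/= => ->; rewrite mulr0.
  by rewrite cintZ ?mul0r//; exact: bounded_cplx_cst.
pose OU (Q : set A) := [set x : G | exists2 g, Q g & U (x - val g)].
have oOU Q : open (OU Q).
  rewrite (_ : OU Q = \bigcup_(g in Q) ((fun x : G => x - val g) @^-1` U)).
    apply: bigcup_open => g _; apply: open_comp => // x _.
    exact: subr_continuous.
  by apply/seteqP; split => x [g]; exists g.
have mOU Q : measurable (OU Q : set (borel G)) by exact: sub_sigma_algebra.
(* As f is constant on each open set U + g and 0 elsewhere, a preimage is a union of such sets, or
   the complement of one when it contains the points where f = 0 by default. *)
have mf (p : C -> R) : measurable_fun setT (p \o f).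
  move=> _ B mB; rewrite setTI.
  have [B0|B0] := pselect (B (p 0)).
    rewrite (_ : _ @^-1` _ = ~` OU [set g | ~ B (p (a g))]).
      exact: measurableC.
    apply/seteqP; split => x /=; first by move=> Bx [g Bg /fE fx]; rewrite fx in Bx.
    move=> nx; have [[g Ug]|noU] := pselect (exists g : A, U (x - val g)).
      by rewrite (fE _ _ Ug); apply: contrapT => Bg; apply: nx; exists g.
    by rewrite f0.
  rewrite (_ : _ @^-1` _ = OU [set g | B (p (a g))])//.
  apply/seteqP; split => x /=; last by move=> [g Bg /fE ->].
  have [[g Ug]|noU] := pselect (exists g : A, U (x - val g)).
    by rewrite (fE _ _ Ug) => Bg; exists g.
  by rewrite f0.
have haarOU (g : A) : haarG (OU [set g]) = haarG U.
  have h : forall (x : G) (B : set (borel G)), measurable B ->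
      haarG ((fun y : G => x + y) @` B) = haarG B by case: haarG_haar.
  rewrite -[RHS](h (val g)); last exact: sub_sigma_algebra.
  congr (haarG _); apply/seteqP; split => x /=.
    by move=> [_ -> Ux]; exists (x - val g) => //; rewrite addrC subrK.
  by move=> [y Uy <-]; exists g => //; rewrite addrAC subrr add0r.
have [code codeI] := countable_injP _ countableA.
(* A partial enumeration of A, so that |f|^2 is dominated by a series over nat; an index that codes
   no element contributes 0. *)
pose dec n : option A := if pselect (exists g, code g = n) is left h
  then Some (sval (cid h)) else None.
have decK g : dec (code g) = Some g.
  rewrite /dec; case: pselect => [h|[]]; last by exists g.
  by congr Some; case: cid => k /= /codeI ->//; rewrite inE.
have decC : ocancel dec code.
  by move=> n; rewrite /dec; case: pselect => //= h; case: cid.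
pose F n (x : borel G) : \bar R := if dec n is Some g
  then ((sqmod (a g))%:E * (\1_(OU [set g]) x)%:E)%E else 0%E.
have F0 n x : (0 <= F n x)%E.
  by rewrite /F; case: (dec n) => // g; rewrite mule_ge0// lee_fin ?sqmod_ge0.
have mF n : measurable_fun setT (F n).
  rewrite /F; case: (dec n) => [g|]; last exact: measurable_cst.
  by apply: measurable_funeM; apply/measurable_EFinP; exact: measurable_indic.
have iF n : (\int[haarG]_x F n x = if dec n is Some g
    then (sqmod (a g) * fine (haarG U))%:E else 0)%E.
  rewrite /F; case: (dec n) => [g|]; last by rewrite integral0.
  rewrite ge0_integralZl//; last 2 first.
    by apply/measurable_EFinP; exact: measurable_indic.
    by rewrite lee_fin sqmod_ge0.
  by rewrite integral_indic// setIT haarOU EFinM fineK// ge0_fin_numE.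
have fL2 : in_L2 haarG setT f.
  split; first by split; exact: mf.
  have msq : measurable_fun setT (fun x => (ComplexField.Normc.normc (f x) ^+ 2)%:E).
    by apply/measurable_EFinP; exact: (mf (fun z => ComplexField.Normc.normc z ^+ 2)).
  apply: (@le_lt_trans _ _ (\int[haarG]_x (\sum_(n <oo) F n x))%E).
    apply: ge0_le_integral => //.
    - by move=> x _; rewrite lee_fin sqr_ge0.
    - by apply: (ge0_emeasurable_sum (P := xpredT)).
    - move=> x _; rewrite normc_sqr.
      have [[g Ug]|noU] := pselect (exists g : A, U ((x : G) - val g)); last first.
        by rewrite f0// sqmod0; apply: nneseries_ge0 => n _ _.
      apply: le_trans (nneseries_lim_ge (code g).+1 _) => //.
      rewrite big_nat_recr//= -[leLHS]add0e leeD//; first by apply: sume_ge0.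
      rewrite /F decK (fE _ _ Ug) indicE mem_set; last by exists g.
      by rewrite mule1.
  rewrite integral_nneseries//; apply: (@le_lt_trans _ _ (fine (haarG U))%:E).
    apply: lime_le; first by apply: is_cvg_nneseries => n _ _; exact: integral_ge0.
    apply: nearW => n.
    rewrite (eq_bigr (fun n => (if dec n is Some g
      then (sqmod (a g) * fine (haarG U)) else 0)%:E)); last first.
      by move=> i _; rewrite iF; case: (dec i).
    rewrite sumEFin lee_fin.
    have -> : \sum_(0 <= i < n) (if dec i is Some g
        then sqmod (a g) * fine (haarG U) else 0) =
        fine (haarG U) * \sum_(g <- pmap dec (iota 0 n)) sqmod (a g).
      rewrite /index_iota subn0; elim: (iota 0 n) => [|i t IH].
        by rewrite !big_nil mulr0.
      rewrite big_cons IH /=; case: (dec i) => [g|]/=; last by rewrite add0r.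
      by rewrite big_cons mulrDr mulrC.
    rewrite ler_piMr ?fine_ge0 ?measure_ge0//; apply: ab.
    by apply: pmap_uniq decC _ _; exact: iota_uniq.
  by rewrite ltry.
(* On the nonempty open set U, of positive Haar measure, f has the value a 0, that is, the measure
   of E. *)
have fneq0 : ~ (f = 0 %[ae haarG]).
  move=> [N [mN N0 fN]].
  have v0 : val (0 : A) = 0 by rewrite raddf0.
  have UN : U `<=` N.
    move=> x Ux; apply: fN => /= /(_ I); rewrite (fE x 0); last by rewrite v0 subr0.
    by apply/eqP.
  have /(_ U oU)h : forall U : set G, open U -> U !=set0 -> (0 < haarG U)%E.
    by case: haarG_haar.
  have := h (ex_intro _ 0 U0); rewrite lt_neqAle => /andP[/eqP + _]; apply.
  apply/esym/eqP; rewrite eq_le measure_ge0 andbT -N0.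
  by apply: le_measure => //; rewrite inE//; exact: sub_sigma_algebra.
have := translates_indep fL2 fneq0 us (c := c).
suff hZ : [set h : borel G -> C | h = 0 %[ae haarG]]
    (\sum_(i <- s) c i *: (fun x : borel G => f ((x : G) - val i))).
  by move=> /(_ hZ a0 a0s)/eqP; rewrite (negPf ca0).
apply: aeW => x _; rewrite fct_sumE; exact: rel.
Qed.

(** Distinct frequencies rule out cancellation and let the coefficient be read as a function of the
    frequency. *)
Lemma tpoly_uniq_neq0_ae (P : tpoly R A) : uniq (unzip2 P) ->
  (exists2 t, t \in P & t.1 != 0) ->
  lambda [set chi | teval P chi = 0] = 0%E.
Proof.
move=> uP [t tP t0]; pose c a := (nth (0, 0) P (index a (unzip2 P))).1.
have sP : size (unzip2 P) = size P by rewrite size_map.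
have PE : P = [seq (c a, a) | a <- unzip2 P].
  apply: (@eq_from_nth _ (0, 0)) => [|i iP]; first by rewrite size_map sP.
  rewrite (nth_map 0) ?sP// /c index_uniq ?sP// (nth_map (0, 0))//.
  by case: nth.
rewrite PE; apply: tpoly_neq0_ae => //; exists t.2; first exact: map_f.
rewrite /c; have [i iP it] : exists2 i, (i < size P)%N & t = nth (0, 0) P i.
  by exists (index t P); rewrite ?index_mem// nth_index.
have -> : index t.2 (unzip2 P) = i.
  by rewrite it -(nth_map (0, 0) 0 snd iP) index_uniq ?sP.
by rewrite -it.
Qed.

End NonvanishingPolynomials.

(** * Unitary representations *)

Section HilbertSpace.
Variables (R : realType) (H : completeNormedModType (Cplx R)).
Local Notation C := (Cplx R).
Variable dot : {dot H for (@conjC C)}.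
Hypothesis H_norm : hilbert_norm dot.
Implicit Types (x y z : H) (c : C) (M : set H).

Lemma dotDl x y z : dot (x + y) z = dot x z + dot y z.
Proof. exact: linearDl. Qed.
Lemma dotZl c x y : dot (c *: x) y = c * dot x y.
Proof. exact: linearZl_LR. Qed.
Lemma dotC x y : dot y x = (dot x y)^*%R.
Proof. by rewrite hermC expr0 mul1r. Qed.
Lemma dotDr x y z : dot x (y + z) = dot x y + dot x z.
Proof. by rewrite dotC dotDl rmorphD/= -!dotC. Qed.
Lemma dotZr c x y : dot x (c *: y) = c^*%R * dot x y.
Proof. by rewrite dotC dotZl rmorphM/= -dotC. Qed.
Lemma dotNl x y : dot (- x) y = - dot x y.
Proof. by rewrite -scaleN1r dotZl mulN1r. Qed.
Lemma dotNr x y : dot x (- y) = - dot x y.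
Proof. by rewrite dotC dotNl rmorphN/= -dotC. Qed.
Lemma dotBl x y z : dot (x - y) z = dot x z - dot y z.
Proof. by rewrite dotDl dotNl. Qed.
Lemma dotBr x y z : dot x (y - z) = dot x y - dot x z.
Proof. by rewrite dotDr dotNr. Qed.
Lemma dot0l x : dot 0 x = 0.
Proof. by rewrite -(scale0r (0 : H)) dotZl mul0r. Qed.
Lemma dot0r x : dot x 0 = 0.
Proof. by rewrite dotC dot0l conjC0. Qed.
Lemma dot_suml (I : Type) (s : seq I) (f : I -> H) y :
  dot (\sum_(i <- s) f i) y = \sum_(i <- s) dot (f i) y.
Proof.
elim: s => [|i s IH]; first by rewrite !big_nil dot0l.
by rewrite !big_cons dotDl IH.
Qed.
Lemma dot_sumr (I : Type) (s : seq I) (f : I -> H) y :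
  dot y (\sum_(i <- s) f i) = \sum_(i <- s) dot y (f i).
Proof.
rewrite dotC dot_suml rmorph_sum/=; apply: eq_bigr => i _.
by rewrite -dotC.
Qed.

Definition sqn x : R := complex.Re (dot x x).

Lemma dot_sqn x : dot x x = (sqn x)%:C%C.
Proof.
apply: complex_eq => //=; have := congr1 (@complex.Im R) (dotC x x).
by rewrite cIm_conj; lra.
Qed.

Lemma norm_sqn x : `|x| ^+ 2 = (sqn x)%:C%C.
Proof. by rewrite H_norm dot_sqn. Qed.

Lemma sqn_ge0 x : 0 <= sqn x.
Proof. by rewrite -leCR -norm_sqn exprn_ge0. Qed.

Lemma sqn_eq0 x : sqn x = 0 -> x = 0.
Proof.
move=> x0; apply/eqP; rewrite -normr_eq0 -sqrf_eq0; apply/eqP.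
by rewrite norm_sqn x0.
Qed.

Lemma sqn0 : sqn 0 = 0. Proof. by rewrite /sqn dot0l. Qed.

Lemma sqnN x : sqn (- x) = sqn x.
Proof. by rewrite /sqn dotNl dotNr opprK. Qed.

Lemma sqnBC x y : sqn (x - y) = sqn (y - x).
Proof. by rewrite -sqnN opprB. Qed.

Lemma sqnZ c x : sqn (c *: x) = sqmod c * sqn x.
Proof.
apply: (@complexI R); rewrite rmorphM/= -!dot_sqn dotZl dotZr mulrA.
by rewrite mulC_conj.
Qed.

Lemma sqnD x y : sqn (x + y) = sqn x + sqn y + 2 * complex.Re (dot x y).
Proof.
rewrite /sqn dotDl !dotDr !cReD (dotC x y) cRe_conj; ring.
Qed.

Lemma sqnB x y : sqn (x - y) = sqn x + sqn y - 2 * complex.Re (dot x y).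
Proof. by rewrite sqnD sqnN dotNr cReN mulrN. Qed.

Lemma sqnD_le x y : sqn (x + y) <= 2 * sqn x + 2 * sqn y.
Proof. have := sqn_ge0 (x - y); rewrite sqnB sqnD; lra. Qed.

Lemma sqn_triangle x y z : sqn (x - z) <= 2 * sqn (x - y) + 2 * sqn (y - z).
Proof.
rewrite (_ : x - z = (x - y) + (y - z)); first exact: sqnD_le.
by rewrite addrA subrK.
Qed.

Lemma cauchy_schwarz x y : sqmod (dot x y) <= sqn x * sqn y.
Proof.
have [y0|y0] := eqVneq (sqn y) 0.
  by rewrite y0 (sqn_eq0 y0) dot0r sqmod0 mulr0.
have yp : 0 < sqn y by rewrite lt_neqAle eq_sym y0 sqn_ge0.
have := sqn_ge0 ((sqn y)%:C%C *: x - dot x y *: y).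
rewrite sqnB !sqnZ sqmod_real dotZl dotZr cReM/=.
have -> : (dot x y)^*%R * dot x y = (sqmod (dot x y))%:C%C.
  by rewrite mulrC mulC_conj.
rewrite /= mul0r subr0 => h.
have {}h : 0 <= sqn y * (sqn x * sqn y - sqmod (dot x y)) by move: h; lra.
by move: h; rewrite pmulr_rge0// subr_ge0.
Qed.

Lemma sqn_cauchy_cvg (u : nat -> H) :
  (forall e, 0 < e -> exists N, forall m n, (N <= m)%N -> (N <= n)%N ->
    sqn (u m - u n) < e) ->
  exists l, forall e, 0 < e -> exists N, forall n, (N <= n)%N ->
    sqn (u n - l) < e.
Proof.
move=> uC.
have nlt x (e : R) : 0 < e -> (`|x| < e%:C%C) = (sqn x < e ^+ 2).
  move=> e0; rewrite -(@ltr_pXn2r _ 2)// ?nnegrE ?leCR ?(ltW e0)//.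
  by rewrite norm_sqn -rmorphXn/= ltCR.
have eE (e : C) : 0 < e -> 0 < complex.Re e /\ e = (complex.Re e)%:C%C.
  by move=> e0; move: (e0); rewrite ltcE => /andP[/eqP h1 h2]; split => //; exact: complex_eq.
have cu : cauchy (u @ \oo).
  apply/cauchy_ballP => e /eE[e0 ->]; set r := complex.Re e in e0 *.
  have [|N uN] := uC (r ^+ 2); first by rewrite exprn_gt0.
  pose B := u @` [set n | (N <= n)%N].
  have FB : (u @ \oo) B by exists N => // n Nn; exists n.
  exists (B, B) => // -[_ _] [[m Nm <-] [n Nn <-]] /=.
  by rewrite -ball_normE/= nlt//; exact: uN.
have /cauchy_cvgP/cvg_ex[l ul] := cu.
exists l => e e0; have se : 0 < Num.sqrt e by rewrite sqrtr_gt0.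
have seC : (0 : C) < (Num.sqrt e)%:C%C by rewrite ltCR.
have [N _ h] := ul _ (nbhsx_ballx l _ seC).
exists N => n /h; rewrite /= -ball_normE/= nlt// sqnBC sqr_sqrtr//; exact: ltW.
Qed.

Definition closed_subspace M := [/\ M 0,
  forall x y, M x -> M y -> M (x + y), forall c x, M x -> M (c *: x) &
  forall x, (forall e, 0 < e -> exists2 y, M y & sqn (x - y) < e) -> M x].

Lemma closed_subspaceB M x y : closed_subspace M -> M x -> M y -> M (x - y).
Proof.
move=> [_ MD MZ _] Mx My; apply: MD => //.
by rewrite -scaleN1r; exact: MZ.
Qed.

(** A minimizing sequence for the distance to M is Cauchy by the parallelogram law, and x - u n is
    nearly orthogonal to M with an explicit error, which passes to the limit. *)
Lemma orthogonal_projection M x : closed_subspace M ->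
  exists2 m, M m & forall y, M y -> dot (x - m) y = 0.
Proof.
move=> cM; have [M0 MD MZ Mcl] := cM.
pose D := [set sqn (x - m) | m in M].
have infD : has_inf D.
  by split; [exists (sqn (x - 0)); exists 0|exists 0 => _ [m _ <-]; exact: sqn_ge0].
pose d := inf D.
have dle m : M m -> d <= sqn (x - m).
  by move=> Mm; apply: (ge_inf (proj2 infD)); exists m.
have exm n : exists m, M m /\ sqn (x - m) < d + n.+1%:R^-1.
  have n0 : 0 < n.+1%:R^-1 :> R by rewrite invr_gt0.
  have [_ [m Mm <-] h] := inf_adherent n0 infD.
  by exists m.
have [u uP] := choice exm.
(* Moving u n by the best multiple of y lowers the squared distance by |<v, y>|^2 / |y|^2, which
   near-minimality bounds by 1 / (n + 1). *)
have small n y : M y -> sqmod (dot (x - u n) y) <= n.+1%:R^-1 * sqn y.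
  move=> My; have [Mu ud] := uP n.
  have [y0|y0] := eqVneq (sqn y) 0.
    by rewrite y0 (sqn_eq0 y0) dot0r sqmod0 mulr0.
  have yp : 0 < sqn y by rewrite lt_neqAle eq_sym y0 sqn_ge0.
  set v := x - u n in ud *; pose c := ((sqn y)^-1)%:C%C * dot v y.
  have := dle (u n + c *: y) (MD _ _ Mu (MZ c _ My)).
  rewrite opprD addrA -/v sqnB sqnZ dotZr /c rmorphM/= -mulrA.
  have -> : (dot v y)^*%R * dot v y = (sqmod (dot v y))%:C%C.
    by rewrite mulrC mulC_conj.
  rewrite conjCE conjc_real -rmorphM/= sqmodM sqmod_real => h.
  set s := sqmod _ in h *.
  have E : (sqn y)^-1 ^+ 2 * s * sqn y = (sqn y)^-1 * s by field.
  rewrite E in h; have {}h : (sqn y)^-1 * s < n.+1%:R^-1.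
    by move: ud h; move: (_ * s) (sqn v) (_^-1) => w V e; lra.
  by rewrite mulrC ltr_pdivrMr// in h; exact: ltW.
(* Parallelogram law, with the midpoint of u n and u m as competitor. *)
have smallv n m : sqn (u n - u m) <= 2 * n.+1%:R^-1 + 2 * m.+1%:R^-1.
  have [Mn dn] := uP n; have [Mm dm] := uP m.
  have hMZ : M ((1 / 2)%:C%C *: (u n + u m)) by apply/MZ/MD.
  have := dle _ hMZ.
  have -> : x - (1 / 2)%:C%C *: (u n + u m) =
      (1 / 2)%:C%C *: ((x - u n) + (x - u m)).
    rewrite -[x in LHS]scale1r.
    have -> : (1 : C) = (1 / 2)%:C%C + (1 / 2)%:C%C.
      by rewrite -rmorphD/= -splitr.
    by rewrite scalerDl -!scalerDr -scalerBr; congr (_ *: _); rewrite opprD addrACA.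
  rewrite sqnZ sqmod_real => h.
  have := sqnD (x - u n) (x - u m); have := sqnB (x - u n) (x - u m).
  have -> : x - u n - (x - u m) = u m - u n by rewrite opprB addrC addrA subrK.
  rewrite sqnBC => h1 h2; rewrite h1; move: h; rewrite h2.
  move: dn dm; move: (sqn (x - u n)) (sqn (x - u m)) (n.+1%:R^-1) (m.+1%:R^-1).
  by move: (complex.Re _) => r a b e1 e2; lra.
have [l ul] : exists l, forall e, 0 < e -> exists N, forall n, (N <= n)%N ->
    sqn (u n - l) < e.
  apply: sqn_cauchy_cvg => e e0; have e4 : 0 < e / 4 by lra.
  have [N _ NP] := near_infty_natSinv_lt (PosNum e4).
  exists N => m n Nm Nn; have := NP _ Nm; have := NP _ Nn => /= h1 h2.
  apply: le_lt_trans (smallv m n) _; move: h1 h2.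
  by move: (n.+1%:R^-1) (m.+1%:R^-1) => a b; lra.
have Ml : M l.
  apply: Mcl => e e0; have [N h] := ul _ e0.
  by exists (u N); [case: (uP N)|rewrite sqnBC; exact: h].
exists l => // y My; apply/eqP; rewrite -sqmod_eq0 eq_le sqmod_ge0 andbT.
apply/ler_addgt0Pr => e e0; rewrite add0r.
pose K := sqn y + 1; have K0 : 0 < K by rewrite ltr_wpDl ?sqn_ge0.
have eK : 0 < e / (4 * K) by rewrite divr_gt0// mulr_gt0.
have [N h] := ul _ eK; have [N' _ h'] := near_infty_natSinv_lt (PosNum eK).
pose n := maxn N N'.
have hn := h n (leq_maxl _ _); have hn' := h' n (leq_maxr _ _).
rewrite /= in hn'; rewrite ltr_pdivlMr ?mulr_gt0// in hn.
rewrite ltr_pdivlMr ?mulr_gt0// in hn'.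
rewrite (_ : x - l = (x - u n) + (u n - l)); last by rewrite addrA subrK.
rewrite dotDl; apply: le_trans (sqmodD_le _ _) _.
have s1 := small n y My; have s2 := cauchy_schwarz (u n - l) y.
have yK : sqn y <= K by rewrite /K; lra.
have k1 : n.+1%:R^-1 * sqn y <= n.+1%:R^-1 * K by rewrite ler_wpM2l.
have k2 : sqn (u n - l) * sqn y <= sqn (u n - l) * K.
  by rewrite ler_wpM2l ?sqn_ge0.
move: s1 s2 k1 k2 hn hn'; move: (n.+1%:R^-1) => k.
move: (sqmod _) (sqmod _) (sqn (u n - l)) => a b c.
move: (k * sqn y) (c * sqn y) => p q; rewrite !(mulrCA _ 4).
move: (k * K) (c * K) => p' q'; lra.
Qed.

End HilbertSpace.

(** * Polynomials in the representation and spectral measures of vectors *)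

Section Representation.
Variables (R : realType) (H : completeNormedModType (Cplx R)).
Local Notation C := (Cplx R).
Variable dot : {dot H for (@conjC C)}.
Hypothesis H_norm : hilbert_norm dot.
Variable A : PreTopologicalZmodule.type.
Variable pi : A -> unitary_op dot.
Hypothesis pi_rep : unitary_rep pi.
Local Notation dA := (borel (dual R A)).
Local Notation sqn := (sqn dot).
Implicit Types (P Q : tpoly R A) (x y f g : H) (a b : A).

Definition act P f : H := \sum_(t <- P) t.1 *: pi t.2 f.

Lemma pi0 x : pi 0 x = x.
Proof. by apply: (can_inj (uvalK (pi 0))); rewrite -pi_rep addr0. Qed.

Lemma pi_adjoint a x y : dot (pi a x) y = dot x (pi (- a) y).
Proof. by rewrite -(uval_dot (pi (- a))) -pi_rep addNr pi0. Qed.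

Lemma sqn_pi a x : sqn (pi a x) = sqn x.
Proof. by rewrite /sqn uval_dot. Qed.

Lemma pi_sum a (I : Type) (s : seq I) (u : I -> H) :
  pi a (\sum_(i <- s) u i) = \sum_(i <- s) pi a (u i).
Proof. exact: raddf_sum. Qed.

Lemma act_cat P Q f : act (P ++ Q) f = act P f + act Q f.
Proof. by rewrite /act big_cat. Qed.

Lemma act_single (z : C) a f : act [:: (z, a)] f = z *: pi a f.
Proof. by rewrite /act big_seq1. Qed.

Lemma actB P f g : act P (f - g) = act P f - act P g.
Proof. by rewrite /act -sumrB; apply: eq_bigr => t _; rewrite raddfB scalerBr. Qed.

Lemma act_mul P Q f : act (tmul P Q) f = act P (act Q f).
Proof.
rewrite /act /tmul big_flatten/= big_map; apply: eq_bigr => t _.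
rewrite big_map pi_sum scaler_sumr; apply: eq_bigr => u _ /=.
by rewrite linearZ/= scalerA pi_rep.
Qed.

Lemma act_adjoint P f g : dot (act P f) g = dot f (act (tconj P) g).
Proof.
rewrite /act dot_suml dot_sumr big_map; apply: eq_bigr => t _ /=.
by rewrite dotZl dotZr conjCK pi_adjoint.
Qed.

Lemma dot_act P Q f g :
  dot (act P g) (act Q f) = dot (act (tmul (tconj Q) P) g) f.
Proof.
by rewrite act_mul [LHS]dotC act_adjoint -dotC.
Qed.

Lemma dot_act_coef (nu : {finite_measure set dA -> \bar R}) P f g :
  (forall a, dot (pi a g) f = integral_cplx nu (pairing a)) ->
  dot (act P g) f = integral_cplx nu (teval P).
Proof.
move=> fnu; rewrite cint_sum => [|t]; last first.
  by apply: bounded_cplxM; [exact: bounded_cplx_cst|exact: bounded_pairing].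
rewrite /act dot_suml; apply: eq_bigr => t _.
by rewrite cintZ ?dotZl ?fnu//; exact: bounded_pairing.
Qed.

Lemma sqn_act P f (nu : {finite_measure set dA -> \bar R}) :
  (forall a, dot (pi a f) f = integral_cplx nu (pairing a)) ->
  sqn (act P f) = nrmL2 nu (teval P).
Proof.
move=> fnu; apply: (@complexI R); rewrite -dot_sqn nrmL2_cint dot_act.
rewrite (dot_act_coef _ fnu); congr integral_cplx; apply/funext => chi.
by rewrite teval_mul teval_conj mulrC.
Qed.

Definition pi_subspace M := closed_subspace dot M /\ pi_invariant pi M.

Lemma pi_subspace_act M P f : pi_subspace M -> M f -> M (act P f).
Proof.
move=> [[M0 MD MZ _] Mpi] Mf; rewrite /act; elim: P => [|t P IH].
  by rewrite big_nil.
by rewrite big_cons; apply: MD => //; apply: MZ; apply: Mpi; exists f.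
Qed.

Lemma pi_subspace_orth M f a y : pi_subspace M ->
  (forall y, M y -> dot f y = 0) -> M y -> dot (pi a f) y = 0.
Proof.
move=> [_ Mpi] fM My; rewrite pi_adjoint; apply: fM; apply: Mpi.
by exists y.
Qed.

Lemma act_orth M f P y : pi_subspace M ->
  (forall y, M y -> dot f y = 0) -> M y -> dot (act P f) y = 0.
Proof.
move=> hM fM My; rewrite /act dot_suml big1// => t _.
by rewrite dotZl (pi_subspace_orth _ hM fM My) mulr0.
Qed.

Variable lambda : probability dA R.
Variable mu : {finite_measure set dA -> \bar R}.
Hypothesis mu_spectral : is_spectral_measure pi mu.
Hypothesis mu_abs_cont : mu `<< lambda.

(** All that is used later of the spectral decomposition. The last field provides a vector g that
    corresponds to 1_E when [act Q f] corresponds to [teval Q] in L^2(nu): it stands for the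
    spectral projection of f. *)
Record spectral (f : H) (nu : {finite_measure set dA -> \bar R}) : Prop := {
  spectral_coef : forall a, dot (pi a f) f = integral_cplx nu (pairing a);
  spectral_ac : nu `<< lambda;
  spectral_cut : forall E, measurable E -> exists g, forall P Q,
    sqn (act P g + act Q f) =
    nrmL2 nu (fun chi => (\1_E chi)%:C%C * teval P chi + teval Q chi) }.

(** Take nu(E) = <p(E) f, f>. On the model side p(E) is multiplication by 1_E: it vanishes for
    mu-null E, so nu << mu << lambda, and it commutes with pi. For the cut take g = p(E) f, whose
    measure is nu restricted to E. *)
Lemma spectral_exists f : exists nu, spectral f nu.
Proof.
have [sigma [p [T [[p_proj pT pI p_nu] sd]]]] := mu_spectral.
have T_eq0 h : (forall i, T h i = (fun=> 0) %[ae mu in sigma i]) -> h = 0.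
  move=> Th; apply: (@sqn_eq0 _ _ _ H_norm); rewrite -[sqn h]/(complex.Re (sqn h)%:C%C).
  rewrite -(norm_sqn H_norm); apply: EFin_inj; rewrite -(T_isometry sd).
  rewrite eseries0// => i _ _; rewrite /sqnorm2.
  have [mr mi] := T_measurable sd h i; have mD := sigma_measurable sd i.
  rewrite -[RHS](integral0 mu (sigma i)); apply: ge0_ae_eq_integral => //.
  - under eq_fun do rewrite normc_sqr.
    apply/measurable_EFinP; rewrite /sqmod.
    by apply: measurable_funD; exact: measurable_funX.
  - by move=> chi _; rewrite lee_fin sqr_ge0.
  - apply: filterS (Th i) => chi c Di.
    by rewrite c// ComplexField.Normc.normc0 expr0n.
have T_inj g h : (forall i, T g i = T h i %[ae mu in sigma i]) -> g = h.
  move=> gh; apply/eqP; rewrite -subr_eq0; apply/eqP; apply: T_eq0 => i.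
  have := T_linear sd (-1) h g i; rewrite scaleN1r [- h + g]addrC.
  apply: filterS2 (gh i) => chi h1 h2 Di.
  by rewrite h2// h1// mulN1r addNr.
have p_pi E a h : measurable E -> p E (pi a h) = pi a (p E h).
  move=> mE; apply: T_inj => i.
  have h1 := T_pvm sd mE (pi a h) i; have h2 := T_pi sd a h i.
  have h3 := T_pi sd a (p E h) i; have h4 := T_pvm sd mE h i.
  apply: filterS (filterI h1 (filterI h2 (filterI h3 h4))).
  move=> chi [c1 [c2 [c3 c4]]] Di.
  by rewrite c1// c2// c3// c4// mulrCA.
have p_null E h : measurable E -> mu E = 0%E -> p E h = 0.
  move=> mE E0; apply: T_eq0 => i.
  have h1 := T_pvm sd mE h i.
  have h2 : {ae mu, forall chi, ~ E chi}.
    by exists E; split => // chi /contrapT.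
  apply: filterS2 h1 h2 => chi c1 c2 Di.
  by rewrite c1// indicE memNset// mul0r.
have [nu [nuE nua]] := p_nu f.
exists nu; split => //.
  apply/null_content_dominatesP => E mE E0.
  have muE : mu E = 0%E by move/null_content_dominatesP: mu_abs_cont; apply.
  have := nuE _ mE; rewrite p_null// dot0l => /(congr1 (@complex.Re R)) /= h.
  by rewrite -[LHS]fineK ?fin_num_measure// -h.
move=> E mE; exists (p E f) => P Q.
have [p_idem p_self] := p_proj _ mE.
have [nug [nugE nuga]] := p_nu (p E f).
have nugnu F : measurable F -> nug F = nu (E `&` F).
  move=> mF; have mEF := measurableI _ _ mE mF.
  rewrite -[LHS]fineK ?fin_num_measure// -[RHS]fineK ?fin_num_measure//.
  congr (_%:E); apply: (@complexI R); rewrite -nugE// -nuE// -p_self.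
  by rewrite -pI// setIC pI// p_idem -pI// setIC.
have Rint_nug (u : dA -> R) : bounded_measurable u ->
    \int[nug]_x u x = \int[nu]_x (\1_E x * u x).
  move=> bu; have mEc := measurableC mE.
  have -> : \int[nug]_x u x = \int[nug]_(x in E) u x + \int[nug]_(x in ~` E) u x.
    rewrite -Rintegral_setU// ?setUv//.
      exact: bounded_measurable_integrable.
    by rewrite disj_set2E setICr.
  rewrite [X in _ + X](_ : _ = 0).
    rewrite addr0 /Rintegral (@eq_measure_integral _ _ _ _ nu).
      rewrite -/(Rintegral nu E u) Rintegral_mkcond; apply: eq_Rintegral => x _.
      rewrite patchE indicE; case: (_ \in _); by rewrite ?mul1r ?mul0r.
    move=> B mB BE; apply: etrans (nugnu _ mB) _.
    by congr (nu _); rewrite setIC; exact/setIidPl.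
  rewrite /Rintegral null_set_integral//.
    by apply/measurable_EFinP; apply: measurable_funTS; case: bu.
  by apply: etrans (nugnu _ mEc) _; rewrite setICr measure0.
have cint_nug (u : dA -> C) : bounded_cplx u -> integral_cplx nug u =
    integral_cplx nu (fun chi => (\1_E chi)%:C%C * u chi).
  move=> [ru iu]; apply: complex_eq => /=.
    rewrite Rint_nug//; apply: eq_Rintegral => x _.
    by rewrite cReM/= mul0r subr0.
  rewrite Rint_nug//; apply: eq_Rintegral => x _.
  by rewrite cImM/= mul0r addr0.
have bE : bounded_cplx (fun chi : dA => (\1_E chi : R)%:C%C).
  exact/bounded_cplx_real/bounded_measurable_indic.
have bP := bounded_teval P; have bQ := bounded_teval Q.
(* Since p(E) is a projection commuting with pi, the second f may be replaced by p(E) f; the cross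
   term is thus an integral over [nug] too. *)
have coef a : dot (pi a (p E f)) f = integral_cplx nug (pairing a).
  by rewrite -nuga -(p_self (pi a (p E f))) p_pi// p_idem.
rewrite sqnD (sqn_act _ nuga) (sqn_act _ nua) nrmL2D_cint//; last exact: bounded_cplxM.
rewrite dot_act (dot_act_coef _ coef) cint_nug; last exact: bounded_teval.
congr (_ + _ + 2 * complex.Re _).
  apply: (@complexI R); rewrite !nrmL2_cint cint_nug; last first.
    by apply: bounded_cplxM => //; exact: bounded_cplx_conj.
  congr integral_cplx; apply/funext => chi.
  rewrite !mulC_conj sqmodM sqmod_real rmorphM/= indicE.
  by case: (_ \in _); rewrite ?expr1n ?expr0n.
congr integral_cplx; apply/funext => chi; rewrite teval_mul teval_conj; ring.
Qed.

End Representation.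

(** * Densities and normalized generators of cyclic subspaces *)

Section SpectralDensity.
Context (R : realType) (d : measure_display) (T : measurableType d).
Variables (nu lambda : {finite_measure set T -> \bar R}).
Hypothesis nu_lambda : nu `<< lambda.

Lemma density_exists : exists h : T -> R,
  [/\ measurable_fun setT h, forall x, 0 <= h x &
   forall u : T -> R, bounded_measurable u -> (forall x, 0 <= u x) ->
     bounded_measurable (fun x => u x * h x) ->
     \int[nu]_x u x = \int[lambda]_x (u x * h x)].
Proof.
pose f := Radon_Nikodym_SigmaFinite.f nu lambda.
have f0 x : (0 <= f x)%E by exact: Radon_Nikodym_SigmaFinite.f_ge0.
have ff x : f x \is a fin_num by exact: Radon_Nikodym_SigmaFinite.f_fin_num.
have mf : measurable_fun setT f.
  exact: measurable_int (Radon_Nikodym_SigmaFinite.f_integrable nu_lambda).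
exists (fine \o f); split.
- by apply: measurableT_comp.
- by move=> x /=; rewrite fine_ge0.
- move=> u [mu bu] u0 buf; rewrite /Rintegral; congr fine.
  have u0E x : (0 <= (u x)%:E)%E by rewrite lee_fin.
  have muE : measurable_fun setT (fun x => (u x)%:E) by exact/measurable_EFinP.
  rewrite -(Radon_Nikodym_SigmaFinite.change_of_variables nu_lambda u0E measurableT muE).
  by apply: eq_integral => x _; rewrite EFinM /= fineK.
Qed.

End SpectralDensity.

Section SingleGenerator.
Variables (R : realType) (A : PreTopologicalZmodule.type).
Hypothesis discreteA : forall a : A, open [set a].
Hypothesis countableA : countable [set: A].
Local Notation C := (Cplx R).
Local Notation dA := (borel (dual R A)).
Variables (nu : {finite_measure set dA -> \bar R}) (lambda : probability dA R).
Hypothesis nu_lambda : nu `<< lambda.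

Lemma measurable_teval_eq0 (P : tpoly R A) :
  measurable [set chi : dA | teval P chi = 0].
Proof.
have [[mr _] [mi _]] := bounded_teval P.
rewrite (_ : [set _ | _] = (fun chi => complex.Re (teval P chi)) @^-1` [set 0] `&`
  (fun chi => complex.Im (teval P chi)) @^-1` [set 0]).
  apply: measurableI; rewrite -[X in measurable X]setTI.
    exact: mr.
  exact: mi.
apply/seteqP; split => chi /=; first by move=> ->.
by move=> [r i]; exact: complex_eq.
Qed.

Variable h : dA -> R.
Hypothesis mh : measurable_fun setT h.
Hypothesis h0 : forall x, 0 <= h x.
Hypothesis nu_h : forall u : dA -> R, bounded_measurable u ->
  (forall x, 0 <= u x) -> bounded_measurable (fun x => u x * h x) ->
  \int[nu]_x u x = \int[lambda]_x (u x * h x).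

Let band (m : nat) : set dA := [set x | m.+1%:R^-1 <= h x <= m.+1%:R].

Let measurable_band m : measurable (band m).
Proof.
rewrite (_ : band m = h @^-1` `[m.+1%:R^-1, m.+1%:R]).
  by rewrite -[X in measurable X]setTI; exact: mh.
by apply/seteqP; split => x /=; rewrite in_itv.
Qed.

Let zeros : set dA := [set x | h x = 0].

Let measurable_zeros : measurable zeros.
Proof.
rewrite (_ : zeros = h @^-1` [set 0])//.
by rewrite -[X in measurable X]setTI; exact: mh.
Qed.

(** The bands exhaust the set h <> 0, and its complement is nu-null because nu has density h. *)
Lemma band_exhaust e : 0 < e -> exists m,
  \int[nu]_x (\1_(~` [set x | m.+1%:R^-1 <= h x <= m.+1%:R]) x : R) <= e.
Proof.
move=> e0; have mC m := measurableC (measurable_band m).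
have bz := bounded_measurable_indic R measurable_zeros.
have b1 : forall n x, `|\1_(~` band n) x| <= 1 :> R.
  by move=> n x; rewrite indicE; case: (_ \in _); rewrite ?normr1 ?normr0.
have nz : \int[nu]_x (\1_zeros x : R) = 0.
  have zh x : \1_zeros x * h x = 0.
    rewrite indicE; have [|_] := boolP (x \in zeros); last by rewrite mul0r.
    by rewrite inE /zeros/= => ->; rewrite mulr0.
  rewrite nu_h//.
  - by under eq_Rintegral do rewrite zh; rewrite Rintegral_cst// mul0r.
  - by under eq_fun do rewrite zh; exact: bounded_measurable_cst.
have cv x : (\1_(~` band n) x : R) @[n --> \oo] --> (\1_zeros x : R).
  apply: cvg_near_cst; have [hx|hx] := eqVneq (h x) 0.
    apply: nearW => n; rewrite !indicE mem_set; last first.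
      rewrite /band/= hx => /andP[+ _]; apply/negP.
      by rewrite -ltNge invr_gt0.
    by rewrite mem_set.
  have hp : 0 < h x by rewrite lt_neqAle eq_sym hx h0.
  have [N1 _ N1P] := near_infty_natSinv_lt (PosNum hp).
  have [N2 N2P] : exists N2 : nat, h x <= N2%:R.
    by exists (Num.bound (h x)); rewrite ltW// archi_boundP.
  exists (maxn N1 N2) => // n /=; rewrite geq_max => /andP[n1 n2].
  rewrite !indicE memNset; last first.
    apply: contrapT => /contrapT; apply => /=; apply/andP; split.
      by have := N1P _ n1 => /= /ltW.
    by apply: le_trans N2P _; rewrite ler_nat ltnW.
  by rewrite memNset// => /eqP; rewrite (negPf hx).
have := bounded_cvg_Rint (mu := nu)
  (fun n => bounded_measurable_indic R (mC n)) bz b1 cv.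
rewrite nz => /cvgr0_norm_le/(_ _ e0)[n _ /(_ n (leqnn n)) hn].
by exists n; exact: le_trans (ler_norm _) hn.
Qed.

(* S approximates h ^ (- 1 / 2) on a band 1 / m <= h <= m, where h is the
   density of nu, and Q c approximates P c / S, so that |Q c|^2 d lambda is
   about |P c|^2 d nu. *)
Lemma single_generator (n : nat) (P : nat -> tpoly R A) e : 0 < e ->
  exists (Q : nat -> tpoly R A) (S : tpoly R A), nrmL2 nu (teval S) <= 4 /\
    forall c, (c < n)%N ->
      nrmL2 nu (fun x => teval (P c) x - teval (Q c) x * teval S x) <= e /\
      nrmL2 lambda (teval (Q c)) <= 2 * nrmL2 nu (teval (P c)) + e.
Proof.
move=> e0.
have ubound (V : nat -> tpoly R A) : exists2 K, 0 < K & forall c, (c < n)%N ->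
    forall x, sqmod (teval (V c) x) <= K.
  elim: n => [|m [K K0 KP]]; first by exists 1.
  have [K' K'0 K'P] := bounded_cplx_bound (bounded_teval (V m)).
  exists (K + K'); first exact: addr_gt0.
  move=> c; rewrite ltnS leq_eqVlt => /predU1P[->|cm] x.
    by rewrite (le_trans (K'P x))// lerDr ltW.
  by rewrite (le_trans (KP c cm x))// lerDl ltW.
have [K K0 KP] := ubound P.
have [|m mP] := @band_exhaust (e / (6 * K)); first by rewrite divr_gt0// mulr_gt0.
pose L : R := m.+1%:R; have L1 : 1 <= L by rewrite ler1n.
set E := [set x | _] in mP; have mE : measurable E by exact: (measurable_band m).
have bE := bounded_measurable_indic R mE.
pose s x := Num.sqrt (h x).
(* On the band, multiplication by k maps L^2(nu) isometrically into L^2(lambda) and g undoes it: k^2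
   = 1_E h, g^2 h = 1_E and k g = 1_E. Below, Q c approximates k P c in L^2(lambda) and S
   approximates g in L^2(nu). *)
pose k x : R := \1_E x * s x; pose g x : R := \1_E x * (s x)^-1.
have Ecase x : (\1_E x = 0 :> R) \/ [/\ \1_E x = 1 :> R, 0 < s x, s x ^+ 2 = h x,
    s x <= L & (s x)^-1 <= L].
  rewrite indicE; have [|_] := boolP (x \in E); last by left.
  rewrite inE /E/= -/L => /andP[hl hu]; right.
  have hp : 0 < h x by apply: lt_le_trans hl; rewrite invr_gt0.
  have sp : 0 < s x by rewrite sqrtr_gt0.
  have s2 : s x ^+ 2 = h x by rewrite sqr_sqrtr.
  have Lp : 0 < L by lra.
  split => //.
    by rewrite -(@ler_pXn2r _ 2)// ?nnegrE ?(ltW sp) ?(ltW Lp)// s2; nra.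
  rewrite -(@ler_pXn2r _ 2)// ?nnegrE ?invr_ge0 ?(ltW sp) ?(ltW Lp)//.
  rewrite exprVn s2 -[leRHS]invrK lef_pV2 ?posrE ?invr_gt0 ?exprn_gt0//.
  apply: le_trans hl; rewrite lef_pV2 ?posrE ?exprn_gt0//; nra.
have ms p : measurable_fun setT (fun x => h x `^ p).
  exact: (@measurableT_comp _ _ _ _ _ _ (@powR R ^~ p)).
have bk : bounded_measurable k.
  split.
    apply: measurable_funM; first by case: bE.
    rewrite (_ : s = fun x => h x `^ 2^-1); first exact: ms.
    by apply/funext => x; rewrite powR12_sqrt.
  exists L => x; rewrite /k; have [->|[-> sp _ sL _]] := Ecase x.
    by rewrite mul0r normr0; lra.
  by rewrite mul1r gtr0_norm.
have bg : bounded_measurable g.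
  split.
    apply: measurable_funM; first by case: bE.
    rewrite (_ : (fun x => (s x)^-1) = fun x => h x `^ (- 2^-1)); first exact: ms.
    by apply/funext => x; rewrite powRN powR12_sqrt.
  exists L => x; rewrite /g; have [->|[-> sp _ _ sL]] := Ecase x.
    by rewrite mul0r normr0; lra.
  by rewrite mul1r gtr0_norm// invr_gt0.
have kg x : k x * g x = \1_E x.
  rewrite /k /g; have [->|[-> sp _ _ _]] := Ecase x; first by rewrite !mul0r.
  by rewrite !mul1r divff// gt_eqF.
have gh x : g x ^+ 2 * h x = \1_E x.
  rewrite /g; have [->|[-> sp <- _ _]] := Ecase x.
    by rewrite mul0r expr0n mul0r.
  by rewrite mul1r -exprMn mulVf ?expr1n// gt_eqF.
have kh x : k x ^+ 2 = \1_E x * h x.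
  rewrite /k; have [->|[-> sp <- _ _]] := Ecase x; by rewrite ?mul0r ?mul1r ?expr0n.
have E01 x : 0 <= (\1_E x : R) <= 1.
  by rewrite indicE; case: (_ \in _); rewrite ?lexx ?ler01.
have bkC := bounded_cplx_real bk; have bgC := bounded_cplx_real bg.
have bEC := bounded_cplx_real bE.
have bP c := bounded_teval (P c).
pose e1 := e / 24.
have e1p : 0 < e1 by rewrite /e1; lra.
have exQ c : exists Q, nrmL2 lambda (fun x => (k x)%:C%C * teval (P c) x - teval Q x) <= e1.
  exact: (tpoly_dense discreteA countableA lambda (bounded_cplxM bkC (bP c)) e1p).
have [Q QP] := choice exQ; have bQ c := bounded_teval (Q c).
have [KQ KQ0 KQP] := ubound Q.
(* S comes after the Q c: the error g - S is multiplied by Q c, bounded by KQ. *)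
pose e2 := Num.min 1 (e1 / KQ).
have e2p : 0 < e2 by rewrite lt_min ltr01 divr_gt0.
have [S SP] := tpoly_dense discreteA countableA nu bgC e2p.
have bS := bounded_teval S.
have e2K : e2 * KQ <= e1 by rewrite -ler_pdivlMr// ge_min lexx orbT.
have e21 : e2 <= 1 by rewrite ge_min lexx.
exists Q, S; split.
  (* The bound 4 is 2 + 2: the squared norm of g in L^2(nu) is lambda(E) <= 1, and that of g - S is
     at most e2 <= 1. *)
  have h1 := nrmL2D nu (bounded_cplxN (bounded_cplxB bgC bS)) bgC.
  rewrite (_ : (fun x => _) = teval S) in h1; last first.
    by apply/funext => x; rewrite opprB subrK.
  rewrite nrmL2N in h1.
  have h2 : nrmL2 nu (fun x => (g x)%:C%C) <= 1.
    rewrite /nrmL2; under eq_Rintegral do rewrite sqmod_real.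
    rewrite nu_h.
    - under eq_Rintegral do rewrite gh.
      rewrite Rint_indic// -lee_fin fineK ?fin_num_measure//.
      exact: probability_le1.
    - exact: bounded_measurableM.
    - by move=> x; rewrite sqr_ge0.
    - by under eq_fun do rewrite gh.
  lra.
move=> c cn; split.
- pose u1 x : C := (\1_E x)%:C%C * teval (P c) x.
  pose u2 x : C := teval (Q c) x * (g x)%:C%C.
  have bu1 : bounded_cplx u1 by exact: bounded_cplxM.
  have bu2 : bounded_cplx u2 by exact: bounded_cplxM.
  have bu3 := bounded_cplxM (bQ c) bS.
  have t1 := nrmL2_triangle nu (bP c) bu1 bu3.
  have t2 := nrmL2_triangle nu bu1 bu2 bu3.
  have a1 : nrmL2 nu (fun x => teval (P c) x - u1 x) <= e / 6.
    apply: (@le_trans _ _ (\int[nu]_x (K * (\1_(~` E) x : R)))).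
      apply: le_Rint => [||x].
      - exact/bounded_cplx_sqmod/bounded_cplxB.
      - apply: bounded_measurableM; first exact: bounded_measurable_cst.
        by apply: bounded_measurable_indic; exact: measurableC.
      rewrite /u1 !indicE in_setC; case: (x \in E) => /=.
        by rewrite mul1r subrr sqmod0 mulr0.
      by rewrite mul0r subr0 mulr1; exact: KP.
    rewrite RintZ; last by apply: bounded_measurable_indic; exact: measurableC.
    have : K * \int[nu]_x (\1_(~` E) x : R) <= K * (e / (6 * K)) by rewrite ler_wpM2l// ltW.
    by have -> : K * (e / (6 * K)) = e / 6 by field; lra.
  have a2 : nrmL2 nu (fun x => u1 x - u2 x) <= e1.
    have bv := bounded_cplxB (bounded_cplxM bkC (bP c)) (bQ c).
    have uE x : sqmod (u1 x - u2 x) =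
        g x ^+ 2 * sqmod ((k x)%:C%C * teval (P c) x - teval (Q c) x).
      rewrite -sqmod_real -sqmodM; congr sqmod.
      by rewrite /u1 /u2 -kg rmorphM/=; ring.
    have uhE x : sqmod (u1 x - u2 x) * h x =
        \1_E x * sqmod ((k x)%:C%C * teval (P c) x - teval (Q c) x).
      by rewrite uE mulrAC gh.
    have buh : bounded_measurable (fun x => sqmod (u1 x - u2 x) * h x).
      under eq_fun do rewrite uhE.
      by apply: bounded_measurableM => //; exact: bounded_cplx_sqmod.
    apply: le_trans (QP c); rewrite /nrmL2 nu_h//.
    - apply: le_Rint => // [|x]; first exact: bounded_cplx_sqmod.
      by rewrite uhE ler_piMl ?sqmod_ge0//; case/andP: (E01 x).
    - exact/bounded_cplx_sqmod/bounded_cplxB.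
    - by move=> x; exact: sqmod_ge0.
  have a3 : nrmL2 nu (fun x => u2 x - teval (Q c) x * teval S x) <= e1.
    rewrite (_ : (fun x => _) = (fun x => teval (Q c) x * ((g x)%:C%C - teval S x))).
      have := nrmL2M_le nu (bQ c) (bounded_cplxB bgC bS) (KQP c cn).
      move=> /le_trans; apply; apply: le_trans e2K.
      by rewrite mulrC ler_wpM2r// ltW.
    by apply/funext => x; rewrite mulrBr.
  rewrite /e1 in a2 a3; lra.
- have bkP := bounded_cplxM bkC (bP c).
  have h1 := nrmL2D lambda (bounded_cplxN (bounded_cplxB bkP (bQ c))) bkP.
  rewrite (_ : (fun x => _) = teval (Q c)) in h1; last first.
    by apply/funext => x; rewrite opprB subrK.
  rewrite nrmL2N in h1; have h2 := QP c.
  have h3 : nrmL2 lambda (fun x => (k x)%:C%C * teval (P c) x) <= nrmL2 nu (teval (P c)).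
    have bsP := bounded_cplx_sqmod (bP c).
    apply: (@le_trans _ _ (\int[nu]_x (\1_E x * sqmod (teval (P c) x)))).
      rewrite nu_h.
      - rewrite le_eqVlt; apply/orP; left; apply/eqP; apply: eq_Rintegral => x _.
        by rewrite sqmodM sqmod_real kh mulrAC.
      - exact: bounded_measurableM.
      - by move=> x; rewrite mulr_ge0 ?sqmod_ge0//; case/andP: (E01 x).
      - under eq_fun do rewrite mulrAC -kh.
        by apply: bounded_measurableM => //; exact: bounded_measurableM.
    apply: le_Rint => [||x]; [exact: bounded_measurableM|by []|].
    by rewrite ler_piMl ?sqmod_ge0//; case/andP: (E01 x).
  rewrite /e1 in h2; lra.
Qed.

End SingleGenerator.

(** * Finitely generated invariant subspaces *)

Section Synthesis.
Variables (R : realType) (H : completeNormedModType (Cplx R)).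
Local Notation C := (Cplx R).
Variable dot : {dot H for (@conjC C)}.
Hypothesis H_norm : hilbert_norm dot.
Variable A : PreTopologicalZmodule.type.
Hypothesis discreteA : forall a : A, open [set a].
Hypothesis countableA : countable [set: A].
Variable pi : A -> unitary_op dot.
Hypothesis pi_rep : unitary_rep pi.
Local Notation dA := (borel (dual R A)).
Local Notation sqn := (sqn dot).
Local Notation act := (act pi).
Variable lambda : probability dA R.
Hypothesis pi_spectral : forall f, exists nu, spectral pi lambda f nu.
Implicit Types (P Q S : tpoly R A) (f x y : H) (M : set H) (l : seq H).

(** The measure nu of f is carried by the zeros of Q, a lambda-null and hence nu-null set. So nu =
    0, and its total mass is |f|^2. *)
Lemma act_inj Q f : lambda [set chi | teval Q chi = 0] = 0%E ->
  act Q f = 0 -> f = 0.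
Proof.
move=> Q0 Qf; have [nu [fnu nu_lambda _]] := pi_spectral f.
have nQ : nrmL2 nu (teval Q) = 0 by rewrite -(sqn_act pi_rep _ fnu) Qf sqn0.
have h1 := Rint_eq0_ae (bounded_cplx_sqmod (bounded_teval Q))
  (fun chi => sqmod_ge0 _) nQ.
have mZ := measurable_teval_eq0 Q.
have h2 : nu [set chi | teval Q chi = 0] = 0%E.
  by move/null_content_dominatesP: nu_lambda; apply.
have nuT : nu setT = 0%E.
  apply/eqP; rewrite eq_le measure_ge0 andbT.
  have -> : [set: dA] = [set chi | teval Q chi = 0] `|`
      [set chi | sqmod (teval Q chi) != 0].
    apply/seteqP; split => // chi _; rewrite /= sqmod_eq0.
    by have [|] := eqVneq (teval Q chi) 0; [left|right].
  have mB : measurable [set chi : dA | sqmod (teval Q chi) != 0].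
    rewrite (_ : [set _ | _] = ~` [set chi | teval Q chi = 0]).
      exact: measurableC.
    by apply/seteqP; split => chi /=; rewrite sqmod_eq0 => /eqP.
  have h12 : (nu [set chi | teval Q chi = 0%R] +
      nu [set chi | sqmod (teval Q chi) != 0%R] <= 0)%E.
    by rewrite h1 h2 adde0.
  exact: le_trans (measureU2 nu mZ mB) h12.
apply: (sqn_eq0 H_norm); have -> : f = act [:: (1, 0)] f.
  by rewrite act_single scale1r pi0.
rewrite (sqn_act pi_rep _ fnu) /nrmL2.
under eq_Rintegral do rewrite teval1 mul1r pairing0 sqmod1.
by rewrite Rintegral_cst// [X in fine X]nuT mulr0.
Qed.

(** If m is the projection of y to M, then Q(pi)(y - m) lies both in M and in its orthogonal
    complement, so [act_inj] gives y = m. *)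
Lemma pi_subspace_absorb M Q y : pi_subspace pi M ->
  lambda [set chi | teval Q chi = 0] = 0%E -> M (act Q y) -> M y.
Proof.
move=> hM Q0 MQy; have [cM _] := hM.
have [m Mm ym] := orthogonal_projection H_norm y cM.
suff ym0 : y - m = 0 by rewrite -(subrK m y) ym0 add0r.
apply: (act_inj Q0); apply: (sqn_eq0 H_norm); rewrite /sqn.
rewrite (act_orth pi_rep _ hM ym)// actB.
by apply: (closed_subspaceB cM) => //; exact: (pi_subspace_act _ hM Mm).
Qed.

Definition pi_span l : set H := [set x | forall M, pi_subspace pi M ->
  (forall y, y \in l -> M y) -> M x].

Lemma pi_span_subspace l : pi_subspace pi (pi_span l).
Proof.
split; first split.
- by move=> M [[]].
- by move=> x y hx hy M hM lM; case: (hM) => -[_ MD _ _] _; apply: MD; [exact: hx|exact: hy].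
- by move=> c x hx M hM lM; case: (hM) => -[_ _ MZ _] _; apply: MZ; exact: hx.
- move=> x hx M hM lM; case: (hM) => -[_ _ _ Mcl] _; apply: Mcl => e e0.
  by have [y hy xy] := hx e e0; exists y => //; exact: hy.
- move=> a _ [x hx <-] M hM lM; case: (hM) => _ Mpi; apply: Mpi.
  by exists x => //; exact: hx.
Qed.

Lemma mem_pi_span l y : y \in l -> pi_span l y.
Proof. by move=> yl M _; exact. Qed.

(** The vectors with such approximations form a pi-invariant closed subspace containing f and l, and
    [pi_span] is the smallest one. *)
Lemma pi_span_cons f l x e : pi_span (f :: l) x -> 0 < e ->
  exists P m, pi_span l m /\ sqn (x - (act P f + m)) < e.
Proof.
move=> hx e0; pose N := [set x | forall e, 0 < e ->
  exists P m, pi_span l m /\ sqn (x - (act P f + m)) < e].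
have [[l0 lD lZ _] lpi] := pi_span_subspace l.
suff /hx h : pi_subspace pi N.
  have /h : forall y, y \in f :: l -> N y.
    move=> y; rewrite inE => /predU1P[->|yl] d d0.
      exists [:: (1, 0)], 0; split=> //.
      by rewrite act_single scale1r pi0// addr0 subrr sqn0.
    exists [::], y; split; first exact: mem_pi_span.
    by rewrite /act big_nil add0r subrr sqn0.
  by apply.
split; first split.
- move=> d d0; exists [::], 0; split => //.
  by rewrite /act big_nil addr0 subrr sqn0.
- move=> y z hy hz d d0; have d4 : 0 < d / 4 by lra.
  have [P [m [lm Pm]]] := hy _ d4; have [P' [m' [lm' Pm']]] := hz _ d4.
  exists (P ++ P'), (m + m'); split; first exact: lD.
  rewrite act_cat [act P f + _ + _]addrACA opprD addrACA.
  apply: le_lt_trans (sqnD_le H_norm _ _) _; lra.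
- move=> c y hy d d0; pose K := sqmod c + 1.
  have K0 : 0 < K by rewrite ltr_wpDl ?sqmod_ge0.
  have [P [m [lm Pm]]] := hy (d / K) (divr_gt0 d0 K0).
  exists (tmul [:: (c, 0)] P), (c *: m); split; first exact: lZ.
  rewrite act_mul// act_single pi0// -scalerDr -scalerBr sqnZ.
  rewrite ltr_pdivlMr// in Pm; apply: le_lt_trans Pm.
  by rewrite mulrC ler_wpM2l ?sqn_ge0// /K lerDl.
- move=> y hy d d0; have d4 : 0 < d / 4 by lra.
  have [z hz yz] := hy _ d4; have [P [m [lm Pm]]] := hz _ d4.
  exists P, m; split => //.
  apply: le_lt_trans (sqn_triangle H_norm _ z _) _; lra.
- move=> a _ [y hy <-] d d0; have [P [m [lm Pm]]] := hy _ d0.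
  exists (tmul [:: (1, a)] P), (pi a m); split; first by apply: lpi; exists m.
  by rewrite act_mul// act_single scale1r -raddfD -raddfB sqn_pi.
Qed.

(* The dual form of the lower frame bound of the system {pi a eta}: every
   vector of M is approximable by combinations whose coefficients have
   controlled l^2 norm, with sum |eta|^2 <= K. *)
Definition synthesizable M (K : R) := forall n (xs : nat -> H) e, 0 < e ->
  (forall c, (c < n)%N -> M (xs c)) ->
  exists E : seq (H * (nat -> tpoly R A)), \sum_(w <- E) sqn w.1 <= K /\
    forall c, (c < n)%N ->
      sqn (xs c - \sum_(w <- E) act (w.2 c) w.1) <= e /\
      \sum_(w <- E) nrmL2 lambda (teval (w.2 c)) <= 4 * sqn (xs c) + e.

(** Take eta = S(pi) f from [single_generator] and transport its estimates by [sqn_act]. In the last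
    bound, 4 is 2 from that lemma times 2 from replacing xs c by P(pi) f. *)
Lemma synthesizable_cyclic f n (xs : nat -> H) e : 0 < e ->
  (forall c, (c < n)%N -> forall d, 0 < d -> exists P, sqn (xs c - act P f) < d) ->
  exists eta (Q : nat -> tpoly R A), sqn eta <= 4 /\
    forall c, (c < n)%N -> sqn (xs c - act (Q c) eta) <= e /\
      nrmL2 lambda (teval (Q c)) <= 4 * sqn (xs c) + e.
Proof.
move=> e0 hxs; have e8 : 0 < e / 8 by lra.
have exP c : exists P, (c < n)%N -> sqn (xs c - act P f) < e / 8.
  have [cn|] := boolP (c < n)%N; last by exists [::].
  by have [P hP] := hxs c cn _ e8; exists P.
have [P PP] := choice exP.
have [nu [fnu nu_lambda _]] := pi_spectral f.
have [h [mh h0 nu_h]] := density_exists nu_lambda.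
have [Q [S [S4 QP]]] := single_generator discreteA countableA mh h0 nu_h n P e8.
exists (act S f), Q; split; first by rewrite (sqn_act pi_rep _ fnu).
move=> c cn; have [q1 q2] := QP c cn; have p1 := PP c cn.
have p2 : nrmL2 nu (teval (P c)) <= 2 * sqn (xs c) + 2 * (e / 8).
  rewrite -(sqn_act pi_rep _ fnu).
  have -> : act (P c) f = xs c + - (xs c - act (P c) f) by rewrite opprB addrC subrK.
  by apply: le_trans (sqnD_le H_norm _ _) _; rewrite sqnN; lra.
split; last by lra.
apply: le_trans (sqn_triangle H_norm _ (act (P c) f) _) _.
suff : sqn (act (P c) f - act (Q c) (act S f)) <= e / 8 by lra.
apply: le_trans q1.
have -> : act (P c) f - act (Q c) (act S f) =
    act (P c ++ tmul [:: (-1, 0)] (tmul (Q c) S)) f.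
  by rewrite act_cat act_mul// act_single pi0// scaleN1r act_mul.
rewrite (sqn_act pi_rep _ fnu) le_eqVlt; apply/orP; left; apply/eqP.
congr nrmL2; apply/funext => chi.
by rewrite teval_cat !teval_mul teval1 pairing0 mulr1 mulN1r.
Qed.

(* Gram-Schmidt: each new generator is replaced by its component orthogonal to
   the span of the previous ones, which reduces to the cyclic case. *)
Lemma pi_span_synthesizable l : exists K, synthesizable (pi_span l) K.
Proof.
elim: l => [|f l [K IH]].
  exists 0 => n xs e e0 hxs; exists [::]; split; first by rewrite big_nil.
  move=> c cn; have -> : xs c = 0.
    apply: (hxs c cn [set 0]) => //; split; first split => //.
    - by move=> x y -> ->; rewrite /= addr0.
    - by move=> z x ->; rewrite /= scaler0.
    - move=> x hx; apply: (sqn_eq0 H_norm); apply/eqP.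
      rewrite eq_le sqn_ge0// andbT; apply/ler_addgt0Pr => d d0; rewrite add0r.
      by have [y -> /ltW] := hx _ d0; rewrite subr0.
    - by move=> a _ [x -> <-]; rewrite /= raddf0.
  by rewrite !big_nil subr0 sqn0 mulr0 add0r ltW.
exists (K + 4) => n xs e e0 hxs.
have hM := pi_span_subspace l; have [cM _] := hM; have [_ MD _ _] := cM.
have proj x := orthogonal_projection H_norm x cM.
have exm c : exists m, pi_span l m /\ forall y, pi_span l y -> dot (xs c - m) y = 0.
  by have [m lm hm] := proj (xs c); exists m.
have [m mP] := choice exm.
have [m0 lm0 fm0] := proj f; pose g := f - m0.
pose ys c := xs c - m c.
have hys c : (c < n)%N -> forall d, 0 < d -> exists P, sqn (ys c - act P g) < d.
  move=> cn d d0; have [P [m1 [lm1 hP]]] := pi_span_cons (hxs c cn) d0.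
  have [lmc hmc] := mP c.
  exists P; apply: le_lt_trans hP.
  (* The error of the given approximation is ys c - P(pi) g, orthogonal to the span of l, plus this
     vector of the span; dropping the latter only decreases the norm. *)
  have lz : pi_span l (m c - (act P m0 + m1)).
    by apply: (closed_subspaceB cM) => //; apply: MD => //; exact: (pi_subspace_act _ hM lm0).
  have -> : xs c - (act P f + m1) = (ys c - act P g) + (m c - (act P m0 + m1)).
    rewrite /g /ys actB.
    move: (act P f) (act P m0) (xs c) (m c) => a b u v.
    rewrite opprB [u - v + _]addrC -[RHS]addrA [u - v + _]addrA subrK.
    by rewrite [RHS]addrCA !opprD [b - a + _]addrACA subrr add0r.
  rewrite [leRHS]sqnD dotBl (hmc _ lz : dot (ys c) _ = 0).
  rewrite (act_orth pi_rep P hM fm0 lz : dot (act P g) _ = 0) subrr mulr0 addr0.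
  by rewrite lerDl sqn_ge0.
have e4 : 0 < e / 4 by lra.
have [eta [Q [eta4 QP]]] := synthesizable_cyclic e4 hys.
have [E [EK EP]] := IH n m _ e4 (fun c _ => proj1 (mP c)).
exists ((eta, Q) :: E); split; first by rewrite big_cons/=; lra.
move=> c cn; rewrite !big_cons/=.
have [q1 q2] := QP c cn; have [p1 p2] := EP c cn; have [lmc hmc] := mP c.
(* By Pythagoras the coefficient bounds of the two parts add up to 4 |xs c|^2, so the factor 4 does
   not grow with the number of generators; only K does. *)
have pyth : sqn (xs c) = sqn (ys c) + sqn (m c).
  rewrite -[xs c in LHS](subrK (m c)) -/(ys c).
  by rewrite sqnD (hmc _ lmc : dot (ys c) _ = 0) mulr0 addr0.
split; last lra.
have -> : xs c - (act (Q c) eta + \sum_(w <- E) act (w.2 c) w.1) =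
    (ys c - act (Q c) eta) + (m c - \sum_(w <- E) act (w.2 c) w.1).
  by rewrite opprD [RHS]addrACA subrK.
by apply: le_trans (sqnD_le H_norm _ _) _; lra.
Qed.

End Synthesis.

(** * Dilations *)

Section Counting.
Variables (R : realType) (H : completeNormedModType (Cplx R)).
Local Notation C := (Cplx R).
Variable dot : {dot H for (@conjC C)}.
Hypothesis H_norm : hilbert_norm dot.
Variable A : PreTopologicalZmodule.type.
Hypothesis discreteA : forall a : A, open [set a].
Hypothesis countableA : countable [set: A].
Variable pi : A -> unitary_op dot.
Hypothesis pi_rep : unitary_rep pi.
Local Notation dA := (borel (dual R A)).
Local Notation sqn := (sqn dot).
Local Notation act := (act pi).
Variable lambda : probability dA R.
Hypothesis lambda_invariant : forall (x : dual R A) (E : set dA),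
  measurable E -> lambda ((fun y : dual R A => x + y) @` E) = lambda E.
Hypothesis pi_spectral : forall f, exists nu, spectral pi lambda f nu.
Variable alpha : {additive A -> A}.
Hypothesis alpha_inj : injective alpha.
Variable delta : unitary_op dot.
Hypothesis delta_pi : forall a x, uinv delta (pi a (delta x)) = pi (alpha a) x.
Implicit Types (P Q S : tpoly R A) (f x y : H) (M : set H) (a b : A).
Local Notation delta' := (uinv delta).

Lemma uinvD x y : delta' (x + y) = delta' x + delta' y.
Proof. by apply: (can_inj (uvalK delta)); rewrite raddfD/= !uinvK. Qed.

Lemma uinvZ (c : C) x : delta' (c *: x) = c *: delta' x.
Proof. by apply: (can_inj (uvalK delta)); rewrite linearZ/= !uinvK. Qed.

Lemma uinv0 : delta' 0 = 0.
Proof. by apply: (can_inj (uvalK delta)); rewrite uinvK raddf0. Qed.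

Lemma uinvB x y : delta' (x - y) = delta' x - delta' y.
Proof. by apply: (can_inj (uvalK delta)); rewrite raddfB/= !uinvK. Qed.

Lemma sqn_uinv x : sqn (delta' x) = sqn x.
Proof. by rewrite /sqn -(uval_dot delta) uinvK. Qed.

Lemma sqn_uval x : sqn (delta x) = sqn x.
Proof. by rewrite /sqn uval_dot. Qed.

Lemma uinv_sum (I : Type) (s : seq I) (u : I -> H) :
  delta' (\sum_(i <- s) u i) = \sum_(i <- s) delta' (u i).
Proof.
elim: s => [|i s IH]; first by rewrite !big_nil uinv0.
by rewrite !big_cons uinvD IH.
Qed.

Lemma uinv_pi a x : delta' (pi a x) = pi (alpha a) (delta' x).
Proof. by rewrite -[x in LHS](uinvK delta) delta_pi. Qed.

Lemma uinv_act Q x : delta' (act Q x) = act (tmap alpha Q) (delta' x).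
Proof.
rewrite /act uinv_sum big_map; apply: eq_bigr => t _ /=.
by rewrite uinvZ uinv_pi.
Qed.

Lemma iter_uinv_pi n a x :
  iter n delta' (pi a x) = pi (iter n alpha a) (iter n delta' x).
Proof. by elim: n => [//|n IH]; rewrite !iterS IH uinv_pi. Qed.

Lemma iter_uinv_act n Q x :
  iter n delta' (act Q x) = act (iter n (tmap alpha) Q) (iter n delta' x).
Proof. by elim: n => [//|n IH]; rewrite !iterS IH uinv_act. Qed.

Lemma iter_uinv_sum n (I : Type) (s : seq I) (u : I -> H) :
  iter n delta' (\sum_(i <- s) u i) = \sum_(i <- s) iter n delta' (u i).
Proof. by elim: n => [//|n IH]; rewrite iterS IH uinv_sum. Qed.

Lemma iter_uinvB n x y : iter n delta' (x - y) = iter n delta' x - iter n delta' y.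
Proof. by elim: n => [//|n IH]; rewrite !iterS IH uinvB. Qed.

Lemma sqn_iter_uinv n x : sqn (iter n delta' x) = sqn x.
Proof. by elim: n => [//|n IH]; rewrite iterS sqn_uinv. Qed.

Lemma sqn_iter_uval n x : sqn (iter n delta x) = sqn x.
Proof. by elim: n => [//|n IH]; rewrite iterS sqn_uval. Qed.

Lemma iter_uinvK n x : iter n delta' (iter n delta x) = x.
Proof. by elim: n x => [//|n IH] x; rewrite iterSr /= uvalK IH. Qed.

Lemma nrmL2_iter_tmap n Q :
  nrmL2 lambda (teval (iter n (tmap alpha) Q)) = nrmL2 lambda (teval Q).
Proof. by elim: n => [//|n IH]; rewrite iterS nrmL2_tmap. Qed.

Lemma mem_iter_tmap n Q t : t \in iter n (tmap alpha) Q ->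
  exists a, t.2 = iter n alpha a.
Proof.
elim: n t => [|n IH] t; first by exists t.2.
by move=> /mapP[u /IH[a ua] ->] /=; exists a; rewrite ua.
Qed.

Let iter_alphaB n a b : iter n alpha (a - b) = iter n alpha a - iter n alpha b.
Proof. by elim: n => [//|n IH]; rewrite !iterS IH raddfB. Qed.

Let iter_alphaD n a b : iter n alpha (a + b) = iter n alpha a + iter n alpha b.
Proof. by elim: n => [//|n IH]; rewrite !iterS IH raddfD. Qed.

Lemma iter_alpha_inj n : injective (iter n alpha).
Proof. by elim: n => [//|n IH] x y /alpha_inj/IH. Qed.

(** Cancelling alpha^k would otherwise put b into the image of alpha. *)
Lemma cosets_distinct b (m k n : nat) a : (forall a, alpha a <> b) ->
  (k < m)%N -> (m < n)%N -> iter k alpha b <> iter m alpha b + iter n alpha a.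
Proof.
move=> nb km mn; rewrite -(subnKC (ltnW km)) -(subnKC (ltnW (ltn_trans km mn))).
rewrite !iterD -iter_alphaD => /iter_alpha_inj.
have [p ->] : exists p, (m - k)%N = p.+1 by exists (m - k).-1; rewrite prednK ?subn_gt0.
have [q ->] : exists q, (n - k)%N = q.+1.
  by exists (n - k).-1; rewrite prednK ?subn_gt0// (ltn_trans km).
by rewrite !iterS -raddfD => /esym; exact: nb.
Qed.

(** Cauchy-Schwarz with a free weight. A weight independent of n will do, so the gain of order sqrt
    n appears as a linear estimate. *)
Let Re_dot_le x y (t : R) : 0 < t ->
  complex.Re (dot x y) <= t * sqn x + (4 * t)^-1 * sqn y.
Proof.
move=> t0; have := sqn_ge0 H_norm ((2 * t)%:C%C *: x - y).
rewrite sqnB sqnZ sqmod_real dotZl cReM/= mul0r subr0 => h.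
have {}h : 4 * t * complex.Re (dot x y) <= 4 * t * (t * sqn x) + sqn y by lra.
rewrite -(@ler_pM2l _ (4 * t)) ?mulr_gt0// mulrDr.
rewrite (mulrA _ (4 * t)^-1) divff ?mul1r//.
by rewrite mulf_neq0// gt_eqF.
Qed.

(** The adjoint coefficients belonging to one generator, collected over all c < m into one
    polynomial, so that the bound on x is used once per generator. Different c contribute
    frequencies in different cosets of alpha^n(A). *)
Let gather n b (V : nat -> tpoly R A) : nat -> tpoly R A :=
  fix g m := if m is m'.+1 then
    g m' ++ tmul (tconj (iter n (tmap alpha) (V m'))) [:: (1, iter m' alpha b)]
  else [::].

Let act_gather n b V x m : act (gather n b V m) x = \sum_(0 <= c < m)
  act (tconj (iter n (tmap alpha) (V c))) (pi (iter c alpha b) x).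
Proof.
elim: m => [|m IH]; first by rewrite big_geq// /act big_nil.
by rewrite big_nat_recr//= act_cat IH act_mul// act_single scale1r.
Qed.

Let mem_gather n b V m t : t \in gather n b V m -> exists c a,
  (c < m)%N /\ t.2 = iter c alpha b - iter n alpha a.
Proof.
elim: m => [//|m IH] /=; rewrite mem_cat => /orP[/IH[c [a [cm ->]]]|].
  by exists c, a; split => //; exact: ltnW.
move=> /allpairsP[[u v] /= [/mapP[w wQ ->]]]; rewrite inE => /eqP -> ->.
have [a wa] := mem_iter_tmap wQ.
by exists m, a; split => //=; rewrite wa addrC.
Qed.

Let nrmL2_gather n b V m : (forall a, alpha a <> b) -> (m <= n)%N ->
  nrmL2 lambda (teval (gather n b V m)) =
  \sum_(0 <= c < m) nrmL2 lambda (teval (V c)).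
Proof.
move=> nb; elim: m => [|m IH] mn.
  rewrite big_geq// /nrmL2; under eq_Rintegral do rewrite /teval big_nil sqmod0.
  by rewrite Rintegral_cst// mul0r.
rewrite big_nat_recr//= -IH ?(ltnW mn)// nrmL2_cat//.
  congr (_ + _); rewrite -[RHS](nrmL2_iter_tmap n) /nrmL2; apply: eq_Rintegral => chi _.
  rewrite teval_mul teval_conj teval1 sqmodM sqmod_conj mul1r sqmod_pairing.
  by rewrite mulr1.
move=> t u /mem_gather[c [a [cm ->]]].
move=> /allpairsP[[u' v] /= [/mapP[w wQ ->]]]; rewrite inE => /eqP -> -> /=.
have [a' ->] := mem_iter_tmap wQ; apply/eqP => h.
apply: (@cosets_distinct b m c n (a - a')) => //.
rewrite iter_alphaB -[LHS](subrK (iter n alpha a)) h.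
by rewrite [- _ + _]addrC -addrA [- _ + _]addrC.
Qed.

Lemma bounded_vector_eq0 M K b x B : (forall a, alpha a <> b) ->
  pi_subspace pi M -> (forall y, M y -> M (delta y)) ->
  synthesizable pi lambda M K -> M x -> 0 < B ->
  (forall P, sqn (act P x) <= B * nrmL2 lambda (teval P)) -> x = 0.
Proof.
move=> nb [_ Mpi] Mdelta hK Mx B0 xB; apply: contrapT => x0.
set X := sqn x; have X0 : 0 < X.
  rewrite lt_neqAle sqn_ge0// andbT eq_sym; apply/eqP => /(sqn_eq0 H_norm).
  exact: x0.
have Miter n y : M y -> M (iter n delta y).
  by move=> My; elim: n => [//|n IH]; rewrite iterS; exact: Mdelta.
(* The right side is independent of n, which contradicts X > 0 for large n. *)
suff bound n : n%:R * X <= 20 * B * K.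
  have := bound (Num.bound (20 * B * K / X)).
  rewrite -ler_pdivlMr// leNgt => /negP; apply.
  (* The instance without vectors already exhibits a sum of squares below K. *)
  have K0 : 0 <= K.
    have X1 : 0 < (1 : R) by [].
    have [E [EK _]] := hK 0%N (fun=> 0) 1 X1 (fun c cn => False_ind _ (notF cn)).
    by apply: le_trans EK; apply: sumr_ge0 => w _; exact: sqn_ge0.
  by apply: archi_boundP; rewrite divr_ge0 ?mulr_ge0// ltW.
pose xs c := iter n delta (pi (iter c alpha b) x).
have Mxs c : (c < n)%N -> M (xs c).
  by move=> _; apply: Miter; apply: Mpi; exists x.
have sxs c : sqn (xs c) = X by rewrite /xs sqn_iter_uval sqn_pi.
have X4 : 0 < X / 4 by lra.
have [E [EK EP]] := hK n xs _ X4 Mxs.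
pose eta (w : H * (nat -> tpoly R A)) := iter n delta' w.1.
pose P w := gather n b w.2 n.
pose Re_ (w : H * (nat -> tpoly R A)) c := complex.Re (dot (act
  (tconj (iter n (tmap alpha) (w.2 c))) (pi (iter c alpha b) x)) (eta w)).
have low c : (c < n)%N -> X / 2 <= \sum_(w <- E) Re_ w c.
  move=> cn; have [/= r _] := EP c cn.
  set y := \sum_(w <- E) _ in r; set v := pi (iter c alpha b) x.
  have vE : iter n delta' (xs c) = v by exact: iter_uinvK.
  have r' : sqn (v - iter n delta' y) <= X / 4.
    by rewrite -vE -iter_uinvB sqn_iter_uinv.
  have -> : \sum_(w <- E) Re_ w c = complex.Re (dot v (iter n delta' y)).
    rewrite iter_uinv_sum dot_sumr Re_sum; apply: eq_bigr => w _.
    rewrite /Re_ iter_uinv_act act_adjoint//; congr (complex.Re (dot _ (act _ _))).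
    by rewrite /tconj -map_comp map_id_in// => -[z a] _ /=; rewrite conjCK opprK.
  (* The approximant is within squared distance X / 4 of v, and |v|^2 = X; with weight 1/4 the loss
     Re <v, v - y'> is at most X / 4 + X / 4, leaving X / 2. *)
  have q4 : 0 < (1 / 4 : R) by lra.
  have := Re_dot_le v (v - iter n delta' y) q4.
  have -> : (4 * (1 / 4))^-1 = 1 :> R by field.
  have vX : sqn v = X by rewrite sqn_pi.
  rewrite dotBr cReD cReN -[complex.Re (dot v v)]/(sqn v) vX mul1r; lra.
(* The coefficients total at most 5 n X, so this weight makes their share n X / 4, half of the lower
   bound n X / 2. What remains is n X / 4 <= 5 B K. *)
pose t : R := (20 * B)^-1.
have t0 : 0 < t by rewrite invr_gt0 mulr_gt0.
have upw w : \sum_(0 <= c < n) Re_ w c <=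
    t * B * \sum_(0 <= c < n) nrmL2 lambda (teval (w.2 c)) + (4 * t)^-1 * sqn w.1.
  rewrite -Re_sum -dot_suml -(act_gather n b w.2 x n).
  apply: le_trans (Re_dot_le _ _ t0) _; rewrite sqn_iter_uinv lerD2r.
  by rewrite -mulrA ler_wpM2l ?(ltW t0)// -(nrmL2_gather _ nb (leqnn n)).
have h1 : n%:R * (X / 2) <= \sum_(0 <= c < n) \sum_(w <- E) Re_ w c.
  rewrite mulr_natl (_ : X / 2 *+ n = \sum_(0 <= c < n) X / 2); last first.
    by rewrite sumr_const_nat subn0.
  rewrite big_nat [leRHS]big_nat.
  by apply: ler_sum => c /andP[_ cn]; exact: low.
rewrite exchange_big/= in h1.
have h2 : \sum_(w <- E) \sum_(0 <= c < n) Re_ w c <= \sum_(w <- E)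
    (t * B * \sum_(0 <= c < n) nrmL2 lambda (teval (w.2 c)) + (4 * t)^-1 * sqn w.1).
  by apply: ler_sum => w _; exact: upw.
rewrite big_split/= -!mulr_sumr in h2.
have h3 : \sum_(0 <= c < n) \sum_(w <- E) nrmL2 lambda (teval (w.2 c)) <=
    n%:R * (5 * X).
  rewrite mulr_natl (_ : 5 * X *+ n = \sum_(0 <= c < n) 5 * X); last first.
    by rewrite sumr_const_nat subn0.
  rewrite big_nat [leRHS]big_nat.
  apply: ler_sum => c /andP[_ cn]; have [_ r] := EP c cn.
  by apply: le_trans r _; rewrite sxs; lra.
have tB : t * B = 20^-1.
  by rewrite /t invfM -mulrA mulVf ?mulr1// gt_eqF.
have t4 : (4 * t)^-1 = 5 * B.
  by rewrite /t invfM invrK mulrA; congr (_ * B); field.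
rewrite tB t4 in h2.
have h4 : 5 * B * \sum_(w <- E) sqn w.1 <= 5 * B * K.
  by rewrite ler_wpM2l// mulr_ge0// ltW.
have h5 : n%:R * (X / 2) = n%:R * X / 2 by rewrite mulrA.
have h6 : n%:R * (5 * X) = 5 * (n%:R * X) by rewrite mulrCA.
rewrite h5 in h1; rewrite h6 exchange_big/= in h3; lra.
Qed.

(* The vector is the image of f under the spectral projection of the set where
   the density h of the spectral measure of f satisfies 1 / (m + 1) <= h <= m + 1. *)
Lemma bounded_vector_exists M f : pi_subspace pi M -> M f -> f != 0 ->
  exists x B, [/\ M x, x != 0, 0 < B &
    forall P, sqn (act P x) <= B * nrmL2 lambda (teval P)].
Proof.
move=> hM Mf f0; have [nu [fnu nu_lambda cut]] := pi_spectral f.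
have [h [mh h0 nu_h]] := density_exists nu_lambda.
have sf : 0 < sqn f.
  rewrite lt_neqAle sqn_ge0// andbT eq_sym.
  by apply: contra f0 => /eqP/(sqn_eq0 H_norm) ->.
have sf2 : 0 < sqn f / 2 by lra.
have [m mP] := band_exhaust mh h0 nu_h sf2.
set E := [set x | _] in mP.
have mE : measurable E.
  rewrite (_ : E = h @^-1` `[m.+1%:R^-1, m.+1%:R]).
    by rewrite -[X in measurable X]setTI; exact: mh.
  by apply/seteqP; split => x /=; rewrite in_itv.
have bE := bounded_measurable_indic R mE.
have bEC := bounded_cplx_real bE.
have [g gP] := cut E mE.
have one (y : H) : y = act [:: (1, 0)] y by rewrite act_single scale1r pi0.
have act0 y : act [::] y = 0 by rewrite /act big_nil.
have teval0 chi : teval ([::] : tpoly R A) chi = 0 by rewrite /teval big_nil.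
have tone chi : teval ([:: (1, 0)] : tpoly R A) chi = 1 by rewrite teval1 mul1r pairing0.
(* |f|^2 is the total mass of nu and |g|^2 the mass of the band, outside which at most half of the
   mass lies. *)
have gnorm : sqn f / 2 <= sqn g.
  have sfE : sqn f = \int[nu]_x (1 : R).
    rewrite {1}(one f) (sqn_act pi_rep _ fnu) /nrmL2.
    by under eq_Rintegral do rewrite tone sqmod1.
  have sgE : sqn g = \int[nu]_x (\1_E x : R).
    have := gP [:: (1, 0)] [::]; rewrite -one act0 addr0 => ->; rewrite /nrmL2.
    apply: eq_Rintegral => chi _; rewrite tone teval0 mulr1 addr0 sqmod_real indicE.
    by case: (_ \in _); rewrite ?expr1n ?expr0n.
  have bEc := bounded_measurable_indic R (measurableC mE).
  have : \int[nu]_x (1 : R) = \int[nu]_x (\1_E x : R) + \int[nu]_x (\1_(~` E) x : R).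
    rewrite -RintD//; apply: eq_Rintegral => chi _.
    by rewrite !indicE in_setC; case: (_ \in _); rewrite ?addr0 ?add0r.
  rewrite -sfE -sgE; lra.
exists g, m.+1%:R; split.
(* A polynomial Q close to 1_E in L^2(nu) gives Q(pi) f, a vector of M close to g. *)
- have [[_ _ _ Mcl] _] := hM; apply: Mcl => e e0.
  have e2 : 0 < e / 2 by lra.
  have [Q Qe] := tpoly_dense discreteA countableA nu bEC e2.
  exists (act Q f); first exact: pi_subspace_act.
  have -> : g - act Q f = act [:: (1, 0)] g + act (tmul [:: (-1, 0)] Q) f.
    by rewrite -one act_mul// act_single pi0// scaleN1r.
  rewrite gP; apply: le_lt_trans (_ : _ <= e / 2) _; last lra.
  apply: le_trans Qe; rewrite le_eqVlt; apply/orP; left; apply/eqP.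
  congr nrmL2; apply/funext => chi.
  by rewrite tone mulr1 teval_mul teval1 pairing0 mulr1 mulN1r.
- by apply/eqP => g0; move: gnorm; rewrite g0 sqn0; lra.
- by rewrite ltr0n.
- move=> P; have := gP P [::]; rewrite act0 addr0 => ->.
  have bP := bounded_teval P; have bs := bounded_cplx_sqmod bP.
  have uE chi : sqmod ((\1_E chi)%:C%C * teval P chi + teval ([::] : tpoly R A) chi) =
      \1_E chi * sqmod (teval P chi).
    rewrite teval0 addr0 sqmodM sqmod_real indicE.
    by case: (_ \in _); rewrite ?expr1n ?expr0n.
  have bEh : bounded_measurable (fun chi => \1_E chi * h chi).
    split; first by apply: measurable_funM => //; case: bE.
    exists m.+1%:R => chi; rewrite indicE.
    have [|_] := boolP (chi \in E); last by rewrite mul0r normr0.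
    by rewrite inE => /andP[_ hm]; rewrite mul1r ger0_norm.
  rewrite /nrmL2; under eq_Rintegral do rewrite uE.
  rewrite nu_h.
  + rewrite -RintZ//; apply: le_Rint => [||chi].
    * under eq_fun do rewrite mulrAC.
      exact: bounded_measurableM.
    * by apply: bounded_measurableM => //; exact: bounded_measurable_cst.
    rewrite mulrAC ler_wpM2r ?sqmod_ge0// indicE.
    have [|_] := boolP (chi \in E); last by rewrite mul0r.
    by rewrite inE => /andP[_ hm]; rewrite mul1r.
  + exact: bounded_measurableM.
  + by move=> chi; rewrite mulr_ge0 ?sqmod_ge0// indicE.
  + under eq_fun do rewrite mulrAC.
    exact: bounded_measurableM.
Qed.

End Counting.

(** * Closed linear spans *)

Section Closures.
Variables (R : realType) (H : completeNormedModType (Cplx R)).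
Local Notation C := (Cplx R).
Variable dot : {dot H for (@conjC C)}.
Hypothesis H_norm : hilbert_norm dot.
Local Notation sqn := (sqn dot).
Implicit Types (x y : H) (V : set H).

Let norm_lt x (e : R) : 0 < e -> (`|x| < e%:C%C) = (sqn x < e ^+ 2).
Proof.
move=> e0; rewrite -(@ltr_pXn2r _ 2)// ?nnegrE ?leCR ?(ltW e0)//.
by rewrite (norm_sqn H_norm) -rmorphXn/= ltCR.
Qed.

Lemma closure_sqn V x : closure V x <->
  forall e, 0 < e -> exists2 y, V y & sqn (x - y) < e.
Proof.
split=> [clx e e0|h B].
  have se : 0 < Num.sqrt e by rewrite sqrtr_gt0.
  have seC : (0 : C) < (Num.sqrt e)%:C%C by rewrite ltCR.
  have [y [Vy xy]] := clx _ (nbhsx_ballx x _ seC).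
  exists y => //; move: xy; rewrite -ball_normE/= norm_lt// sqr_sqrtr//.
  exact: ltW.
move=> /nbhs_ballP[e /= e0 eB].
have eE : e = (complex.Re e)%:C%C.
  by move: e0; rewrite ltcE => /andP[/eqP ? _]; exact: complex_eq.
have r0 : 0 < complex.Re e by rewrite eE ltCR in e0.
have [|y Vy xy] := h (complex.Re e ^+ 2); first by rewrite exprn_gt0.
exists y; split => //; apply: eB; rewrite -ball_normE/= eE norm_lt//.
Qed.

(** In [linear_span] the coefficient is a function of the vector, so repeated entries share it.
    Repetitions are removed first, and a vector already listed only has its coefficient changed. *)
Lemma linear_span_consL (B : set H) x v (c : C) : B x -> linear_span B v ->
  linear_span B (c *: x + v).
Proof.
have uniqspan w : linear_span B w -> exists s (d : H -> C), [/\ uniq s,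
    forall y, y \in s -> B y & w = \sum_(y <- s) d y *: y].
  move=> [s [d [sB ->]]]; elim: s sB => [|y s IH] sB.
    by exists [::], d; split => //; rewrite !big_nil.
  have [z zs|t [f [ut tB E]]] := IH; first by apply: sB; rewrite inE zs orbT.
  rewrite big_cons E; have [yt|yt] := boolP (y \in t).
    exists t, (fun z => f z + (z == y)%:R * d y); split => //.
    under [RHS]eq_bigr do rewrite scalerDl.
    rewrite big_split/= addrC; congr (_ + _).
    rewrite (bigD1_seq y)//= eqxx mul1r big1 ?addr0// => z /negPf ->.
    by rewrite mul0r scale0r.
  exists (y :: t), (fun z => if z == y then d y else f z); split.
  - by rewrite /= yt.
  - by move=> z; rewrite inE => /predU1P[->|/tB//]; apply: sB; rewrite inE eqxx.
  - rewrite big_cons eqxx; congr (_ + _); apply: eq_big_seq => z zt.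
    by case: eqP => // zy; move: yt; rewrite -zy zt.
move=> Bx /uniqspan[t [f [ut tB ->]]]; have [xt|xt] := boolP (x \in t).
  exists t, (fun z => f z + (z == x)%:R * c); split => //.
  under [RHS]eq_bigr do rewrite scalerDl.
  rewrite big_split/= addrC; congr (_ + _).
  rewrite (bigD1_seq x)//= eqxx mul1r big1 ?addr0// => z /negPf ->.
  by rewrite mul0r scale0r.
exists (x :: t), (fun z => if z == x then c else f z); split.
  by move=> z; rewrite inE => /predU1P[->//|/tB].
rewrite big_cons eqxx; congr (_ + _); apply: eq_big_seq => z zt.
by case: eqP => // zx; move: xt; rewrite -zx zt.
Qed.

Lemma linear_spanD (B : set H) v w : linear_span B v -> linear_span B w ->
  linear_span B (v + w).
Proof.
move=> [s [c [sB ->]]] Bw; elim: s sB => [|x s IH] sB.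
  by rewrite big_nil add0r.
rewrite big_cons -addrA; apply: linear_span_consL; first by apply: sB; rewrite inE eqxx.
by apply: IH => y ys; apply: sB; rewrite inE ys orbT.
Qed.

Lemma linear_spanZ (B : set H) (c : C) v : linear_span B v ->
  linear_span B (c *: v).
Proof.
move=> [s [d [sB ->]]]; exists s, (fun x => c * d x); split => //.
by rewrite scaler_sumr; apply: eq_bigr => x _; rewrite scalerA.
Qed.

Lemma mem_linear_span (B : set H) x : B x -> linear_span B x.
Proof.
move=> Bx; exists [:: x], (fun=> 1); split; last by rewrite big_seq1 scale1r.
by move=> y; rewrite inE => /eqP ->.
Qed.

Lemma linear_span_sub (B M : set H) : closed_subspace dot M -> B `<=` M ->
  closure (linear_span B) `<=` M.
Proof.
move=> [M0 MD MZ Mcl] BM x /closure_sqn clx; apply: Mcl => e /clx[y By xy].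
exists y => //; have [s [c [sB ->]]] := By; elim: s sB {By xy} => [|z s IH] sB.
  by rewrite big_nil.
rewrite big_cons; apply: MD; first by apply: MZ; apply: BM; apply: sB; rewrite inE eqxx.
by apply: IH => t ts; apply: sB; rewrite inE ts orbT.
Qed.

Lemma closure_linear_span_subspace (B : set H) :
  closed_subspace dot (closure (linear_span B)).
Proof.
split.
- apply/closure_sqn => e e0; exists 0; last by rewrite subr0 sqn0.
  by exists [::], (fun=> 0); split => //; rewrite big_nil.
- move=> x y /closure_sqn hx /closure_sqn hy; apply/closure_sqn => e e0.
  have e4 : 0 < e / 4 by lra.
  have [x' Bx xx] := hx _ e4; have [y' By' yy] := hy _ e4.
  exists (x' + y'); first exact: linear_spanD.
  rewrite opprD addrACA; apply: le_lt_trans (sqnD_le H_norm _ _) _; lra.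
- move=> c x /closure_sqn hx; apply/closure_sqn => e e0.
  pose K := sqmod c + 1; have K0 : 0 < K by rewrite ltr_wpDl ?sqmod_ge0.
  have [y By' xy] := hx _ (divr_gt0 e0 K0).
  exists (c *: y); first exact: linear_spanZ.
  rewrite -scalerBr sqnZ; rewrite ltr_pdivlMr// in xy; apply: le_lt_trans xy.
  by rewrite mulrC ler_wpM2l ?(sqn_ge0 H_norm)// /K lerDl.
- move=> x hx; apply/closure_sqn => e e0; have e4 : 0 < e / 4 by lra.
  have [y /closure_sqn hy xy] := hx _ e4; have [z Bz yz] := hy _ e4.
  exists z => //; apply: le_lt_trans (sqn_triangle H_norm _ y _) _; lra.
Qed.

End Closures.

(** * Linear relations in the affine system *)

Section AffineSystem.
Variables (R : realType) (H : completeNormedModType (Cplx R)).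
Local Notation C := (Cplx R).
Variable dot : {dot H for (@conjC C)}.
Hypothesis H_norm : hilbert_norm dot.
Variable A : PreTopologicalZmodule.type.
Hypothesis discreteA : forall a : A, open [set a].
Hypothesis countableA : countable [set: A].
Variable pi : A -> unitary_op dot.
Hypothesis pi_rep : unitary_rep pi.
Local Notation dA := (borel (dual R A)).
Local Notation sqn := (sqn dot).
Local Notation act := (act pi).
Variable lambda : probability dA R.
Hypothesis lambda_invariant : forall (x : dual R A) (E : set dA),
  measurable E -> lambda ((fun y : dual R A => x + y) @` E) = lambda E.
Hypothesis tpoly_neq0 : forall P : tpoly R A, uniq (unzip2 P) ->
  (exists2 t, t \in P & t.1 != 0) -> lambda [set chi | teval P chi = 0] = 0%E.
Hypothesis pi_spectral : forall f, exists nu, spectral pi lambda f nu.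
Variable alpha : {additive A -> A}.
Hypothesis alpha_inj : injective alpha.
Variable b : A.
Hypothesis alpha_b : forall a, alpha a <> b.
Variable delta : unitary_op dot.
Hypothesis delta_pi : forall a x, uinv delta (pi a (delta x)) = pi (alpha a) x.
Variable psi : H.
Hypothesis V0_invariant : pi_invariant pi (negative_dilates pi delta psi).
Local Notation delta' := (uinv delta).

Let psi_ n := iter n delta' psi.

Lemma uval_upow j x : delta (upow delta j x) = upow delta (j + 1) x.
Proof.
case: j => [n|[|n]]; first by rewrite -PoszD addn1.
- by rewrite NegzE addNr /= uinvK.
- by rewrite (_ : Negz n.+1 + 1 = Negz n) /= ?uinvK// !NegzE -[n.+2]addn1 PoszD opprD subrK.
Qed.

Lemma upow_uinv j x : upow delta j (delta' x) = delta' (upow delta j x).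
Proof.
case: j => n; last by rewrite /= -iterSr.
by elim: n => [//|n IH]; rewrite /= [iter n _ _]IH uinvK uvalK.
Qed.

Lemma upow_iter_uinv (j : int) n x :
  upow delta (j + n%:Z) (iter n delta' x) = upow delta j x.
Proof.
elim: n => [|n IH]; first by rewrite addr0.
by rewrite -addn1 PoszD addrA -uval_upow addn1 iterS upow_uinv IH uinvK.
Qed.

Lemma upow_lincomb j (I : Type) (s : seq I) (c : I -> C) (u : I -> H) :
  upow delta j (\sum_(i <- s) c i *: u i) =
  \sum_(i <- s) c i *: upow delta j (u i).
Proof.
case: j => n; elim: n => [//|n IH].
- by rewrite /= [iter n _ _]IH raddf_sum; apply: eq_bigr => i _; rewrite /= linearZ.
- by rewrite /= uinv_sum; apply: eq_bigr => i _; rewrite uinvZ.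
- move: IH; rewrite /= => ->; rewrite uinv_sum.
  by apply: eq_bigr => i _; rewrite uinvZ.
Qed.

Lemma upow_eq0 j x : upow delta j x = 0 -> x = 0.
Proof.
move=> /(congr1 sqn); rewrite sqn0.
have -> : sqn (upow delta j x) = sqn x.
  by case: j => n; [exact: sqn_iter_uval|exact: sqn_iter_uinv].
exact: sqn_eq0.
Qed.

(* A common level normalization: the largest level of the relation becomes 0,
   and level j becomes the power delta^-k with k = j_max - j. *)
Lemma nontrivial_relation (s : seq (int * A)) (c : int * A -> C) : uniq s ->
  \sum_(i <- s) c i *: affine_system pi delta psi i = 0 ->
  (exists2 i, i \in s & c i != 0) ->
  exists K (Q : nat -> tpoly R A), [/\ forall k, uniq (unzip2 (Q k)),
    exists2 t, t \in Q 0%N & t.1 != 0, exists2 t, t \in Q K & t.1 != 0 &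
    \sum_(0 <= k < K.+1) act (Q k) (psi_ k) = 0].
Proof.
(* Zero coefficients are dropped, so that the extreme levels carry nonzero ones. *)
move=> us rel [i0 i0s ci0]; pose s' := [seq i <- s | c i != 0].
have i0s' : i0 \in s' by rewrite mem_filter ci0.
have us' : uniq s' by exact: filter_uniq.
have max_ex (f : int * A -> int) (t : seq (int * A)) i : i \in t ->
    exists2 m, m \in t & forall j, j \in t -> f j <= f m.
  elim: t i => // x [_ i _|y t IH i _].
    by exists x; rewrite ?mem_seq1// => j; rewrite inE => /eqP ->.
  have [m mt hm] := IH y (mem_head _ _).
  have [fxm|fmx] := leP (f x) (f m).
    exists m; first by rewrite inE mt orbT.
    by move=> j; rewrite inE => /predU1P[->//|/hm].
  exists x; first exact: mem_head.
  by move=> j; rewrite inE => /predU1P[->//|/hm /le_trans]; apply; exact: ltW.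
have [im ims imP] := max_ex fst s' i0 i0s'.
have [iM iMs iMP] := max_ex (fun i => - i.1) s' i0 i0s'.
pose k (i : int * A) : nat := `|im.1 - i.1|%N.
have kE i : i \in s' -> im.1 = i.1 + (k i)%:Z.
  move=> /imP h; rewrite /k gez0_abs ?subr_ge0//.
  by rewrite addrCA subrr addr0.
pose K := k iM.
have kK i : i \in s' -> (k i <= K)%N.
  move=> is'; rewrite -lez_nat -(lerD2l i.1) -kE// (kE iM)// lerD2r.
  by have := iMP _ is'; rewrite lerN2.
(* Moving delta^-m past pi(a) turns a into alpha^m(a). Frequencies stay distinct within a level
   since alpha is injective. *)
pose Q m : tpoly R A := [seq (c i, iter m alpha i.2) | i <- s' & k i == m].
exists K, Q; split.
- move=> m; rewrite /unzip2 -map_comp map_inj_in_uniq ?filter_uniq//.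
  move=> i j; rewrite mem_filter => /andP[/eqP ki is'].
  rewrite mem_filter => /andP[/eqP kj js'] /=.
  move=> /(iter_alpha_inj alpha_inj) ij2.
  have : i.1 = j.1.
    have := kE i is'; rewrite (kE j js') ki kj => /(congr1 (fun z => z - m%:Z)).
    by rewrite !addrK.
  by case: i j ij2 {ki is' kj js'} => [? ?] [? ?] /= -> ->.
- exists (c im, iter 0 alpha im.2).
    apply/mapP; exists im => //; rewrite mem_filter ims andbT.
    by rewrite /k subrr.
  by move: ims; rewrite mem_filter => /andP[].
- exists (c iM, iter K alpha iM.2).
    by apply/mapP; exists iM => //; rewrite mem_filter iMs eqxx.
  by move: iMs; rewrite mem_filter => /andP[].
have rel' : \sum_(i <- s') c i *: affine_system pi delta psi i = 0.
  rewrite -[RHS]rel big_filter [RHS](bigID (fun i => c i != 0))/= [X in _ + X]big1 ?addr0//.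
  by move=> i /negPn/eqP ->; rewrite scale0r.
apply: (@upow_eq0 im.1); rewrite -[RHS]rel'.
have -> : \sum_(0 <= m < K.+1) act (Q m) (psi_ m) =
    \sum_(i <- s') c i *: pi (iter (k i) alpha i.2) (psi_ (k i)).
  under eq_bigr do rewrite /act /Q big_map big_filter/=.
  rewrite (exchange_big_dep xpredT)//=; apply: eq_big_seq => i is'.
  under eq_bigl do rewrite eq_sym.
  by rewrite big_nat1_eq ltnS kK.
rewrite upow_lincomb; apply: eq_big_seq => i is'; congr (_ *: _).
by rewrite /affine_system -(iter_uinv_pi delta_pi) (kE i is') upow_iter_uinv.
Qed.

Lemma affine_system_uval ja :
  delta (affine_system pi delta psi ja) = affine_system pi delta psi (ja.1 + 1, ja.2).
Proof. by rewrite /affine_system uval_upow. Qed.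

Lemma negative_dilates_pi_subspace : pi_subspace pi (negative_dilates pi delta psi).
Proof. by split=> //; exact: closure_linear_span_subspace. Qed.

Lemma preimage_uinv_pi_subspace M : pi_subspace pi M ->
  pi_subspace pi [set x | M (delta' x)].
Proof.
move=> [[M0 MD MZ Mcl] Mpi]; split; first split => /=.
- by rewrite uinv0.
- by move=> x y Mx My; rewrite uinvD; exact: MD.
- by move=> c x Mx; rewrite uinvZ; exact: MZ.
- move=> x hx; apply: Mcl => e /hx[y My xy]; exists (delta' y) => //.
  by rewrite -uinvB sqn_uinv.
- move=> a _ [x Mx <-] /=; rewrite (uinv_pi delta_pi); apply: Mpi.
  by exists (delta' x).
Qed.

(** Invariance is not claimed here: delta pi(a) x is pi(c) delta x only when a = alpha(c). For
    [uinv delta] each pi(a) becomes pi(alpha a), so the previous preimage is invariant. *)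
Lemma preimage_uval_closed_subspace M : closed_subspace dot M ->
  closed_subspace dot [set x | M (delta x)].
Proof.
move=> [M0 MD MZ Mcl]; split => /=.
- by rewrite raddf0.
- by move=> x y Mx My; rewrite raddfD; exact: MD.
- by move=> c x Mx; rewrite linearZ; exact: MZ.
- move=> x hx; apply: Mcl => e /hx[y My xy]; exists (delta y) => //.
  by rewrite -raddfB sqn_uval.
Qed.

Lemma affine_system_independent : psi != 0 ->
  linearly_independent (affine_system pi delta psi).
Proof.
move=> psi0 s c us rel i is_; apply: contrapT => /eqP ci.
have [K [Q [uQ [t0 t0Q t00] [tK tKQ tK0] {}rel]]] :=
  nontrivial_relation us rel (ex_intro2 _ _ i is_ ci).
(* For K = 0 the list is empty and M is the zero space; the argument covers this case as well. *)
pose gens := [seq psi_ k | k <- iota 1 K].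
pose M := pi_span pi gens.
have hM : pi_subspace pi M by exact: pi_span_subspace.
have [[M0 MD MZ Mcl] Mpi] := hM.
have MS (I : Type) (r : seq I) (P : pred I) (u : I -> H) :
    (forall i, P i -> M (u i)) -> M (\sum_(i <- r | P i) u i).
  by move=> h; elim/big_rec: _ => // j x Pj Mx; apply: MD => //; exact: h.
have MN x y : x + y = 0 -> M y -> M x.
  by move=> /eqP; rewrite addr_eq0 => /eqP -> My; rewrite -scaleN1r; exact: MZ.
have Mgen k : (0 < k)%N -> (k <= K)%N -> M (psi_ k).
  move=> k0 kK; apply: mem_pi_span; apply/mapP; exists k => //.
  by rewrite mem_iota k0 add1n ltnS.
have Mpsi0 : M (psi_ 0).
  apply: (pi_subspace_absorb H_norm pi_rep pi_spectral hM (Q := Q 0%N)).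
    by apply: tpoly_neq0 => //; exists t0.
  apply: (MN _ (\sum_(1 <= k < K.+1) act (Q k) (psi_ k))).
    by rewrite -big_ltn.
  rewrite big_nat; refine (MS _ _ _ _ _) => k /andP[k1 kK].
  exact: (pi_subspace_act _ hM (Mgen _ k1 kK)).
have Mle k : (k <= K)%N -> M (psi_ k) by case: k => // k kK; exact: Mgen.
(* After delta^-1 the top coefficient is Q_K with its frequencies mapped by alpha, still distinct,
   and all other terms lie in M. *)
have MpsiK : M (psi_ K.+1).
  apply: (pi_subspace_absorb H_norm pi_rep pi_spectral hM (Q := tmap alpha (Q K))).
    apply: tpoly_neq0; last by exists (tK.1, alpha tK.2) => //; apply/mapP; exists tK.
    rewrite /unzip2 /tmap -map_comp (map_comp alpha snd) map_inj_uniq//; exact: uQ.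
  have := congr1 delta' rel; rewrite uinv0 uinv_sum big_nat_recr//= addrC => h.
  rewrite -(uinv_act delta_pi); apply: (MN _ _ h).
  rewrite big_nat; refine (MS _ _ _ _ _) => k /andP[_ kK].
  by rewrite (uinv_act delta_pi); exact: (pi_subspace_act _ hM (Mle _ kK)).
have Mdelta' x : M x -> M (delta' x).
  move=> Mx; apply: (Mx [set x | M (delta' x)]).
    exact: preimage_uinv_pi_subspace.
  move=> _ /mapP[k + ->] /=; rewrite mem_iota add1n ltnS => /andP[_ kK].
  rewrite -iterS; move: kK; rewrite leq_eqVlt => /predU1P[->//|kK].
  exact: (Mle _ kK).
(* The rest of the proof combines two inclusions: M in V_0, by the invariance of V_0, and delta V_0
   in M, since delta raises a negative level to some -n <= 0 and delta^-n pi(a) psi = pi(alpha^n a)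
   psi_n. *)
have Mpsi k : M (psi_ k) by elim: k => // k /Mdelta'.
have MV x : M x -> negative_dilates pi delta psi x.
  move=> Mx; apply: (Mx _ negative_dilates_pi_subspace) => _ /mapP[k + ->].
  rewrite mem_iota => /andP[k0 _]; apply: subset_closure; apply: mem_linear_span.
  exists (Negz k.-1, 0) => //=; rewrite /affine_system/= pi0// -iterS prednK//.
have VM : negative_dilates pi delta psi `<=` [set x | M (delta x)].
  apply: (linear_span_sub H_norm); first exact: preimage_uval_closed_subspace.
  move=> _ [[j a] /= j0 <-] /=; rewrite affine_system_uval /affine_system/=.
  have [n ->] : exists n : nat, j + 1 = - n%:Z.
    by case: j j0 => // n _; exists n; rewrite NegzE -addn1 PoszD opprD subrK.
  have -> : upow delta (- n%:Z) (pi a psi) = iter n delta' (pi a psi).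
    by case: n => // n; rewrite -NegzE.
  by rewrite (iter_uinv_pi delta_pi); apply: Mpi; exists (psi_ n).
have [B hB] := pi_span_synthesizable H_norm discreteA countableA pi_rep pi_spectral gens.
have [x [B' [Mx x0 B'0 xB]]] :=
  bounded_vector_exists H_norm discreteA countableA pi_rep pi_spectral hM Mpsi0 psi0.
move/eqP: x0; apply.
by apply: (bounded_vector_eq0 H_norm discreteA countableA pi_rep lambda_invariant
  alpha_inj delta_pi alpha_b hM _ hB Mx B'0 xB) => y /MV/VM.
Qed.

End AffineSystem.

Unset Implicit Arguments.

Theorem theorem1 (R : realType) (G : topologicalZmodType)
  (G_second_countable : @second_countable G)
  (G_locally_compact : locally_compact [set: G])
  (G_hausdorff : hausdorff_space G)
  (haarG : {measure set (borel G) -> \bar R})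
  (haarG_haar : is_haar haarG)
  (Gamma : zmodClosed G)
  (Gamma_closed : closed [set` Gamma])
  (Gamma_countable : countable [set` Gamma])
  (Gamma_discrete : discrete_subgroup Gamma)
  (lambda : probability (borel (dual R (subgroup Gamma))) R)
  (lambda_haar : is_haar lambda)
  (alpha : {additive subgroup Gamma -> subgroup Gamma})
  (alpha_inj : injective alpha)
  (N : nat) (N_gt1 : (1 < N)%N)
  (alpha_index : (cosets alpha #= `I_N)%card)
  (alpha_ergodic :
    ergodic lambda
      (dual_map (f := alpha)
         (discrete_continuous (f := alpha) Gamma_discrete)))
  (H : completeNormedModType (Cplx R)) (dot : {dot H for (@conjC (Cplx R))})
  (H_norm : hilbert_norm dot) (H_separable : separable_space H)
  (pi : subgroup Gamma -> unitary_op dot) (pi_rep : unitary_rep pi)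
  (mu : {finite_measure set (borel (dual R (subgroup Gamma))) -> \bar R})
  (mu_spectral : is_spectral_measure pi mu)
  (mu_abs_cont : mu `<< lambda)
  (delta : unitary_op dot)
  (delta_pi : forall (g : subgroup Gamma) (x : H),
    uinv delta (pi g (delta x)) = pi (alpha g) x)
  (translates_indep : translates_independent Gamma haarG)
  (psi : H) (psi_neq0 : psi != 0)
  (V0_invariant : pi_invariant pi (negative_dilates pi delta psi)) :
  linearly_independent (affine_system pi delta psi).
Proof.
(* If alpha were onto there would be a single coset, against N > 1. *)
have [b alpha_b] : exists b, forall a, alpha a <> b.
  apply: contrapT => alpha_surj.
  have alphaE b : exists a, alpha a = b.
    by apply: contrapT => h; apply: alpha_surj; exists b => a ab; apply: h; exists a.
  have coset_setT : cosets alpha `<=` [set setT].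
    move=> _ [b _ <-] /=; apply/seteqP; split=> // x _.
    by have [a ab] := alphaE (x - b); exists a => //; rewrite ab addrC subrK.
  have : (`I_N #<= [set @setT (subgroup Gamma)])%card.
    apply: card_le_trans (subset_card_le coset_setT).
    by rewrite card_eq_le in alpha_index; case/andP: alpha_index.
  by rewrite (card_le_eqr card_set1) card_le_II leqNgt N_gt1.
have [lambda_invariant _ _] := lambda_haar.
apply: (affine_system_independent H_norm (subgroup_set1_open Gamma_discrete)
  (subgroup_countable Gamma_countable) pi_rep lambda_invariant _
  (spectral_exists H_norm pi_rep mu_spectral mu_abs_cont) alpha_inj alpha_b
  delta_pi V0_invariant psi_neq0).
exact: (tpoly_uniq_neq0_ae G_locally_compact haarG_haar Gamma_countable
  Gamma_discrete lambda_haar translates_indep).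
Qed.
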